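(* Consider the extended rigid body system on $\mathbb{R}^{3\times3}\times\mathbb{R}^3$, $$\dot R=R\hat\Omega-k_{\rm e}R(R^TR-I),\qquad \dot\Omega=\mathbb{I}^{-1}(\mathbb{I}\Omega\times\Omega)+\mathbb{I}^{-1}u,$$ with $k_{\rm e}>0$, and a bounded reference trajectory $(R_0(t),\Omega_0(t))\in\mathrm{SO}(3)\times\mathbb{R}^3$ with bounded control $u_0(t)$, $t\ge0$, satisfying $\dot R_0=R_0\hat\Omega_0$ and $\dot\Omega_0=\mathbb{I}^{-1}(\mathbb{I}\Omega_0\times\Omega_0)+\mathbb{I}^{-1}u_0$. Let $\Delta R=R-R_0(t)$, $\Delta\Omega=\Omega-\Omega_0(t)$, $\Delta u=u-u_0(t)$, $Z=R_0(t)^T\Delta R$, $Z_k=\tfrac12(Z-Z^T)$. Let $z_{\rm o}=(Z^\vee_{k,\rm est},\Delta\Omega_{\rm est})\in\mathbb{R}^3\times\mathbb{R}^3$ be the state of the observer $$\dot z_{\rm o}=A(t)z_{\rm o}+B\Delta u-L(t)(Cz_{\rm o}-Z_k^\vee),\qquad L(t)=P(t)C^T\tilde R^{-1}(t),$$ where $$A(t)=\begin{bmatrix}-\hat\Omega_0(t)&I\\0&\mathbb{I}^{-1}(\widehat{\mathbb{I}\Omega_0(t)}-\hat\Omega_0(t)\mathbb{I})\end{bmatrix},\quad B=\begin{bmatrix}0\\ \mathbb{I}^{-1}\end{bmatrix},\quad C=\begin{bmatrix}I&0\end{bmatrix},$$ and $P(t)$ is the solution of $\dot P=PA^T(t)+A(t)P-PC^T\tilde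 R^{-1}(t)CP+Q(t)$, with $\tilde R(t)=\tilde R^T(t)$ and $Q(t)=Q^T(t)$ such that $\gamma_1I\le Q(t)\le\gamma_2I$ and $\gamma_3I\le\tilde R(t)\le\gamma_4I$ for all $t\ge0$ for some positive numbers $\gamma_1,\dots,\gamma_4$. Let $k_P>0$ and let $K_D=K_D^T\in\mathbb{R}^{3\times3}$ be positive definite. If $\Omega_0(t)$ is periodic, then the controller $$u=u_0-(\mathbb{I}\Delta\Omega_{\rm est})\times\Omega_0-(\mathbb{I}\Omega_0)\times\Delta\Omega_{\rm est}-\mathbb{I}(k_PZ^\vee_{k,\rm est}+K_D\Delta\Omega_{\rm est})$$ exponentially stabilizes the tracking error dynamics, i.e. the dynamics of $(\Delta R,\Delta\Omega)$ (equivalently, of $(Z,\Delta\Omega)$).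
   Context: $\mathbb{I}$ is the ($3\times3$, symmetric positive definite) moment of inertia matrix. For $\Omega=(\Omega_1,\Omega_2,\Omega_3)\in\mathbb{R}^3$, $\hat\Omega$ is the skew-symmetric matrix with $\hat\Omega y=\Omega\times y$ for all $y\in\mathbb{R}^3$; $\vee$ denotes the inverse map, so $(\hat\Omega)^\vee=\Omega$. On $\mathrm{SO}(3)\times\mathbb{R}^3$ the extended system coincides with the rigid body system $\dot R=R\hat\Omega$, $\dot\Omega=\mathbb{I}^{-1}(\mathbb{I}\Omega\times\Omega)+\mathbb{I}^{-1}u$. The measured output is $R$. $Q(t)$ and $\tilde R(t)$ are continuous, and $P(0)=P(0)^T\ge0$. ''Exponentially stabilizes the tracking error dynamics'' means: for the closed loop consisting of the extended rigid body system and the observer, written in the variables $(\Delta R,\Delta\Omega,e_{\rm o})$ with $e_{\rm o}=(Z_k^\vee,\Delta\Omega)-z_{\rm o}$, the origin is an exponentially stable equilibrium point: there are $c,\kappa,\lambda>0$ such that every solution $\xi$ with $\|\xi(t_0)\|<c$ satisfies $\|\xi(t)\|\le\kappa\|\xi(t_0)\|e^{-\lambda(t-t_0)}$ for all $t\ge t_0\ge0$. *)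

(* Defs.v *)
From HB Require Import structures.
From mathcomp Require Import all_boot all_order all_algebra.
From mathcomp Require Import all_classical all_reals all_analysis.
From mathcomp Require Import ring.

Set Implicit Arguments.
Unset Strict Implicit.
Unset Printing Implicit Defensive.

Import Order.TTheory GRing.Theory Num.Theory.
Import numFieldNormedType.Exports.

Local Open Scope classical_set_scope.
Local Open Scope ring_scope.

Definition cross (R : realType) (x y : 'cV[R]_3) : 'cV[R]_3 :=
  \col_i [:: x 1 0 * y 2 0 - x 2 0 * y 1 0;
             x 2 0 * y 0 0 - x 0 0 * y 2 0;
             x 0 0 * y 1 0 - x 1 0 * y 0 0]`_i.

Definition hat (R : realType) (w : 'cV[R]_3) : 'M[R]_3 :=
  \matrix_(i, j) (nth [::] [:: [::       0; - w 2 0;   w 1 0];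
                              [::   w 2 0;       0; - w 0 0];
                              [:: - w 1 0;   w 0 0;       0]] i)`_j.

(* Meaningful on skew-symmetric matrices only, where it inverts [hat]
   (see [hatK] and [veeK]). *)
Definition vee (R : realType) (M : 'M[R]_3) : 'cV[R]_3 :=
  \col_i [:: M 2 1; M 0 2; M 1 0]`_i.

Lemma hat_mulE (R : realType) (w y : 'cV[R]_3) : hat w *m y = cross w y.
Proof.
apply/matrixP => i j; rewrite ord1 !mxE !big_ord_recl big_ord0 !mxE.
have -> : lift ord0 (ord0 : 'I_2) = 1 :> 'I_3 by apply/val_inj.
have -> : lift ord0 (lift ord0 (ord0 : 'I_1)) = 2 :> 'I_3 by apply/val_inj.
by case: i => [[|[|[|]]]] //= _; ring.
Qed.

Lemma hatK (R : realType) (w : 'cV[R]_3) : vee (hat w) = w.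
Proof.
apply/matrixP => i j; rewrite ord1 !mxE.
by case: i => [[|[|[|]]]] //= h; congr (w _ _); apply/val_inj.
Qed.

Lemma veeK (R : realType) (M : 'M[R]_3) : M^T = - M -> hat (vee M) = M.
Proof.
move=> skewM; have skew i j : M i j = - M j i.
  by have /matrixP/(_ j i) := skewM; rewrite !mxE.
have diag i : M i i = 0.
  by apply/eqP; rewrite -[_ == 0](mulrn_eq0 _ 2) mulr2n {1}skew addNr.
have ext (i i' j j' : 'I_3) : i = i' :> nat -> j = j' :> nat ->
  M i j = M i' j' by move=> /val_inj -> /val_inj ->.
apply/matrixP => i j; rewrite !mxE.
by case: i => [[|[|[|]]]] //= hi; case: j => [[|[|[|]]]] //= hj;
  first [ exact: ext | rewrite -skew; exact: ext
        | rewrite -(diag (Ordinal hi)); exact: ext ].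
Qed.

Definition SO3 (R : realType) : set 'M[R]_3 :=
  [set M | M^T *m M = 1%:M /\ \det M = 1].

Definition loewner_le (R : realType) (n : nat) (M N : 'M[R]_n) : Prop :=
  forall x : 'cV[R]_n, (x^T *m M *m x) 0 0 <= (x^T *m N *m x) 0 0.

Definition sym_posdef (R : realType) (n : nat) (M : 'M[R]_n) : Prop :=
  M^T = M /\ forall x : 'cV[R]_n, x != 0 -> 0 < (x^T *m M *m x) 0 0.

(* Derivative relative to [D]: the usual two-sided derivative at interior
   points, the one-sided one at an endpoint of an interval [D]. *)
Definition has_derivative_within (R : realType) (V : normedModType R)
    (D : set R) (x : R -> V) (t : R) (v : V) : Prop :=
  h^-1 *: (x (t + h) - x t) @[h --> within [set h | D (t + h)] 0^'] --> v.

Definition solves_on (R : realType) (V : normedModType R) (D : set R)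
    (x rhs : R -> V) : Prop :=
  forall t, D t -> has_derivative_within D x t (rhs t).

(* [t0, T[, where T may be infinite *)
Definition horizon (R : realType) (t0 : R) (T : \bar R) : set R :=
  [set t | t0 <= t /\ (t%:E < T)%E].

(* [sol t0 T] is the set of solutions on [t0, T[ of a nonautonomous system.
   Solutions that might exist on a bounded interval only are also subject to
   the estimate; every small initial state is required to start a solution that
   exists for all t >= t0.  Taking xi0 = 0, the origin is an equilibrium. *)
Definition exponentially_stable (R : realType) (V : normedModType R)
    (sol : R -> \bar R -> set (R -> V)) : Prop :=
  exists c kappa lambda : R,
    [/\ 0 < c, 0 < kappa, 0 < lambda &
      forall t0 : R, 0 <= t0 ->
        (forall xi0 : V, `|xi0| < c ->
           exists2 xi, sol t0 +oo%E xi & xi t0 = xi0) /\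
        (forall (T : \bar R) xi, sol t0 T xi -> `|xi t0| < c ->
           forall t, horizon t0 T t ->
             `|xi t| <= kappa * `|xi t0| * expR (- lambda * (t - t0)))].

Section RigidBody.
Variables (R : realType) (J : 'M[R]_3).
Implicit Types (Rot : 'M[R]_3) (Om u : 'cV[R]_3) (z : 'cV[R]_(3 + 3)).

Definition rigid_body_R Rot Om : 'M[R]_3 := Rot *m hat Om.

Definition rigid_body_Om Om u : 'cV[R]_3 :=
  invmx J *m cross (J *m Om) Om + invmx J *m u.

Definition extended_R (ke : R) Rot Om : 'M[R]_3 :=
  Rot *m hat Om - ke *: (Rot *m (Rot^T *m Rot - 1%:M)).

Definition obsA Om0 : 'M[R]_(3 + 3) :=
  block_mx (- hat Om0) 1%:M
           0           (invmx J *m (hat (J *m Om0) - hat Om0 *m J)).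

Definition obsB : 'M[R]_(3 + 3, 3) := col_mx 0 (invmx J).

Definition obsC : 'M[R]_(3, 3 + 3) := row_mx 1%:M 0.

Definition riccati Om0 (Q : 'M[R]_(3 + 3)) (Rt : 'M[R]_3)
    (P : 'M[R]_(3 + 3)) : 'M[R]_(3 + 3) :=
  P *m (obsA Om0)^T + obsA Om0 *m P
  - P *m obsC^T *m invmx Rt *m obsC *m P + Q.

Definition Zk_vee Rot0 Rot : 'cV[R]_3 :=
  let Z := Rot0^T *m (Rot - Rot0) in vee (2^-1 *: (Z - Z^T)).

Definition observer Om0 (P : 'M[R]_(3 + 3)) (Rt : 'M[R]_3) z
    (du y : 'cV[R]_3) : 'cV[R]_(3 + 3) :=
  let L := P *m obsC^T *m invmx Rt in
  obsA Om0 *m z + obsB *m du - L *m (obsC *m z - y).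

Definition controller (kP : R) (KD : 'M[R]_3) Om0 u0 z : 'cV[R]_3 :=
  let Zest := usubmx z in
  let dOm_est := dsubmx z in
  u0 - cross (J *m dOm_est) Om0 - cross (J *m Om0) dOm_est
  - J *m (kP *: Zest + KD *m dOm_est).

(* The closed loop of the extended rigid body system and the observer, on
   [t0, T[, in the original variables. *)
Definition closed_loop (ke kP : R) (KD : 'M[R]_3) (R0 : R -> 'M[R]_3)
    (Om0 u0 : R -> 'cV[R]_3) (P : R -> 'M[R]_(3 + 3)) (Rt : R -> 'M[R]_3)
    (t0 : R) (T : \bar R)
    (Rot : R -> 'M[R]_3) (Om : R -> 'cV[R]_3) (z : R -> 'cV[R]_(3 + 3))
    : Prop :=
  let D := horizon t0 T in
  let u t := controller kP KD (Om0 t) (u0 t) (z t) in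
  [/\ solves_on D Rot (fun t => extended_R ke (Rot t) (Om t)),
      solves_on D Om (fun t => rigid_body_Om (Om t) (u t)) &
      solves_on D z (fun t => observer (Om0 t) (P t) (Rt t) (z t)
                                (u t - u0 t) (Zk_vee (R0 t) (Rot t)))].

(* xi = (Delta R, Delta Omega, e_o) *)
Definition error_solution (ke kP : R) (KD : 'M[R]_3) (R0 : R -> 'M[R]_3)
    (Om0 u0 : R -> 'cV[R]_3) (P : R -> 'M[R]_(3 + 3)) (Rt : R -> 'M[R]_3)
    (t0 : R) (T : \bar R) : set (R -> 'M[R]_3 * 'cV[R]_3 * 'cV[R]_(3 + 3)) :=
  [set xi | exists (Rot : R -> 'M[R]_3) (Om : R -> 'cV[R]_3)
      (z : R -> 'cV[R]_(3 + 3)),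
     closed_loop ke kP KD R0 Om0 u0 P Rt t0 T Rot Om z /\
     forall t, horizon t0 T t ->
       xi t = (Rot t - R0 t, Om t - Om0 t,
               col_mx (Zk_vee (R0 t) (Rot t)) (Om t - Om0 t) - z t)].

End RigidBody.

(* Main.v *)
(** In the coordinates Z = R0^T (R - R0) the attitude error satisfies
    Z' = [Z, Om0^] + dOm^ - ke (Z + Z^T) up to quadratic terms, and the
    estimation error e obeys e' = (A - L C) e up to quadratic terms.
    The Riccati solution P stays symmetric, nonnegative and bounded: each of these
    properties is a comparison for a linear matrix equation W' = F W + W F^T + N,
    settled by pairing W with solutions of the adjoint equation.  Hence, for small
    dl > 0, e^T (P + dl I)^-1 e decreases strictly along the observer, and no lower
    bound on P is needed.  With x1 = Zk^vee and x2 = dOm, a large multiple of it plus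
    kP/2 |Z|^2 + |x2|^2 + 2 eps x1.x2 is a Lyapunov function of the whole loop that
    decreases up to cubic terms, hence exponentially on a small sublevel set.
    Global solutions come from Picard iteration for a field made globally Lipschitz
    by clamping the state: its solutions never leave the sublevel set, where clamping
    has no effect. *)

Require Import Defs.
From HB Require Import structures.
From mathcomp Require Import all_boot all_order all_algebra.
From mathcomp Require Import all_classical all_reals all_analysis.
From mathcomp Require Import ring lra.

Set Implicit Arguments.
Unset Strict Implicit.
Unset Printing Implicit Defensive.

Import Order.TTheory GRing.Theory Num.Theory.
Import numFieldNormedType.Exports.

Local Open Scope classical_set_scope.
Local Open Scope ring_scope.

(** * Calculus of derivatives relative to a set *)

Section WithinDerivative.
Context {R : realType}.
Local Notation hdw := has_derivative_within.

(** [P 0] is only nonnegative, so [P] may be singular and P^-1 may not exist. The shift P + dl I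
    obeys the Riccati equation up to terms of order dl, which Q >= gamma1 I absorbs. The upper bound
    on [P] comes from a constant gain K for which A - K C has a constant Lyapunov matrix: [P] is
    dominated by a multiple of that matrix. In the energy the weight kP/2 makes the x1.x2 terms
    cancel. Then ke damps only Z + Z^T and KD damps only x2; the eps term supplies the missing
    damping of x1. This orders the constants: eps small first, then the weight of the estimation
    error, then the size of the sublevel set. Stability asks for global solutions and for an
    estimate on every solution, even on a bounded horizon. Both rest on one decay statement that
    requires the closed loop only inside the sublevel set. [u0] is not assumed continuous, so
    solutions are built as deviations from the reference, where [u0] cancels. *)

Lemma hdw_subset {V : normedModType R} {D E : set R} {x : R -> V} {t v} :
  D `<=` E -> hdw E x t v -> hdw D x t v.
Proof.
move=> DE; apply: cvg_trans; apply: cvg_app => A.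
rewrite /= !nbhs_simpl /within /= => A0; near=> h => Dh.
by move: (DE _ Dh); near: h.
Unshelve. all: by end_near.
Qed.

Lemma hdw_cst {V : normedModType R} {D : set R} {t} {v : V} :
  hdw D (fun=> v) t 0.
Proof.
rewrite /hdw; under eq_fun do rewrite subrr scaler0.
exact: cvg_cst.
Qed.

Lemma hdwD {V : normedModType R} {D : set R} {x y : R -> V} {t v w} :
  hdw D x t v -> hdw D y t w -> hdw D (fun s => x s + y s) t (v + w).
Proof.
move=> hx hy; rewrite /hdw.
under eq_fun do rewrite opprD addrACA scalerDr.
exact: cvgD.
Qed.

Lemma hdwN {V : normedModType R} {D : set R} {x : R -> V} {t v} :
  hdw D x t v -> hdw D (fun s => - x s) t (- v).
Proof.
move=> hx; rewrite /hdw.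
under eq_fun do rewrite -opprD scalerN.
exact: cvgN.
Qed.

Lemma hdwB {V : normedModType R} {D : set R} {x y : R -> V} {t v w} :
  hdw D x t v -> hdw D y t w -> hdw D (fun s => x s - y s) t (v - w).
Proof. by move=> hx hy; exact: (hdwD hx (hdwN hy)). Qed.

Lemma hdw_continuous {V : normedModType R} {D : set R} {x : R -> V} {t v} :
  hdw D x t v -> x (t + h) @[h --> within [set h | D (t + h)] 0^'] --> x t.
Proof.
move=> hx.
have h0 : h @[h --> within [set h | D (t + h)] 0^'] --> (0 : R).
  apply: (@cvg_trans _ 0^').
    exact: cvg_within.
  exact: nbhs_dnbhs.
have H : h *: (h^-1 *: (x (t + h) - x t)) + x t
    @[h --> within [set h | D (t + h)] 0^'] --> 0 *: v + x t.
  by apply: cvgD; [exact: cvgZ | exact: cvg_cst].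
rewrite scale0r add0r in H; apply: cvg_trans H; apply: near_eq_cvg.
rewrite near_withinE; near=> h => _; rewrite scalerA divff ?scale1r ?subrK//.
near: h; exact: nbhs_dnbhs_neq.
Unshelve. all: by end_near.
Qed.

Lemma hdwZ {V : normedModType R} {D : set R} {f : R -> R} {x : R -> V} {t a v} :
  hdw D f t a -> hdw D x t v ->
  hdw D (fun s => f s *: x s) t (a *: x t + f t *: v).
Proof.
move=> hf hx.
have H : (h^-1 *: (f (t + h) - f t)) *: x (t + h)
      + f t *: (h^-1 *: (x (t + h) - x t))
    @[h --> within [set h | D (t + h)] 0^'] --> a *: x t + f t *: v.
  apply: cvgD; apply: cvgZ => //; [exact: hdw_continuous hx | exact: cvg_cst].
apply: cvg_trans H; apply: near_eq_cvg; rewrite near_withinE; apply: nearW => h _ /=.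
rewrite scalerA [f t * _]mulrC -2!scalerA -scalerDr; congr (_ *: _).
by rewrite -[_ *: x (t + h)]/((f (t + h) - f t) *: _) scalerBl scalerBr addrA subrK.
Qed.

Lemma hdwM {D : set R} {f g : R -> R} {t a b} :
  hdw D f t a -> hdw D g t b ->
  hdw D (fun s => f s * g s) t (a * g t + f t * b).
Proof. by move=> hf hg; exact: (hdwZ hf hg). Qed.

Lemma hdw_sum {V : normedModType R} {D : set R} {I : Type} {r : seq I}
    {p : pred I} {x : I -> R -> V} {t} {v : I -> V} :
  (forall i, hdw D (x i) t (v i)) ->
  hdw D (fun s => \sum_(i <- r | p i) x i s) t (\sum_(i <- r | p i) v i).
Proof.
move=> hx; elim: r => [|i r IH].
  by under eq_fun do rewrite big_nil; rewrite big_nil; exact: hdw_cst.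
under eq_fun do rewrite big_cons; rewrite big_cons.
by case: (p i) => //; exact: (hdwD (hx i) IH).
Qed.

Lemma hdw_scaler {V : normedModType R} {D : set R} {x : R -> V} {t v} {a : R} :
  hdw D x t v -> hdw D (fun s => a *: x s) t (a *: v).
Proof. by move=> hx; have := hdwZ (@hdw_cst R D t a) hx; rewrite scale0r add0r. Qed.

Lemma hdwMl {D : set R} {x : R -> R} {t v} {a : R} :
  hdw D x t v -> hdw D (fun s => a * x s) t (a * v).
Proof. by move=> hx; exact: (hdw_scaler hx). Qed.

Lemma hdwP_is_derive {f : R -> R} {t a} :
  hdw setT f t a <-> is_derive t (1 : R) f a.
Proof.
have E : (h^-1 *: (f (t + h) - f t) @[h --> within [set h | setT (t + h)] 0^'])
   = (h^-1 *: ((f \o shift t) (h *: (1 : R)) - f t) @[h --> 0^']).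
  have -> : [set h | [set: R] (t + h)] = setT by apply/seteqP.
  have -> : within setT (0 : R)^' = (0 : R)^'.
    by apply/seteqP; split => A /=; rewrite /within /=; apply: filterS => h; auto.
  suff -> : (fun h : R => h^-1 *: (f (t + h) - f t)) =
      (fun h : R => h^-1 *: ((f \o shift t) (h *: (1 : R)) - f t)) by [].
  by apply/funext => h /=; rewrite -[h *: 1]/(h * 1) mulr1 (addrC h).
rewrite /hdw E; split => [ha|[df <-]].
  by split; [apply/cvg_ex; exists a | exact: cvg_lim].
exact: df.
Qed.

Lemma hdw_expR {D : set R} {k t : R} :
  hdw D (fun s => expR (k * s)) t (k * expR (k * t)).
Proof.
apply: (@hdw_subset _ _ setT) => //; apply/hdwP_is_derive.
have H : is_derive t 1 (fun s => k * s) k.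
  rewrite -[X in is_derive _ _ _ X]mulr1.
  exact: (@is_deriveZ _ _ _ id k t 1 1 (is_derive_id _ _)).
rewrite [X in is_derive _ _ _ X]mulrC.
exact: (@is_derive1_comp _ expR _ t _ k (is_derive_expR _) H).
Qed.

(** Time reversal: it turns the adjoint equation, prescribed at a final time, into an initial value
    problem. *)
Lemma hdw_reflect {x : R -> R} {a t v} :
  hdw setT x (a - t) v -> hdw setT (fun s => x (a - s)) t (- v).
Proof.
move=> /hdwP_is_derive hx; apply/hdwP_is_derive.
have H : is_derive t 1 (fun s => a - s) (-1).
  rewrite -[X in is_derive _ _ _ X]add0r.
  exact: (is_deriveB (is_derive_cst a t 1) (is_derive_id t 1)).
rewrite -[- v]mulrN1.
exact: (@is_derive1_comp _ x _ t v (-1) hx H).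
Qed.

End WithinDerivative.

(** * Entrywise norm, limits and derivatives of matrices *)

Section MatrixDerivative.
Context {R : realType}.
Local Notation hdw := has_derivative_within.

Lemma norm_entry m n (M : 'M[R]_(m, n)) i j : `|M i j| <= `|M|.
Proof. rewrite [leRHS]/Num.norm /= mx_normrE; exact: (le_bigmax _ _ (i, j)). Qed.

Lemma norm_mx_le m n (M : 'M[R]_(m, n)) a :
  0 <= a -> (forall i j, `|M i j| <= a) -> `|M| <= a.
Proof.
move=> a0 Ma; rewrite [leLHS]/Num.norm /= mx_normrE.
by apply/bigmax_leP; split => //= -[i j].
Qed.

(** The norm is the largest entry, hence submultiplicative only up to the inner dimension. Numerical
    factors such as 9 or 36 below come from such dimension counts. *)
Lemma norm_mulmx m n p (A : 'M[R]_(m, n)) (B : 'M[R]_(n, p)) :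
  `|A *m B| <= n%:R * (`|A| * `|B|).
Proof.
apply: norm_mx_le => [|i j]; first by rewrite !mulr_ge0.
rewrite mxE; apply: le_trans (ler_norm_sum _ _ _) _.
have -> : n%:R = \sum_(k < n) 1 :> R by rewrite sumr_const card_ord.
rewrite mulr_suml; apply: ler_sum => k _.
by rewrite mul1r normrM ler_pM ?norm_entry.
Qed.

Lemma norm_trmx m n (A : 'M[R]_(m, n)) : `|A^T| = `|A|.
Proof.
apply/eqP; rewrite eq_le; apply/andP; split; apply: norm_mx_le => // i j.
  by rewrite mxE norm_entry.
by have := norm_entry A^T j i; rewrite mxE.
Qed.

Lemma cvg_sumr {T I : Type} (F : set_system T) {FF : Filter F}
    (V : normedModType R) (r : seq I) (f : I -> T -> V) (a : I -> V) :
  (forall i, f i x @[x --> F] --> a i) ->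
  \sum_(i <- r) f i x @[x --> F] --> \sum_(i <- r) a i.
Proof.
move=> fa; elim: r => [|i r IH].
  rewrite big_nil (_ : (fun x => _) = (fun=> 0)); first exact: cvg_cst.
  by apply/funext => x; rewrite big_nil.
rewrite big_cons (_ : (fun x => _) = (fun x => f i x + \sum_(j <- r) f j x)).
  exact: cvgD.
by apply/funext => x; rewrite big_cons.
Qed.

Lemma cvg_mx {T : Type} (F : set_system T) {FF : Filter F} m n
    (f : T -> 'M[R]_(m, n)) (M : 'M[R]_(m, n)) :
  (forall i j, f x i j @[x --> F] --> M i j) -> f x @[x --> F] --> M.
Proof.
move=> fM; rewrite [M]matrix_sum_delta.
rewrite (_ : (fun x => _) =
  (fun x => \sum_(i < m) \sum_(j < n) f x i j *: delta_mx i j)).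
  do 2![apply: cvg_sumr => ?]; apply: cvgZ => //; exact: cvg_cst.
by apply/funext => x; rewrite -matrix_sum_delta.
Qed.

Lemma cvg_entry {T} (F : set_system T) {FF : Filter F} m n
    (f : T -> 'M[R]_(m, n)) (M : 'M[R]_(m, n)) i j :
  f x @[x --> F] --> M -> f x i j @[x --> F] --> M i j.
Proof.
move=> fM; apply: (@cvg_comp _ _ _ f (fun A : 'M[R]_(m, n) => A i j) F _ _ fM).
exact: coord_continuous.
Qed.

Lemma hdw_mx {m n} {D : set R} {x : R -> 'M[R]_(m, n)} {t} {v : 'M[R]_(m, n)} :
  (forall i j, hdw D (fun s => x s i j) t (v i j)) -> hdw D x t v.
Proof.
move=> hx; apply: cvg_mx => i j.
rewrite (_ : (fun h => _) = (fun h => h^-1 *: (x (t + h) i j - x t i j))).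
  exact: hx.
by apply/funext => h; rewrite !mxE.
Qed.

Lemma hdw_entry {m n : nat} {D : set R} {x : R -> 'M[R]_(m, n)} {t} {v : 'M[R]_(m, n)} i j :
  hdw D x t v -> hdw D (fun s => x s i j) t (v i j).
Proof.
move=> hx; rewrite /hdw.
rewrite (_ : (fun h => _) = (fun h => (h^-1 *: (x (t + h) - x t)) i j)).
  exact: cvg_entry.
by apply/funext => h; rewrite !mxE.
Qed.

Lemma hdw_mulmx {m n p} {D : set R} {x : R -> 'M[R]_(m, n)}
    {y : R -> 'M[R]_(n, p)} {t v w} :
  hdw D x t v -> hdw D y t w ->
  hdw D (fun s => x s *m y s) t (v *m y t + x t *m w).
Proof.
move=> hx hy; apply: hdw_mx => i j.
under eq_fun do rewrite mxE; rewrite !mxE -big_split /=.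
exact: (hdw_sum (fun k => hdwM (@hdw_entry _ _ _ _ _ _ i k hx) (@hdw_entry _ _ _ _ _ _ k j hy))).
Qed.

Lemma hdw_trmx {m n} {D : set R} {x : R -> 'M[R]_(m, n)} {t v} :
  hdw D x t v -> hdw D (fun s => (x s)^T) t v^T.
Proof.
move=> hx; apply: hdw_mx => i j; under eq_fun do rewrite mxE.
by rewrite mxE; exact: (hdw_entry hx).
Qed.

Lemma hdw_col_mx {m n p} {D : set R} {x : R -> 'M[R]_(m, p)}
    {y : R -> 'M[R]_(n, p)} {t v w} :
  hdw D x t v -> hdw D y t w ->
  hdw D (fun s => col_mx (x s) (y s)) t (col_mx v w).
Proof.
move=> hx hy; apply: hdw_mx => i j; rewrite -(splitK i).
case: (fintype.split i) => k /=.
  by under eq_fun do rewrite col_mxEu; rewrite col_mxEu; exact: (hdw_entry hx).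
by under eq_fun do rewrite col_mxEd; rewrite col_mxEd; exact: (hdw_entry hy).
Qed.

Lemma hdw_mxtrace {n} {D : set R} {x : R -> 'M[R]_n} {t v} :
  hdw D x t v -> hdw D (fun s => \tr (x s)) t (\tr v).
Proof. by move=> hx; exact: (hdw_sum (fun i => @hdw_entry _ _ _ _ _ _ i i hx)). Qed.

End MatrixDerivative.

(** * Mean value estimates and decay from a local differential inequality *)

Section MeanValue.
Context {R : realType}.
Local Notation hdw := has_derivative_within.
Implicit Types (f g U : R -> R) (a b t s : R).

Lemma hdw_cvg {V : normedModType R} {D : set R} {x : R -> V} {t v} :
  hdw D x t v -> x s @[s --> within D (nbhs t)] --> x t.
Proof.
move=> /hdw_continuous hx; apply/cvgrPdist_lt => e e0.
move/cvgrPdist_lt : hx => /(_ _ e0); rewrite !near_withinE => hx.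
apply: (nbhs0P (fun s => D s -> `|x t - x s| < e) t).2; near=> h => Dh.
have [->|h0] := eqVneq h 0; first by rewrite addr0 subrr normr0.
move: h0 Dh; near: h; exact: hx.
Unshelve. all: by end_near.
Qed.

Lemma hdw_dist_lt {V : normedModType R} {D : set R} {x : R -> V} {t v} {e : R} :
  hdw D x t v -> 0 < e -> exists2 d, 0 < d &
    forall s, D s -> `|s - t| < d -> `|x t - x s| < e.
Proof.
move=> /hdw_cvg /cvgrPdist_lt hx e0; have := hx _ e0.
rewrite near_withinE => /nbhs_ballP[d d0 hd]; exists d => // s Ds std.
by apply: hd => //; rewrite /ball /= distrC.
Qed.

Lemma hdw_interior {V : normedModType R} {D : set R} {x : R -> V} {t v} :
  nbhs t D -> hdw D x t v -> hdw setT x t v.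
Proof.
move=> tD; rewrite /hdw; apply: cvg_trans; apply: cvg_app => A.
rewrite /= !nbhs_simpl /within /= => A0; near=> h => _.
suff : D (t + h) by near: h.
near: h; apply: nbhs_dnbhs; exact: (nbhs0P D t).1.
Unshelve. all: by end_near.
Qed.

(** The mean value theorem: at interior points the derivative within the segment is the two-sided
    one, and at the end points it still gives continuity. *)
Lemma hdw_le {f a b} : a <= b ->
  (forall s, a <= s <= b -> exists2 v, hdw `[a, b] f s v & 0 <= v) ->
  f a <= f b.
Proof.
move=> ab hf.
have [df hdf] : exists df : R -> R, forall s, a <= s <= b ->
    hdw `[a, b] f s (df s) /\ 0 <= df s.
  have : forall s, exists v, a <= s <= b -> hdw `[a, b] f s v /\ 0 <= v.
    move=> s; case: (boolP (a <= s <= b)) => [/hf[v hv v0]|_]; first by exists v.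
    by exists 0.
  by move=> /choice[df hdf]; exists df.
have [||c cab E] := @MVT_segment R f df a b ab.
- move=> x xab; apply/hdwP_is_derive.
  have [|hx _] := hdf x; first by move: xab; rewrite in_itv /= => /andP[/ltW-> /ltW->].
  apply: (hdw_interior _ hx).
  have : nbhs x `]a, b[%classic by apply: open_nbhs_nbhs; split => //; exact: interval_open.
  by apply: filterS => y /=; rewrite !in_itv /= => /andP[/ltW-> /ltW->].
- apply/subspace_continuousP => x; rewrite /= in_itv /= => /hdf[hx _].
  exact: (hdw_cvg hx).
rewrite -subr_ge0 E mulr_ge0 ?subr_ge0//.
by have [] := hdf c cab.
Qed.

Lemma hdw_ge {f a b} : a <= b ->
  (forall s, a <= s <= b -> exists2 v, hdw `[a, b] f s v & v <= 0) ->
  f b <= f a.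
Proof.
move=> ab hf; rewrite -lerN2; apply: (@hdw_le (fun s => - f s)) => // s /hf[v hv v0].
by exists (- v); [exact: (hdwN hv) | rewrite oppr_ge0].
Qed.

Lemma hdw_dist_le {f g a b} : a <= b ->
  (forall s, a <= s <= b -> exists v w,
     [/\ hdw `[a, b] f s v, hdw `[a, b] g s w & `|v| <= w]) ->
  `|f b - f a| <= g b - g a.
Proof.
move=> ab H; rewrite ler_norml opprB; apply/andP; split.
  rewrite -subr_ge0 (_ : _ - _ = (f b + g b) - (f a + g a)); last by ring.
  rewrite subr_ge0; apply: (@hdw_le (fun s => f s + g s)) => // s /H[v [w [hv hw vw]]].
  exists (v + w); first exact: (hdwD hv hw).
  by move: vw; rewrite ler_norml => /andP[+ _]; lra.
rewrite -subr_ge0 (_ : _ - _ = (g b - f b) - (g a - f a)); last by ring.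
rewrite subr_ge0; apply: (@hdw_le (fun s => g s - f s)) => // s /H[v [w [hv hw vw]]].
exists (w - v); first exact: (hdwB hw hv).
by move: vw; rewrite ler_norml => /andP[_ +]; lra.
Qed.

(* The set where [U < rho] cannot be left, so the local estimate becomes global. *)
Lemma decay_of_local_decay {U a b} {rho lambda : R} : a <= b -> 0 <= lambda ->
  U a < rho -> (forall s, a <= s <= b -> 0 <= U s) ->
  (forall s, a <= s <= b -> exists2 v, hdw `[a, b] U s v &
     U s < rho -> v <= - lambda * U s) ->
  U b <= U a * expR (- lambda * (b - a)).
Proof.
move=> ab l0 Ua U0 hU.
have sub s c d : a <= c -> d <= b -> c <= s <= d ->
    exists2 v, hdw `[c, d] U s v & U s < rho -> v <= - lambda * U s.
  move=> ac db /andP[cs sd]; have [|v hv hl] := hU s.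
    by rewrite (le_trans ac cs) (le_trans sd db).
  exists v => //; apply: (hdw_subset _ hv) => y /=; rewrite !in_itv /=.
  by move=> /andP[cy yd]; rewrite (le_trans ac cy) (le_trans yd db).
have bnd s : a <= s <= b -> U s <= U a.
  move=> /andP[as_ sb]; rewrite leNgt; apply/negP => Us.
  (* Suppose U s > U a and let tau be the last time up to s at which U is at most U a. By continuity
     U tau <= U a < rho, so U stays below rho, and hence does not increase, just after tau. This
     produces a later element of S. *)
  pose S := [set r | a <= r <= s /\ U r <= U a].
  have Sa : S a by split => //; rewrite lexx.
  have supS : has_sup S by split; [exists a | exists s => r [/andP[]]].
  set tau := sup S.
  have atau : a <= tau by apply: sup_upper_bound.
  have taus : tau <= s by apply: ge_sup => [|r [/andP[]]//]; exists a.
  have taub : a <= tau <= b by rewrite atau (le_trans taus sb).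
  have [w hw hwl] := hU tau taub.
  have Utau : U tau <= U a.
    rewrite leNgt; apply/negP => Ut.
    have [|d d0 hd] := hdw_dist_lt (e := U tau - U a) hw; first by rewrite subr_gt0.
    have [r Sr tr] := sup_adherent d0 supS.
    have rtau : r <= tau by apply: sup_upper_bound.
    have [/andP[ar rs] Ur] := Sr.
    have : `|U tau - U r| < U tau - U a.
      apply: hd; first by rewrite /= in_itv /= ar (le_trans rs sb).
      by rewrite distrC ger0_norm ?subr_ge0//; rewrite -/tau in tr; lra.
    by rewrite ltr_norml => /andP[_]; lra.
  have tau_s : tau < s.
    by rewrite lt_neqAle taus andbT; apply/eqP => E; move: Us; rewrite -E ltNge Utau.
  have Utr : U tau < rho by apply: le_lt_trans Ua.
  have [|d d0 hd] := hdw_dist_lt (e := rho - U tau) hw; first by rewrite subr_gt0.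
  (* Half the continuity radius keeps U below rho on [tau, r]; the minimum keeps r from passing
     s. *)
  pose r := tau + Num.min (d / 2) (s - tau).
  have m0 : 0 < Num.min (d / 2) (s - tau) by rewrite lt_min divr_gt0//= subr_gt0.
  have md : Num.min (d / 2) (s - tau) <= d / 2 by rewrite ge_min lexx.
  have ms : Num.min (d / 2) (s - tau) <= s - tau by rewrite ge_min lexx orbT.
  have taur : tau < r by rewrite /r ltrDl.
  have rs : r <= s by rewrite /r; lra.
  have Sr : S r.
    split; first by rewrite rs andbT; apply: le_trans (ltW taur).
    apply: le_trans Utau; apply: hdw_ge; first exact: ltW.
    move=> y /andP[ty yr]; have tyr : tau <= y <= r by rewrite ty.
    have [v hv hl] := sub y tau r atau (le_trans rs sb) tyr.
    exists v => //.
    have Ay : a <= y <= b by rewrite (le_trans atau ty) (le_trans yr (le_trans rs sb)).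
    have Uy : U y < rho.
      have : `|U tau - U y| < rho - U tau.
        apply: hd; first by rewrite /= in_itv.
        by rewrite ger0_norm ?subr_ge0// /r in yr *; lra.
      by rewrite ltr_norml => /andP[+ _]; lra.
    by apply: le_trans (hl Uy) _; rewrite mulNr oppr_le0 mulr_ge0 ?U0.
  by have := sup_upper_bound supS Sr; rewrite leNgt taur.
(* Now U < rho holds on the whole segment, so U s e^(lambda s) does not increase. *)
have E : U b * expR (lambda * b) <= U a * expR (lambda * a).
  apply: (@hdw_ge (fun s => U s * expR (lambda * s))) => // s sab.
  have [v hv hl] := hU s sab.
  exists (v * expR (lambda * s) + U s * (lambda * expR (lambda * s))).
    exact: (hdwM hv hdw_expR).
  rewrite mulrA -mulrDl mulr_le0_ge0 ?expR_ge0//.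
  have : v <= - lambda * U s by apply: hl; apply: le_lt_trans Ua; apply: bnd.
  by rewrite mulrC; lra.
rewrite -(ler_pM2r (expR_gt0 (lambda * b))) -mulrA -expRD.
by rewrite (_ : _ + _ = lambda * a)//; ring.
Qed.

End MeanValue.

(** * Primitives and limits with explicit error bounds *)

Section Picard.
Context {R : realType}.
Local Notation hdw := has_derivative_within.

Lemma primitive_exists (g : R -> R) a : continuous g ->
  exists2 G : R -> R, G a = 0 & forall t, a <= t -> hdw setT G t (g t).
Proof.
move=> cg; pose mu := @lebesgue_measure R.
(* The integral starts at a - 1, so that a is an interior point and the primitive has a two-sided
   derivative there too. *)
pose F x := Rintegral mu [set` Interval (BLeft (a - 1)) (BRight x)] g.
exists (fun t => F t - F a) => [|t at_]; first by rewrite subrr.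
rewrite -[g t]subr0; apply: (hdwB _ hdw_cst); apply/hdwP_is_derive.
have [||||d1 d2] := @continuous_FTC1 R g (BLeft (a - 1)) t (t + 1).
- by rewrite ltrDl.
- apply: continuous_compact_integrable; first exact: segment_compact.
  by apply: continuous_subspaceT => x; exact: cg.
- by rewrite /= lte_fin; lra.
- exact: cg.
- by rewrite -d2 derive1E; exact: DeriveDef.
Qed.

(** The intervals [a n - c n, a n + c n] meet pairwise, so the supremum of their left ends lies in
    all of them. The limit thus comes with its error bound. *)
Lemma nested_limit (a c : nat -> R) : (forall n, 0 <= c n) ->
  (forall n, `|a n.+1 - a n| <= c n - c n.+1) ->
  exists l, forall n, `|l - a n| <= c n.
Proof.
move=> c0 ac.
have ac' n m : `|a (n + m)%N - a n| <= c n - c (n + m)%N.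
  elim: m => [|m IH]; first by rewrite addn0 !subrr normr0.
  rewrite addnS; have := ac (n + m)%N; have := ler_distD (a (n + m)%N) (a (n + m).+1) (a n).
  by lra.
have acc n m : a n - c n <= a m + c m.
  have := c0 n; have := c0 m; case: (leqP n m) => [nm|/ltnW nm].
    by have := ac' n (m - n)%N; rewrite subnKC// ler_norml => /andP[? ?]; lra.
  by have := ac' m (n - m)%N; rewrite subnKC// ler_norml => /andP[? ?]; lra.
pose S := [set a n - c n | n in [set: nat]].
have supS : has_sup S.
  split; first by exists (a 0%N - c 0%N); exists 0%N.
  by exists (a 0%N + c 0%N) => _ [n _ <-].
exists (sup S) => n; rewrite ler_norml; apply/andP; split.
  suff : a n - c n <= sup S by lra.
  by apply: sup_upper_bound => //; exists n.
suff : sup S <= a n + c n by lra.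
by apply: ge_sup => [|_ [m _ <-]]; [case: supS|].
Qed.

End Picard.

(** * Picard iteration for a globally Lipschitz matrix field *)

Section PicardMatrix.
Context {R : realType} {m n : nat}.
Local Notation hdw := has_derivative_within.
Local Notation V := 'M[R]_(m, n).
Variables (f : R -> V -> V) (L B a : R) (x0 : V).
Hypothesis L0 : 0 < L.
Hypothesis f_lip : forall t x y, `|f t x - f t y| <= L * `|x - y|.
Hypothesis f_cont : forall x, continuous (f ^~ x).
Hypothesis f_bnd : forall t, `|f t x0| <= B.

Lemma field_continuous (x : R -> V) : continuous x -> continuous (fun t => f t (x t)).
Proof.
move=> cx t; apply/cvgrPdist_lt => e e0.
have e2 : 0 < e / 2 by rewrite divr_gt0.
have eL : 0 < e / 2 / L by rewrite divr_gt0.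
have := @f_cont (x t) t; move/cvgrPdist_lt/(_ _ e2) => h1.
have := @cx t; move/cvgrPdist_lt/(_ _ eL) => h2.
near=> s.
apply: le_lt_trans (ler_distD (f s (x t)) _ _) _.
rewrite [e in ltRHS]splitr; apply: ltrD; first by near: s.
apply: le_lt_trans (f_lip _ _ _) _; rewrite mulrC -ltr_pdivlMr//.
by near: s.
Unshelve. all: by end_near.
Qed.

Let E t := expR (2 * L * (t - a)).

Lemma picard_step_exists : exists T : (R -> V) -> R -> V,
  forall x, continuous x -> T x a = x0 /\
    forall t, a <= t -> hdw setT (T x) t (f t (x t)).
Proof.
suff : forall x : R -> V, exists y : R -> V, continuous x -> y a = x0 /\
    forall t, a <= t -> hdw setT y t (f t (x t)).
  by move=> /choice[T HT]; exists T.
move=> x; have [cx|?] := pselect (continuous x); last by exists x.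
have [G HG] : exists G : 'I_m * 'I_n -> R -> R, forall ij, G ij a = 0 /\
    forall t, a <= t -> hdw setT (G ij) t (f t (x t) ij.1 ij.2).
  suff : forall ij : 'I_m * 'I_n, exists G : R -> R, G a = 0 /\
    forall t, a <= t -> hdw setT G t (f t (x t) ij.1 ij.2)
    by move=> /choice[G HG]; exists G.
  move=> ij; have [|G G0 HG] := @primitive_exists R (fun t => f t (x t) ij.1 ij.2) a.
    by move=> t; apply: (@cvg_entry _ _ _ _ _ _ (fun t => f t (x t))); exact: field_continuous.
  by exists G.
exists (fun t => x0 + \matrix_(i, j) G (i, j) t) => _; split.
  by apply/matrixP => i j; rewrite !mxE (HG (i, j)).1 addr0.
move=> t at_; rewrite -[f t (x t)]add0r; apply: (hdwD hdw_cst).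
apply: hdw_mx => i j; under eq_fun do rewrite mxE.
exact: (HG (i, j)).2.
Qed.

(* The weight [E] makes the Picard operator a contraction with factor 1/2. *)
Lemma picard_contraction (y z dy dz : R -> V) M :
  y a = z a ->
  (forall t, a <= t -> hdw setT y t (dy t) /\ hdw setT z t (dz t)) ->
  (forall t, a <= t -> `|dy t - dz t| <= L * (M * E t)) ->
  forall t, a <= t -> `|y t - z t| <= M / 2 * E t.
Proof.
move=> yz hyz hM t at_.
have M0 : 0 <= M.
  have := le_trans (normr_ge0 _) (hM a (lexx a)).
  by rewrite pmulr_rge0// pmulr_lge0// expR_gt0.
apply: norm_mx_le => [|i j]; first by rewrite mulr_ge0 ?expR_ge0 ?divr_ge0.
(* Both functions agree at [a], so the entry is an increment. It is compared with the increment of M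
   / 2 E, whose derivative is L M E because the exponent of E carries 2 L. *)
have -> : (y t - z t) i j = (y t i j - z t i j) - (y a i j - z a i j).
  by rewrite yz subrr subr0 !mxE.
have le : M / 2 * E t - M / 2 * E a <= M / 2 * E t.
  by rewrite gerBl mulr_ge0 ?expR_ge0 ?divr_ge0.
apply: le_trans le.
apply: (@hdw_dist_le _ (fun s => y s i j - z s i j) (fun s => M / 2 * E s)) => // s /andP[as_ st].
exists (dy s i j - dz s i j), (L * (M * E s)); split.
- have [h1 h2] := hyz s as_.
  by apply: hdw_subset (hdwB (hdw_entry h1) (hdw_entry h2)).
- apply: (@hdw_subset _ _ _ setT) => //.
  have EE r : E r = expR (- (2 * L * a)) * expR (2 * L * r).
    by rewrite -expRD /E mulrBr addrC.
  have -> : L * (M * E s) = M / 2 * (expR (- (2 * L * a)) * (2 * L * expR (2 * L * s))).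
    by rewrite EE; field.
  under eq_fun do rewrite EE.
  exact: (hdwMl (hdwMl hdw_expR)).
- apply: le_trans (hM s as_); have := norm_entry (dy s - dz s) i j.
  by rewrite !mxE.
Qed.

Theorem picard : exists2 x : R -> V, x a = x0 &
  forall t, a <= t -> hdw setT x t (f t (x t)).
Proof.
have [T HT] := picard_step_exists.
(* Freezes time before [a]: the operator [T] is controlled for t >= a only, but must be fed
   functions continuous on the whole line. *)
pose w t := Num.max a t.
have cw : continuous w.
  by move=> t; apply: continuous_max; [exact: cvg_cst | exact: cvg_id].
have wa t : a <= w t by rewrite le_max lexx.
have ww t : a <= t -> w t = t by move=> ?; apply/max_idPr.
pose y := fix y k : R -> V := if k is k'.+1 then fun t => T (y k') (w t) else fun=> x0.
have cy k : continuous (y k).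
  elim: k => [|k IH] t; first exact: cvg_cst.
  apply: (@continuous_comp _ _ _ w); first exact: cw.
  have := hdw_cvg ((HT _ IH).2 (w t) (wa t)).
  suff -> : within setT (nbhs (w t)) = nbhs (w t) by [].
  by apply/seteqP; split => A /=; rewrite /within /=; apply: filterS => h; auto.
have B0 : 0 <= B := le_trans (normr_ge0 _) (f_bnd a).
(* With this M the rate of the first increment is at most B = L M, as [picard_contraction] wants
   it. *)
pose M := B / L.
have M0 : 0 <= M by rewrite divr_ge0// ltW.
have E1 t : a <= t -> 1 <= E t.
  by move=> at_; rewrite -expR0 ler_expR !mulr_ge0 ?subr_ge0// ltW.
have step k t : a <= t -> `|y k.+1 t - y k t| <= M / 2 ^+ k / 2 * E t.
  elim: k t => [|k IH] t at_ /=; rewrite !ww//.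
    apply: (@picard_contraction _ (fun=> x0) (fun s => f s x0) (fun=> 0)) => //.
    - exact: (HT _ (cy 0%N)).1.
    - move=> s as_; split; last exact: hdw_cst.
      exact: (HT _ (cy 0%N)).2.
    - move=> s as_; rewrite subr0 expr0 divr1 /M mulrA mulrCA divff ?gt_eqF// mulr1.
      by apply: le_trans (f_bnd s) _; rewrite ler_peMr// E1.
  apply: (@picard_contraction _ _ (fun s => f s (y k.+1 s)) (fun s => f s (y k s))) => //.
  - by rewrite (HT _ (cy k.+1)).1 (HT _ (cy k)).1.
  - by move=> s as_; split; [exact: (HT _ (cy k.+1)).2 | exact: (HT _ (cy k)).2].
  - move=> s as_; apply: le_trans (f_lip _ _ _) _; rewrite ler_pM2l//.
    by apply: le_trans (IH s as_) _; rewrite exprSr invfM mulrA.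
have ME0 k t : 0 <= M / 2 ^+ k * E t.
  by rewrite mulr_ge0 ?expR_ge0// divr_ge0// exprn_ge0.
(* The radii M / 2^k E t shrink from k to k + 1 by exactly the bound of [step], which is what
   [nested_limit] asks for. *)
have lim t : exists l : V, a <= t -> forall k, `|l - y k t| <= M / 2 ^+ k * E t.
  have [at_|] := boolP (a <= t); last by exists 0.
  have : forall ij : 'I_m * 'I_n, exists l, forall k, `|l - y k t ij.1 ij.2| <= M / 2 ^+ k * E t.
    move=> ij; apply: nested_limit => k; first by exact: ME0.
    have := norm_entry (y k.+1 t - y k t) ij.1 ij.2; rewrite !mxE => /le_trans; apply.
    apply: le_trans (step k t at_) _; rewrite -mulrBl exprSr invfM mulrA.
    by rewrite le_eqVlt; apply/orP; left; apply/eqP; congr (_ * _); field; rewrite expf_neq0.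
  move=> /choice[l hl]; exists (\matrix_(i, j) l (i, j)) => _ k.
  apply: norm_mx_le => [|i j]; first by exact: ME0.
  by rewrite !mxE; exact: (hl (i, j)).
have {lim} [z hz] := choice lim.
pose x t := z (w t).
have pow2 e : 0 < e -> exists k, M / 2 ^+ k < e.
  move=> e0; exists (Num.bound (M / e)); set k := Num.bound _.
  rewrite ltr_pdivrMr ?exprn_gt0// mulrC -ltr_pdivrMr//.
  have := archi_boundP (divr_ge0 M0 (ltW e0)); rewrite -/k => /lt_le_trans; apply.
  by rewrite -natrX ler_nat ltnW// ltn_expl.
(* Locally uniform limit: near t the weight is at most E (w t + 1), so a single k serves a whole
   neighbourhood in the three-term estimate. *)
have cx : continuous x.
  move=> t; apply/cvgrPdist_lt => e e0.
  have E0 : 0 < E (w t + 1) by exact: expR_gt0.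
  have [k hk] := pow2 (e / 3 / E (w t + 1)) (divr_gt0 (divr_gt0 e0 (ltr0n _ 3)) E0).
  rewrite ltr_pdivlMr// in hk.
  have Ew s : w s <= w t + 1 -> `|x s - y k (w s)| < e / 3.
    move=> st; apply: le_lt_trans (hz _ (wa s) k) _; apply: le_lt_trans hk.
    apply: ler_wpM2l; first by rewrite divr_ge0 ?exprn_ge0.
    by rewrite /E ler_expR ler_wpM2l ?mulr_ge0 ?lerB// ltW.
  have /cvgrPdist_lt/(_ (e / 3)) : y k \o w @ t --> y k (w t).
    exact: (@continuous_comp _ _ _ w (y k) t (@cw t) (@cy k (w t))).
  rewrite divr_gt0// => /(_ isT) h1.
  have /cvgrPdist_lt/(_ 1) := @cw t; rewrite ltr01 => /(_ isT) h2.
  near=> s.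
  have ws : w s <= w t + 1.
    have : `|w t - w s| < 1 by near: s.
    by rewrite ltr_norml => /andP[+ _]; lra.
  have wt : w t <= w t + 1 by rewrite lerDl.
  have h3 : `|y k (w t) - y k (w s)| < e / 3 by near: s.
  have := Ew _ ws; have := Ew _ wt; rewrite (distrC (x s)) => h4 h5.
  have := ler_distD (y k (w t)) (x t) (x s).
  by have := ler_distD (y k (w s)) (y k (w t)) (x s); lra.
exists (T x) => [|t at_]; first exact: (HT _ cx).1.
(* For every k, both sides are within M / 2^k / 2 E t of the iterate k + 1. *)
suff -> : T x t = x t by exact: (HT _ cx).2.
apply/eqP; rewrite -subr_eq0 -normr_le0; apply/ler_addgt0Pl => e e0; rewrite addr0.
have E0 : 0 < E t by exact: expR_gt0.
have [k hk] := pow2 (e / E t) (divr_gt0 e0 E0); rewrite ltr_pdivlMr// in hk.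
have h1 : `|T x t - y k.+1 t| <= M / 2 ^+ k / 2 * E t.
  rewrite /= ww//.
  apply: (@picard_contraction _ _ (fun s => f s (x s)) (fun s => f s (y k s))) => //.
  - by rewrite (HT _ cx).1 (HT _ (cy k)).1.
  - by move=> s as_; split; [exact: (HT _ cx).2 | exact: (HT _ (cy k)).2].
  - move=> s as_; apply: le_trans (f_lip _ _ _) _; rewrite ler_pM2l//.
    by rewrite /x ww//; exact: hz.
have h2 : `|x t - y k.+1 t| <= M / 2 ^+ k / 2 * E t.
  by rewrite /x ww//; apply: le_trans (hz _ at_ k.+1) _; rewrite exprSr invfM mulrA.
have := ler_distD (y k.+1 t) (T x t) (x t); rewrite (distrC (y k.+1 t)).
have H : M / 2 ^+ k * E t = M / 2 ^+ k / 2 * E t + M / 2 ^+ k / 2 * E t.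
  by rewrite -mulrDl -splitr.
by rewrite H in hk; lra.
Unshelve. all: by end_near.
Qed.
End PicardMatrix.

(** * The Frobenius inner product *)

Section FrobeniusProduct.
Context {R : realType}.
Local Notation hdw := has_derivative_within.

Definition dotm {m n} (A B : 'M[R]_(m, n)) : R := \tr (A^T *m B).

Section Bilinear.
Context {m n : nat}.
Implicit Types A B C : 'M[R]_(m, n).

Lemma dotmE A B : dotm A B = \sum_j \sum_i A i j * B i j.
Proof.
apply: eq_bigr => j _; rewrite mxE; apply: eq_bigr => i _; by rewrite mxE.
Qed.

Lemma dotmC A B : dotm A B = dotm B A.
Proof. by rewrite !dotmE; do 2![apply: eq_bigr => ? _]; rewrite mulrC. Qed.

Lemma dotmDr A B C : dotm A (B + C) = dotm A B + dotm A C.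
Proof. by rewrite /dotm mulmxDr mxtraceD. Qed.

Lemma dotmDl A B C : dotm (A + B) C = dotm A C + dotm B C.
Proof. by rewrite !(dotmC _ C) dotmDr. Qed.

Lemma dotmZr a A B : dotm A (a *: B) = a * dotm A B.
Proof. by rewrite /dotm -scalemxAr mxtraceZ. Qed.

Lemma dotmZl a A B : dotm (a *: A) B = a * dotm A B.
Proof. by rewrite !(dotmC _ B) dotmZr. Qed.

Lemma dotmNr A B : dotm A (- B) = - dotm A B.
Proof. by rewrite -scaleN1r dotmZr mulN1r. Qed.

Lemma dotmNl A B : dotm (- A) B = - dotm A B.
Proof. by rewrite !(dotmC _ B) dotmNr. Qed.

Lemma dotm0r A : dotm A 0 = 0.
Proof. by rewrite -(scale0r 0) dotmZr mul0r. Qed.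

Lemma dotm0l A : dotm 0 A = 0.
Proof. by rewrite dotmC dotm0r. Qed.

Lemma dotm_ge0 A : 0 <= dotm A A.
Proof. by rewrite dotmE; do 2![apply: sumr_ge0 => ? _]; rewrite -expr2 sqr_ge0. Qed.

Lemma norm_sqr_le_dotm A : `|A| ^+ 2 <= dotm A A.
Proof.
have h i j : `|A i j| ^+ 2 <= dotm A A.
  rewrite real_normK ?num_real// dotmE (bigD1 j)//= (bigD1 i)//= -expr2 -addrA lerDl.
  apply: addr_ge0; last apply: sumr_ge0 => ? _;
    by apply: sumr_ge0 => ? _; rewrite -expr2 sqr_ge0.
rewrite -[leRHS]sqr_sqrtr ?dotm_ge0// ler_pXn2r ?nnegrE ?sqrtr_ge0//.
apply: norm_mx_le => [|i j]; first exact: sqrtr_ge0.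
by rewrite -(@ler_pXn2r _ 2) ?nnegrE ?sqrtr_ge0// sqr_sqrtr ?dotm_ge0.
Qed.

Lemma norm_dotm_le A B : `|dotm A B| <= (m * n)%:R * (`|A| * `|B|).
Proof.
rewrite dotmE; apply: le_trans (ler_norm_sum _ _ _) _.
have -> : (m * n)%:R = \sum_(j < n) \sum_(i < m) 1 :> R.
  by rewrite !sumr_const !card_ord -mulrnA.
rewrite mulr_suml; apply: ler_sum => j _; apply: le_trans (ler_norm_sum _ _ _) _.
rewrite mulr_suml; apply: ler_sum => i _.
by rewrite mul1r normrM ler_pM ?norm_entry.
Qed.

Lemma dotm_le A B : dotm A B <= (m * n)%:R * (`|A| * `|B|).
Proof. exact: le_trans (ler_norm _) (norm_dotm_le A B). Qed.

Lemma dotm_le_norm_sqr A : dotm A A <= (m * n)%:R * `|A| ^+ 2.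
Proof. by rewrite expr2; exact: dotm_le. Qed.

Lemma dotm_eq0 A : dotm A A = 0 -> A = 0.
Proof.
move=> A0; apply/eqP; rewrite -normr_eq0 -sqrf_eq0 eq_le sqr_ge0 andbT.
by rewrite -A0 norm_sqr_le_dotm.
Qed.

Lemma dotm_young a A B : 0 < a -> 2 * dotm A B <= a * dotm A A + a^-1 * dotm B B.
Proof.
move=> a0; have := dotm_ge0 (a *: A - B).
rewrite !(dotmDl, dotmDr, dotmNl, dotmNr, dotmZl, dotmZr) (dotmC B A) => h.
rewrite -subr_ge0 -(pmulr_rge0 _ a0); apply: le_trans h _.
rewrite le_eqVlt; apply/orP; left; apply/eqP; field.
by rewrite gt_eqF.
Qed.

Lemma hdw_dotm {D : set R} {x y : R -> 'M[R]_(m, n)} {t v w} :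
  hdw D x t v -> hdw D y t w ->
  hdw D (fun s => dotm (x s) (y s)) t (dotm v (y t) + dotm (x t) w).
Proof.
move=> hx hy; rewrite /dotm -mxtraceD.
exact: (hdw_mxtrace (hdw_mulmx (hdw_trmx hx) hy)).
Qed.
End Bilinear.

Lemma dotm_mull m n p (M : 'M[R]_(m, p)) (A : 'M[R]_(m, n)) (B : 'M[R]_(p, n)) :
  dotm A (M *m B) = dotm (M^T *m A) B.
Proof. by rewrite /dotm trmx_mul trmxK mulmxA. Qed.

Lemma dotm_mulr m n p (M : 'M[R]_(p, n)) (A : 'M[R]_(m, n)) (B : 'M[R]_(m, p)) :
  dotm A (B *m M) = dotm (A *m M^T) B.
Proof. by rewrite /dotm trmx_mul trmxK mulmxA mxtrace_mulC mulmxA. Qed.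

Lemma dotm_tr m n (A B : 'M[R]_(m, n)) : dotm A^T B^T = dotm A B.
Proof. by rewrite !dotmE exchange_big; do 2![apply: eq_bigr => ? _]; rewrite !mxE. Qed.

Lemma dotm_cV n (x y : 'cV[R]_n) : (x^T *m y) 0 0 = dotm x y.
Proof. by rewrite /dotm /mxtrace big_ord1. Qed.

Lemma dotm_col_mx m n p (A B : 'M[R]_(m, p)) (C D : 'M[R]_(n, p)) :
  dotm (col_mx A C) (col_mx B D) = dotm A B + dotm C D.
Proof. by rewrite /dotm tr_col_mx mul_row_col mxtraceD. Qed.

Lemma loewner_leP n (M N : 'M[R]_n) :
  loewner_le M N <-> forall x : 'cV[R]_n, dotm x (M *m x) <= dotm x (N *m x).
Proof. by split=> h x; have := h x; rewrite -!mulmxA !dotm_cV. Qed.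

End FrobeniusProduct.

Definition dotm_linear {R : realType} {m n : nat} :=
  (@dotmDl R m n, @dotmDr R m n, @dotmNl R m n, @dotmNr R m n, @dotmZl R m n,
   @dotmZr R m n).

(** * Limits of products and inverses *)

Section MatrixLimits.
Context {R : realType} {T : Type} {F : set_system T} {FF : Filter F}.

Lemma cvg_mulmx m n p (f : T -> 'M[R]_(m, n)) (g : T -> 'M[R]_(n, p))
    (A : 'M[R]_(m, n)) (B : 'M[R]_(n, p)) :
  f x @[x --> F] --> A -> g x @[x --> F] --> B ->
  f x *m g x @[x --> F] --> A *m B.
Proof.
move=> fA gB; apply: cvg_mx => i j; under eq_fun do rewrite mxE; rewrite mxE.
by apply: cvg_sumr => k; apply: cvgM; apply: cvg_entry.
Qed.

Lemma cvg_trmx m n (f : T -> 'M[R]_(m, n)) (A : 'M[R]_(m, n)) :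
  f x @[x --> F] --> A -> (f x)^T @[x --> F] --> A^T.
Proof.
move=> fA; apply: cvg_mx => i j; under eq_fun do rewrite mxE; rewrite mxE.
exact: cvg_entry.
Qed.

(** The identity A^-1 - F^-1 = F^-1 (F - A) A^-1 reduces convergence of inverses to a bound on them,
    which coercivity provides in every application. *)
Lemma cvg_invmx n (f : T -> 'M[R]_n) (A : 'M[R]_n) (b : R) :
  f x @[x --> F] --> A -> A \in unitmx ->
  (\forall x \near F, f x \in unitmx /\ `|invmx (f x)| <= b) ->
  invmx (f x) @[x --> F] --> invmx A.
Proof.
move=> fA uA hb; apply/cvgrPdist_lt => e e0.
pose K := n%:R * (`|b| + 1) * (n%:R * (`|invmx A| + 1)) + 1.
have K0 : 0 < K by rewrite ltr_wpDl// !mulr_ge0// addr_ge0.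
have := fA; move/cvgrPdist_lt/(_ (e / K) (divr_gt0 e0 K0)) => h.
near=> x.
have [ux bx] : f x \in unitmx /\ `|invmx (f x)| <= b by near: x.
have -> : invmx A - invmx (f x) = invmx (f x) *m (f x - A) *m invmx A.
  by rewrite mulmxBr mulmxBl mulVmx// mul1mx -mulmxA mulmxV// mulmx1.
have hx : `|A - f x| < e / K by near: x.
apply: le_lt_trans (norm_mulmx _ _) _.
apply: (@le_lt_trans _ _ (n%:R * (n%:R * (`|b| * `|A - f x|) * `|invmx A|))).
  rewrite ler_wpM2l// ler_wpM2r//; apply: le_trans (norm_mulmx _ _) _.
  rewrite ler_wpM2l// distrC ler_wpM2r//; exact: le_trans bx (ler_norm _).
apply: (@le_lt_trans _ _ ((K - 1) * `|A - f x|)).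
  rewrite /K addrK -subr_ge0.
  have -> : n%:R * (`|b| + 1) * (n%:R * (`|invmx A| + 1)) * `|A - f x| -
    n%:R * (n%:R * (`|b| * `|A - f x|) * `|invmx A|) =
    n%:R * n%:R * `|A - f x| * (`|b| + `|invmx A| + 1) by ring.
  by rewrite !mulr_ge0// !addr_ge0.
rewrite (@le_lt_trans _ _ (K * `|A - f x|))//; first by rewrite ler_wpM2r// gerBl.
by rewrite mulrC -ltr_pdivlMr.
Unshelve. all: by end_near.
Qed.
End MatrixLimits.

(** * Continuity on the half-line *)

Section ForwardContinuity.
Context {R : realType} {V : normedModType R}.
Local Notation hdw := has_derivative_within.

(* Extending functions on [0, +oo[ by a constant turns one-sided continuity
   into continuity. *)
Definition forward_continuous (x : R -> V) := continuous (fun s : R => x (Num.max 0 s)).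

Lemma within_forward_continuous (x : R -> V) :
  {within `[0, +oo[, continuous x} -> forward_continuous x.
Proof.
move=> /subspace_continuousP cx t; apply/cvgrPdist_lt => e e0.
have t0 : 0 <= Num.max 0 t by rewrite le_max lexx.
have := cx (Num.max 0 t); rewrite /= in_itv /= t0 => /(_ isT) /cvgrPdist_lt/(_ _ e0).
rewrite near_withinE => h.
have : Num.max 0 s @[s --> t] --> Num.max 0 t.
  by apply: continuous_max; [exact: cvg_cst | exact: cvg_id].
move=> /(_ _ h); rewrite nbhs_simpl /=; apply: filterS => s /=; apply.
by rewrite in_itv /= le_max lexx.
Qed.

Lemma hdw_forward_continuous (x v : R -> V) :
  solves_on `[0, +oo[ x v -> forward_continuous x.
Proof.
move=> hx; apply: within_forward_continuous.
by apply/subspace_continuousP => t /hx ht; exact: (hdw_cvg ht).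
Qed.

Lemma forward_bounded (x : R -> V) T : 0 <= T -> forward_continuous x ->
  exists2 M, 0 <= M & forall t, 0 <= t <= T -> `|x t| <= M.
Proof.
move=> T0 cx.
have [|c cT hc] := @EVT_max R (fun s => `|x (Num.max 0 s)|) 0 T T0.
  apply: continuous_subspaceT => s.
  by apply: (@continuous_comp _ _ _ _ (@Num.norm _ V)); [exact: cx | exact: norm_continuous].
exists `|x (Num.max 0 c)| => // t tT.
have := hc t; rewrite in_itv /= => /(_ tT).
by move: tT => /andP[/max_idPr-> _].
Qed.
End ForwardContinuity.

(** * Comparison for linear matrix differential equations *)

Section Comparison.
Context {R : realType} {n : nat}.
Local Notation hdw := has_derivative_within.
Implicit Types F N W : R -> 'M[R]_n.

(** Picard applied to x(s) = eta(T - s), which solves the forward equation x' = F(T - s)^T x. *)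
Lemma adjoint_exists F T p (eta1 : 'M[R]_(n, p)) : 0 <= T -> forward_continuous F ->
  exists2 eta : R -> 'M[R]_(n, p), eta T = eta1 &
    forall t, 0 <= t <= T -> hdw setT eta t (- ((F t)^T *m eta t)).
Proof.
move=> T0 cF; have [M M0 hM] := forward_bounded T0 cF.
(* The reversed time T - s, clamped to [0, T] where F is bounded: this makes the field globally
   Lipschitz. *)
pose w s := Num.max 0 (Num.min T (T - s)).
have w0 s : 0 <= w s <= T by rewrite le_max lexx ge_max T0 ge_min lexx.
have w0' s : 0 <= w s by have /andP[] := w0 s.
pose f s (z : 'M[R]_(n, p)) := (F (w s))^T *m z.
pose L := n%:R * M + 1.
have L0 : 0 < L by rewrite ltr_wpDl// mulr_ge0.
have flip s x y : `|f s x - f s y| <= L * `|x - y|.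
  rewrite -mulmxBr; apply: le_trans (norm_mulmx _ _) _.
  rewrite norm_trmx mulrA ler_wpM2r//.
  apply: (@le_trans _ _ (n%:R * M)); last by rewrite lerDl.
  by rewrite ler_wpM2l// hM.
have fc x : continuous (f ^~ x).
  move=> s; apply: cvg_mulmx; last exact: cvg_cst.
  apply: cvg_trmx; rewrite -[w s](max_idPr (w0' s)).
  rewrite (_ : (fun y => F (w y)) = (fun s => F (Num.max 0 s)) \o w); last first.
    by apply/funext => y /=; rewrite (max_idPr (w0' y)).
  apply: continuous_comp; last exact: cF.
  apply: continuous_max; first exact: cvg_cst.
  apply: continuous_min; first exact: cvg_cst.
  by apply: cvgB; [exact: cvg_cst | exact: cvg_id].
have fb s : `|f s eta1| <= n%:R * (M * `|eta1|).
  by apply: le_trans (norm_mulmx _ _) _; rewrite norm_trmx ler_wpM2l// ler_wpM2r// hM.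
have [x x0 hx] := picard 0 L0 flip fc fb.
exists (fun t => x (T - t)) => [|t /andP[t0 tT]]; first by rewrite subrr.
have H : hdw setT x (T - t) ((F t)^T *m x (T - t)).
  have := hx (T - t); rewrite subr_ge0 => /(_ tT).
  by rewrite /f (_ : w (T - t) = t)// /w subKr (min_idPr tT) (max_idPr t0).
apply: hdw_mx => i j.
have -> : (- ((F t)^T *m x (T - t))) i j = - ((F t)^T *m x (T - t)) i j by rewrite mxE.
exact: (hdw_reflect (hdw_entry H)).
Qed.

(** The adjoint equation is made so that the terms in F cancel in mu^T W eta. Only the source N is
    left, whose sign then decides. *)
Lemma hdw_dotm_adjoint F N W p T t (eta mu : R -> 'M[R]_(n, p)) : 0 <= t <= T ->
  hdw setT eta t (- ((F t)^T *m eta t)) -> hdw setT mu t (- ((F t)^T *m mu t)) ->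
  hdw `[0, +oo[ W t (F t *m W t + W t *m (F t)^T + N t) ->
  hdw `[0, T] (fun s => dotm (mu s) (W s *m eta s)) t (dotm (mu t) (N t *m eta t)).
Proof.
move=> /andP[t0 tT] he hm hW.
have sub : (`[0, T]%classic : set R) `<=` `[0, +oo[%classic.
  by move=> s /=; rewrite !in_itv /= => /andP[->].
have := hdw_dotm (hdw_subset (@subsetT _ _) hm)
  (hdw_mulmx (hdw_subset sub hW) (hdw_subset (@subsetT _ _) he)).
suff -> : dotm (mu t) (N t *m eta t) =
    dotm (- ((F t)^T *m mu t)) (W t *m eta t) +
    dotm (mu t) ((F t *m W t + W t *m (F t)^T + N t) *m eta t +
       W t *m (- ((F t)^T *m eta t))) by [].
rewrite !mulmxDl mulmxN !dotm_linear -!mulmxA (dotm_mull (F t)).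
by ring.
Qed.

Lemma lyapunov_comparison F N W : forward_continuous F ->
  solves_on `[0, +oo[ W (fun t => F t *m W t + W t *m (F t)^T + N t) ->
  (forall t, 0 <= t -> loewner_le 0 (N t)) -> loewner_le 0 (W 0) ->
  forall t, 0 <= t -> loewner_le 0 (W t).
Proof.
move=> cF hW hN hW0 T T0; apply/loewner_leP => v; rewrite mul0mx dotm0r.
have [eta <- he] := adjoint_exists v T0 cF.
apply: (@le_trans _ _ (dotm (eta 0) (W 0 *m eta 0))).
  by have /loewner_leP/(_ (eta 0)) := hW0; rewrite mul0mx dotm0r.
apply: (@hdw_le _ (fun s => dotm (eta s) (W s *m eta s))) => // s sT.
have s0 : 0 <= s by have /andP[] := sT.
exists (dotm (eta s) (N s *m eta s)).
  apply: (@hdw_dotm_adjoint F N W) => //; try exact: he.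
  by apply: hW; rewrite /= in_itv /= s0.
by have /loewner_leP/(_ (eta s)) := hN _ s0; rewrite mul0mx dotm0r.
Qed.

(** Matrix-valued adjoints with final values I and W T turn the conserved pairing into |W T|^2 at
    time T, while it vanishes at time 0. *)
Lemma lyapunov_zero F W : forward_continuous F ->
  solves_on `[0, +oo[ W (fun t => F t *m W t + W t *m (F t)^T) -> W 0 = 0 ->
  forall t, 0 <= t -> W t = 0.
Proof.
move=> cF hW W0 T T0; apply: dotm_eq0.
have [eta eT he] := adjoint_exists 1%:M T0 cF.
have [mu mT hm] := adjoint_exists (W T) T0 cF.
have E : dotm (mu T) (W T *m eta T) = dotm (W T) (W T) by rewrite eT mT mulmx1.
rewrite -E; suff : dotm (mu T) (W T *m eta T) = dotm (mu 0) (W 0 *m eta 0).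
  by rewrite W0 mul0mx dotm0r.
apply/eqP; rewrite -subr_eq0 -normr_le0.
apply: le_trans (_ : 0 - 0 <= 0); last by rewrite subrr.
apply: (@hdw_dist_le _ (fun s => dotm (mu s) (W s *m eta s)) (fun=> 0)) => // s sT.
have s0 : 0 <= s by have /andP[] := sT.
exists 0, 0; rewrite normr0; split => //; last exact: hdw_cst.
have hWs : hdw `[0, +oo[ W s (F s *m W s + W s *m (F s)^T + 0).
  by rewrite addr0; apply: hW; rewrite /= in_itv /= s0.
have := @hdw_dotm_adjoint F (fun=> 0) W _ T s eta mu sT (he s sT) (hm s sT) hWs.
by rewrite mul0mx dotm0r.
Qed.

End Comparison.

(** * Quadratic forms and coercivity without eigenvalues *)

Section QuadraticForms.
Context {R : realType}.

Lemma trmxD m n (A B : 'M[R]_(m, n)) : (A + B)^T = A^T + B^T.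
Proof. by apply/matrixP => i j; rewrite !mxE. Qed.

Lemma trmxN m n (A : 'M[R]_(m, n)) : (- A)^T = - A^T.
Proof. by apply/matrixP => i j; rewrite !mxE. Qed.

Lemma trmxZ m n a (A : 'M[R]_(m, n)) : (a *: A)^T = a *: A^T.
Proof. by apply/matrixP => i j; rewrite !mxE. Qed.

Lemma norm_dotm_mulmx_le m n (x : 'cV[R]_m) (M : 'M[R]_(m, n)) (y : 'cV[R]_n) :
  `|dotm x (M *m y)| <= (m * n)%:R * (`|M| * (`|x| * `|y|)).
Proof.
apply: le_trans (norm_dotm_le _ _) _; rewrite muln1 natrM -mulrA ler_wpM2l//.
have -> : n%:R * (`|M| * (`|x| * `|y|)) = `|x| * (n%:R * (`|M| * `|y|)) by ring.
by rewrite ler_wpM2l// norm_mulmx.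
Qed.

Lemma norm_quad_le n (M : 'M[R]_n) (v : 'cV[R]_n) :
  `|dotm v (M *m v)| <= (n * n)%:R * `|M| * dotm v v.
Proof.
apply: le_trans (norm_dotm_mulmx_le _ _ _) _; rewrite mulrA ler_wpM2l ?mulr_ge0//.
by rewrite -expr2 norm_sqr_le_dotm.
Qed.

Lemma quad_le n (M : 'M[R]_n) (v : 'cV[R]_n) :
  dotm v (M *m v) <= (n * n)%:R * `|M| * dotm v v.
Proof. exact: le_trans (ler_norm _) (norm_quad_le M v). Qed.

Lemma dotm_delta n (M : 'M[R]_n) i j :
  dotm (delta_mx i 0 : 'cV[R]_n) (M *m (delta_mx j 0 : 'cV[R]_n)) = M i j.
Proof. by rewrite -colE -dotm_cV trmx_delta -rowE !mxE. Qed.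

Lemma dotm_delta_delta n (i : 'I_n) :
  dotm (delta_mx i 0 : 'cV[R]_n) (delta_mx i 0 : 'cV[R]_n) = 1.
Proof. by rewrite -[X in dotm _ X]mul1mx dotm_delta mxE eqxx. Qed.

(** Polarization: nonnegativity at e_i + e_j and e_i - e_j bounds |M i j| by the mean of M i i and M
    j j. *)
Lemma norm_le_of_quad n (M : 'M[R]_n) c : M^T = M -> 0 <= c ->
  (forall v : 'cV[R]_n, 0 <= dotm v (M *m v) <= c * dotm v v) -> `|M| <= c.
Proof.
move=> symM c0 hM; apply: norm_mx_le => // i j.
have E (s : R) (v w : 'cV[R]_n) : dotm (v + s *: w) (M *m (v + s *: w)) =
    dotm v (M *m v) + 2 * s * dotm v (M *m w) + s ^+ 2 * dotm w (M *m w).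
  have sw : dotm w (M *m v) = dotm v (M *m w) by rewrite dotm_mull symM dotmC.
  by rewrite mulmxDr -scalemxAr !dotm_linear sw; ring.
pose d k := delta_mx k 0 : 'cV[R]_n.
have := E 1 (d i) (d j); have := E (-1) (d i) (d j).
have /andP[h1 _] := hM (d i + (-1) *: d j); have /andP[h2 _] := hM (d i + 1 *: d j).
have /andP[_ h3] := hM (d i); have /andP[_ h4] := hM (d j).
rewrite !dotm_delta_delta !dotm_delta in h3 h4 *.
by rewrite ler_norml => h5 h6; apply/andP; split; lra.
Qed.

Section Coercive.
Context {n : nat} {M : 'M[R]_n} {c : R}.
Hypotheses (c0 : 0 < c) (hM : forall v : 'cV[R]_n, c * dotm v v <= dotm v (M *m v)).

Lemma coercive_unitmx : M \in unitmx.
Proof.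
rewrite -unitmx_tr unitmxE unitfE; apply/det0P => -[v v0 vM].
have : c * dotm v^T v^T <= 0.
  apply: le_trans (hM _) _.
  by rewrite -[M]trmxK -trmx_mul vM trmx0 dotm0r.
rewrite pmulr_rle0// => h; move: v0; rewrite -(trmxK v).
by rewrite (dotm_eq0 (A := v^T)) ?trmx0 ?eqxx//; apply/eqP; rewrite eq_le h dotm_ge0.
Qed.

Lemma coercive_inv_dotm (y : 'cV[R]_n) :
  c ^+ 2 * dotm (invmx M *m y) (invmx M *m y) <= dotm y y.
Proof.
set w := invmx M *m y; have := hM w.
rewrite mulmxA mulmxV ?coercive_unitmx// mul1mx.
have := dotm_young w y c0 => h1 h2.
have h : c * dotm w w <= c^-1 * dotm y y by lra.
have := h; rewrite -(ler_pM2l c0) mulrA -expr2 => /le_trans; apply.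
by rewrite mulrA divff ?gt_eqF// mul1r.
Qed.

Lemma coercive_inv_norm : `|invmx M| <= c^-1.
Proof.
apply: norm_mx_le => [|i j]; first by rewrite invr_ge0 ltW.
have ci0 : 0 <= c^-1 by rewrite invr_ge0 ltW.
rewrite -(@ler_pXn2r _ 2) ?nnegrE// exprVn.
rewrite -[leRHS]mulr1 ler_pdivlMl ?exprn_gt0//.
have := coercive_inv_dotm (delta_mx j 0); rewrite dotm_delta_delta; apply: le_trans.
rewrite ler_wpM2l ?exprn_ge0 ?(ltW c0)//; apply: le_trans (norm_sqr_le_dotm _).
rewrite ler_pXn2r ?nnegrE//; apply: le_trans (norm_entry _ i 0).
by rewrite -colE mxE.
Qed.
End Coercive.

(** This is M^2 <= mu M. It follows from M >= 0 tested on mu w - M w together with M <= mu I tested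
    on M w. *)
Lemma posdef_dotm_mulmx_le n (M : 'M[R]_n) mu (w : 'cV[R]_n) : M^T = M -> 0 < mu ->
  (forall v : 'cV[R]_n, 0 <= dotm v (M *m v) <= mu * dotm v v) ->
  dotm (M *m w) (M *m w) <= mu * dotm w (M *m w).
Proof.
move=> symM mu0 hM; set y := M *m w.
have /andP[h _] := hM (mu *: w - y); have /andP[_ h'] := hM y.
have E : dotm w (M *m y) = dotm y y by rewrite dotm_mull symM.
move: h; rewrite mulmxBr -scalemxAr !dotm_linear E -/y => h.
by rewrite -(ler_pM2l mu0); lra.
Qed.

Lemma sym_posdef_unitmx n (M : 'M[R]_n) : sym_posdef M -> M \in unitmx.
Proof.
move=> [symM pM]; rewrite unitmxE unitfE; apply/det0P => -[v v0 vM].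
have := pM v^T; rewrite trmx_eq0 => /(_ v0).
by rewrite trmxK vM mul0mx mxE ltxx.
Qed.

(* With [u = KD^-1 x], expand [0 <= (x - s u)^T KD (x - s u)] for small [s]. *)
Lemma sym_posdef_coercive n (M : 'M[R]_n) : sym_posdef M ->
  exists2 c, 0 < c & forall v : 'cV[R]_n, c * dotm v v <= dotm v (M *m v).
Proof.
move=> pM; have uM := sym_posdef_unitmx pM; have [symM posM] := pM.
pose b := (n * n)%:R * `|invmx M| + 1.
have b0 : 0 < b by rewrite ltr_wpDl// mulr_ge0.
exists b^-1 => [|v]; first by rewrite invr_gt0.
have nn (x : 'cV[R]_n) : 0 <= dotm x (M *m x).
  have [->|x0] := eqVneq x 0; first by rewrite dotm0l.
  by rewrite -dotm_cV mulmxA ltW// posM.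
set u := invmx M *m v; have := nn (v - b^-1 *: u).
have Mu : M *m u = v by rewrite mulmxA mulmxV// mul1mx.
have E : dotm u (M *m v) = dotm v v by rewrite dotm_mull symM Mu.
rewrite mulmxBr -scalemxAr Mu !dotm_linear E (dotmC u v).
have hb : dotm v u <= b * dotm v v.
  by apply: le_trans (quad_le _ _) _; rewrite ler_wpM2r ?dotm_ge0// lerDl.
have : b^-1 * (b^-1 * dotm v u) <= b^-1 * dotm v v.
  by rewrite ler_pM2l ?invr_gt0// ler_pdivrMl.
by lra.
Qed.

End QuadraticForms.

(* Closes an identity between expanded matrix expressions: the products are
   abstracted, what remains is linear. *)
Ltac mx_linear := repeat match goal with
  |- context [@mulmx ?R ?m ?n ?p ?A ?B] => move: (@mulmx R m n p A B) => ? end;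
  let i := fresh "i" in let j := fresh "j" in
  apply/matrixP => i j; rewrite !mxE; ring.

(** * Symmetry, sign and boundedness of Riccati solutions *)

Section Riccati.
Context {R : realType} {n : nat}.
Local Notation hdw := has_derivative_within.
Variables A S Q P : R -> 'M[R]_n.
Hypothesis cA : forward_continuous A.
Hypothesis cS : forward_continuous S.
Hypothesis symS : forall t, 0 <= t -> (S t)^T = S t.
Hypothesis symQ : forall t, 0 <= t -> (Q t)^T = Q t.
Hypothesis Qge0 : forall t, 0 <= t -> loewner_le 0 (Q t).
Hypothesis Sge0 : forall t, 0 <= t -> loewner_le 0 (S t).
Hypothesis P0sym : (P 0)^T = P 0.
Hypothesis P0ge0 : loewner_le 0 (P 0).
Hypothesis hP : solves_on `[0, +oo[ P
  (fun t => P t *m (A t)^T + A t *m P t - P t *m S t *m P t + Q t).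

Let cP : forward_continuous P.
Proof. exact: hdw_forward_continuous hP. Qed.

(** For W = P - P^T take F = A - P^T S: the mixed products P^T S P cancel in F W + W F^T and the
    difference of the two quadratic terms remains. So W solves a homogeneous equation. *)
Lemma riccati_sym t : 0 <= t -> (P t)^T = P t.
Proof.
move=> t0; apply/esym/eqP; rewrite -subr_eq0; apply/eqP.
apply: (@lyapunov_zero _ _ (fun t => A t - (P t)^T *m S t) (fun t => P t - (P t)^T)) => //;
  last by rewrite P0sym subrr.
  move=> s; apply: cvgB; first exact: cA.
  by apply: cvg_mulmx; [apply: cvg_trmx; exact: cP | exact: cS].
move=> s hs; have s0 : 0 <= s by move: hs; rewrite /= in_itv /= andbT.
suff <- : (P s *m (A s)^T + A s *m P s - P s *m S s *m P s + Q s) -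
   (P s *m (A s)^T + A s *m P s - P s *m S s *m P s + Q s)^T =
  (A s - (P s)^T *m S s) *m (P s - (P s)^T)
    + (P s - (P s)^T) *m (A s - (P s)^T *m S s)^T.
  exact: (hdwB (hP hs) (hdw_trmx (hP hs))).
rewrite !(trmxD, trmxN, trmx_mul, trmxK) symS// symQ//.
rewrite !(mulmxDl, mulmxDr, mulmxN, mulNmx) !mulmxA.
mx_linear.
Qed.

(** The Riccati equation in Joseph form: with F = A - P S its source is P S P + Q, which is
    nonnegative. *)
Lemma riccati_ge0 t : 0 <= t -> loewner_le 0 (P t).
Proof.
move=> t0.
apply: (@lyapunov_comparison _ _ (fun t => A t - P t *m S t)
  (fun t => P t *m S t *m P t + Q t) P) => //.
- move=> s; apply: cvgB; first exact: cA.
  by apply: cvg_mulmx; [exact: cP | exact: cS].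
- move=> s hs; have s0 : 0 <= s by move: hs; rewrite /= in_itv /= andbT.
  have := hP hs; suff -> : P s *m (A s)^T + A s *m P s - P s *m S s *m P s + Q s =
    (A s - P s *m S s) *m P s + P s *m (A s - P s *m S s)^T
    + (P s *m S s *m P s + Q s) by [].
  rewrite !(trmxD, trmxN, trmx_mul) symS// riccati_sym//.
  rewrite !(mulmxDl, mulmxDr, mulmxN, mulNmx) !mulmxA.
  mx_linear.
- move=> s s0; apply/loewner_leP => v; rewrite mul0mx dotm0r mulmxDl dotmDr.
  apply: addr_ge0; last by have /loewner_leP/(_ v) := Qge0 s0; rewrite mul0mx dotm0r.
  rewrite -!mulmxA dotm_mull riccati_sym//.
  by have /loewner_leP/(_ (P s *m v)) := Sge0 s0; rewrite mul0mx dotm0r.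
Qed.

(** Suboptimality of a fixed gain K: with F = A - K C, the difference k Pi - P satisfies a linear
    equation whose source is nonnegative for large k. *)
Lemma riccati_le m (C : 'M[R]_(m, n)) (Rt : R -> 'M[R]_m) (K : 'M[R]_(n, m))
    (Pi : 'M[R]_n) (c q r : R) :
  (forall t, 0 <= t -> S t = C^T *m invmx (Rt t) *m C) ->
  (forall t, 0 <= t -> (Rt t)^T = Rt t /\ Rt t \in unitmx) ->
  (forall t y, 0 <= t -> 0 <= dotm y (invmx (Rt t) *m (y : 'cV[R]_m))) ->
  (forall t y, 0 <= t -> dotm y (Rt t *m (y : 'cV[R]_m)) <= r * dotm y y) ->
  (forall t v, 0 <= t -> dotm v (Q t *m (v : 'cV[R]_n)) <= q * dotm v v) ->
  0 <= q -> 0 <= r -> Pi^T = Pi -> 0 < c ->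
  (forall v : 'cV[R]_n, c * dotm v v <= dotm v (Pi *m v)) ->
  (forall t (v : 'cV[R]_n), 0 <= t ->
     2 * dotm v ((A t - K *m C) *m Pi *m v) <= - dotm v v) ->
  exists2 p, 0 < p &
    forall t (v : 'cV[R]_n), 0 <= t -> dotm v (P t *m v) <= p * dotm v v.
Proof.
move=> hS hRt Rige0 hr hq q0 r0 symPi c0 hPi hK.
pose ck := (n * n)%:R * `|K *m K^T|; pose p0 := (n * n)%:R * `|P 0|.
have ck0 : 0 <= ck by rewrite mulr_ge0.
have p00 : 0 <= p0 by rewrite mulr_ge0.
(* The three terms pay in turn for Q, for K R K^T, and for the initial value P 0. *)
pose k := q + r * ck + p0 / c.
have pc0 : 0 <= p0 / c by rewrite divr_ge0// ltW.
have k0 : 0 <= k by rewrite addr_ge0// addr_ge0// mulr_ge0.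
pose pu := (n * n)%:R * `|Pi|.
have pu0 : 0 <= pu by rewrite mulr_ge0.
suff H t : 0 <= t -> loewner_le 0 (k *: Pi - P t).
  exists (k * pu + 1) => [|t v t0]; first by rewrite ltr_wpDl// mulr_ge0.
  have /loewner_leP/(_ v) := H t t0; rewrite mul0mx dotm0r mulmxBl -scalemxAl !dotm_linear.
  have : k * dotm v (Pi *m v) <= k * (pu * dotm v v) by rewrite ler_wpM2l// quad_le.
  by have := dotm_ge0 v; lra.
pose F t := A t - K *m C.
pose N t := (P t *m S t *m P t - K *m C *m P t - P t *m (K *m C)^T - Q t)
  - k *: (F t *m Pi + Pi *m (F t)^T).
move: t; apply: (@lyapunov_comparison _ _ F N (fun t => k *: Pi - P t)).
- by move=> s; apply: cvgB; [exact: cA | exact: cvg_cst].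
- move=> s hs; have s0 : 0 <= s by move: hs; rewrite /= in_itv /= andbT.
  have := hdwB (hdw_cst (v := k *: Pi)) (hP hs).
  suff -> : 0 - (P s *m (A s)^T + A s *m P s - P s *m S s *m P s + Q s) =
    F s *m (k *: Pi - P s) + (k *: Pi - P s) *m (F s)^T + N s by [].
  rewrite /N /F !(trmxD, trmxN) !(mulmxDl, mulmxDr, mulmxN, mulNmx, scalerDr).
  rewrite -?scalemxAl -?scalemxAr ?scalerN ?mulmxA.
  mx_linear.
- move=> s s0; apply/loewner_leP => v; rewrite mul0mx dotm0r.
  have [symR uR] := hRt s s0.
  pose y := C *m P s *m v; pose z := K^T *m v.
  have E1 : dotm v (P s *m S s *m P s *m v) = dotm y (invmx (Rt s) *m y).
    rewrite hS// -!mulmxA (dotm_mull (P s)) (dotm_mull C^T) trmxK riccati_sym//.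
    by rewrite /y !mulmxA.
  have E2 : dotm v (K *m C *m P s *m v) = dotm z y.
    by rewrite -!mulmxA (dotm_mull K) /y !mulmxA.
  have E3 : dotm v (P s *m (K *m C)^T *m v) = dotm z y.
    rewrite trmx_mul -!mulmxA (dotm_mull (P s)) (dotm_mull C^T) trmxK riccati_sym//.
    by rewrite dotmC mulmxA.
  have E4 : dotm v (Pi *m (F s)^T *m v) = dotm v (F s *m Pi *m v).
    by rewrite dotm_mull trmx_mul trmxK symPi dotmC.
  rewrite /N !(mulmxBl _ _ v) -scalemxAl (mulmxDl _ _ v) !dotm_linear E1 E2 E3 E4.
  (* Completing the square: R^-1 tested on y - R z gives y.R^-1 y - 2 z.y >= - z.R z, and the right
     side is bounded by the r [ck] share of k. *)
  have h1 := Rige0 s (y - Rt s *m z) s0.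
  have symRi : (invmx (Rt s))^T = invmx (Rt s) by rewrite trmx_inv symR.
  have E5 : dotm (Rt s *m z) (invmx (Rt s) *m y) = dotm z y.
    by rewrite dotm_mull symRi (mulmxA _ (Rt s) z) mulVmx// mul1mx.
  move: h1; rewrite mulmxBr (mulmxA _ (Rt s) z) mulVmx// mul1mx !dotm_linear E5.
  rewrite (dotmC y z) (dotmC (Rt s *m z) z) => h1.
  have h2 := hr s z s0; have h3 := hq s v s0; have h4 := hK s v s0.
  have h5 : dotm z z <= ck * dotm v v.
    by rewrite /z dotm_mull trmxK mulmxA dotmC; exact: quad_le.
  have h6 : r * dotm z z <= r * (ck * dotm v v) by rewrite ler_wpM2l.
  have h7 : k * (2 * dotm v (F s *m Pi *m v)) <= k * (- dotm v v) by rewrite ler_wpM2l.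
  have h8 : 0 <= p0 / c * dotm v v by rewrite mulr_ge0 ?dotm_ge0.
  have E6 : k * dotm v v = q * dotm v v + r * (ck * dotm v v) + p0 / c * dotm v v.
    by rewrite /k; ring.
  by lra.
- apply/loewner_leP => v; rewrite mul0mx dotm0r mulmxBl -scalemxAl !dotm_linear.
  have h1 := quad_le (P 0) v.
  have h2 : k * (c * dotm v v) <= k * dotm v (Pi *m v) by rewrite ler_wpM2l.
  have E6 : k * (c * dotm v v) = (q + r * ck) * c * dotm v v + p0 * dotm v v.
    by rewrite /k; field; rewrite gt_eqF.
  have h8 : 0 <= (q + r * ck) * c * dotm v v.
    apply: mulr_ge0; last exact: dotm_ge0.
    apply: mulr_ge0; last exact: ltW.
    by rewrite addr_ge0// mulr_ge0.
  by rewrite -/p0 in h1; lra.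
Qed.

End Riccati.

(** * The maps hat and vee *)

Section HatVee.
Context {R : realType}.
Implicit Types (w x y : 'cV[R]_3) (M N : 'M[R]_3).

Lemma trmx_hat w : (hat w)^T = - hat w.
Proof.
apply/matrixP => i j; rewrite !mxE.
by case: i => [[|[|[|]]]] //= hi; case: j => [[|[|[|]]]] //= hj; rewrite ?oppr0 ?opprK.
Qed.

Lemma dotm_hat_self w x : dotm x (hat w *m x) = 0.
Proof. have := dotm_mull (hat w) x x; rewrite trmx_hat mulNmx dotmNl (dotmC (_ *m _)); lra. Qed.

Lemma hatD x y : hat (x + y) = hat x + hat y.
Proof.
apply/matrixP => i j; rewrite !mxE.
by case: i => [[|[|[|]]]] //= hi; case: j => [[|[|[|]]]] //= hj; rewrite ?mxE; ring.
Qed.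

Lemma hatZ a x : hat (a *: x) = a *: hat x.
Proof.
apply/matrixP => i j; rewrite !mxE.
by case: i => [[|[|[|]]]] //= hi; case: j => [[|[|[|]]]] //= hj; rewrite ?mxE; ring.
Qed.

Lemma hatB x y : hat (x - y) = hat x - hat y.
Proof. by rewrite hatD -scaleN1r hatZ scaleN1r. Qed.

Lemma norm_hat w : `|hat w| <= `|w|.
Proof.
apply: norm_mx_le => // i j; rewrite !mxE.
by case: i => [[|[|[|]]]] //= hi; case: j => [[|[|[|]]]] //= hj;
  rewrite ?normr0 ?normrN ?norm_entry.
Qed.

Lemma veeD M N : vee (M + N) = vee M + vee N.
Proof.
apply/matrixP => i j; rewrite !mxE.
by case: i => [[|[|[|]]]] //= hi; rewrite !mxE.
Qed.

Lemma veeZ a M : vee (a *: M) = a *: vee M.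
Proof.
apply/matrixP => i j; rewrite !mxE.
by case: i => [[|[|[|]]]] //= hi; rewrite !mxE.
Qed.

Lemma norm_vee M : `|vee M| <= `|M|.
Proof.
apply: norm_mx_le => // i j; rewrite !mxE.
by case: i => [[|[|[|]]]] //= hi; rewrite norm_entry.
Qed.

Lemma crossC x y : cross x y = - cross y x.
Proof.
apply/matrixP => i j; rewrite !mxE.
by case: i => [[|[|[|]]]] //= hi; ring.
Qed.

Lemma hdw_vee (D : set R) (X : R -> 'M[R]_3) t V :
  has_derivative_within D X t V ->
  has_derivative_within D (fun s => vee (X s)) t (vee V).
Proof.
move=> hX; apply: hdw_mx => i j.
have H := fun i j => @hdw_entry _ _ _ _ _ _ _ i j hX.
case: i => [[|[|[|]]]] //= hi; rewrite !mxE /=; under eq_fun do rewrite !mxE /=;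
  exact: H.
Qed.

Lemma cvg_hat {T : Type} {F : set_system T} {FF : Filter F} (f : T -> 'cV[R]_3) w :
  f x @[x --> F] --> w -> hat (f x) @[x --> F] --> hat w.
Proof.
move=> fw; apply: cvg_mx => i j.
have H := fun i j => @cvg_entry _ _ _ _ _ _ _ _ i j fw.
case: i => [[|[|[|]]]] //= hi; case: j => [[|[|[|]]]] //= hj; rewrite !mxE /=;
  under eq_fun do rewrite !mxE /=; first [exact: cvg_cst | exact: H | apply: cvgN; exact: H].
Qed.

End HatVee.

(** * Uniform detectability of the linearized error system *)

Section Observer.
Context {R : realType}.
Variable J : 'M[R]_3.
Local Notation obsC := (@obsC R).

(** The derivative at Om0 of the gyroscopic term Om |-> J^-1 (J Om x Om). *)
Definition coupling (Om0 : 'cV[R]_3) : 'M[R]_3 :=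
  invmx J *m (hat (J *m Om0) - hat Om0 *m J).

Lemma obsAE Om0 : obsA J Om0 = block_mx (- hat Om0) 1%:M 0 (coupling Om0).
Proof. by []. Qed.

Lemma coupling_bounded : exists2 k, 0 <= k & forall w, `|coupling w| <= k * `|w|.
Proof.
pose k := 3 * (`|invmx J| * (3 * `|J| + 3 * `|J|)).
exists k => [|w]; first by rewrite !mulr_ge0 ?addr_ge0 ?mulr_ge0.
apply: le_trans (norm_mulmx _ _) _; rewrite /k -!mulrA ler_wpM2l// ler_wpM2l//.
apply: le_trans (ler_normB _ _) _; rewrite mulrDl; apply: lerD.
  by apply: le_trans (norm_hat _) _; apply: le_trans (norm_mulmx _ _) _; rewrite mulrA.
apply: le_trans (norm_mulmx _ _) _; rewrite -mulrA ler_wpM2l// mulrC ler_wpM2l//.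
exact: norm_hat.
Qed.

Lemma cvg_block_mx {T : Type} {F : set_system T} {FF : Filter F} m1 m2 n1 n2
  (f : T -> 'M[R]_(m1, n1)) (g : T -> 'M[R]_(m1, n2)) (h : T -> 'M[R]_(m2, n1))
  (k : T -> 'M[R]_(m2, n2)) (A : 'M[R]_(m1, n1)) (B : 'M[R]_(m1, n2))
  (C : 'M[R]_(m2, n1)) (D : 'M[R]_(m2, n2)) :
  f x @[x --> F] --> A -> g x @[x --> F] --> B -> h x @[x --> F] --> C ->
  k x @[x --> F] --> D ->
  block_mx (f x) (g x) (h x) (k x) @[x --> F] --> block_mx A B C D.
Proof.
move=> fA gB hC kD; apply: cvg_mx => i j; rewrite -(splitK i) -(splitK j).
case: (fintype.split i) => {}i; case: (fintype.split j) => {}j /=.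
- by under eq_fun do rewrite block_mxEul; rewrite block_mxEul; exact: cvg_entry.
- by under eq_fun do rewrite block_mxEur; rewrite block_mxEur; exact: cvg_entry.
- by under eq_fun do rewrite block_mxEdl; rewrite block_mxEdl; exact: cvg_entry.
- by under eq_fun do rewrite block_mxEdr; rewrite block_mxEdr; exact: cvg_entry.
Qed.

Lemma obsA_continuous (Om0 : R -> 'cV[R]_3) :
  forward_continuous Om0 -> forward_continuous (fun t => obsA J (Om0 t)).
Proof.
move=> cO t; have c := @cO t; apply: cvg_block_mx; try exact: cvg_cst.
  by apply: cvgN; exact: cvg_hat.
apply: cvg_mulmx; first exact: cvg_cst.
apply: cvgB; first by apply: cvg_hat; apply: cvg_mulmx => //; exact: cvg_cst.
by apply: cvg_mulmx; [exact: cvg_hat | exact: cvg_cst].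
Qed.

(* The blocks [Pi = [[1, b], [b, c]]] and [K = [k1; k2]] are chosen so that the
   cross terms of [2 v^T (A - K C) Pi v] cancel up to bounded couplings. *)
Lemma observer_gain w : 0 <= w -> exists (K : 'M[R]_(3 + 3, 3)) (Pi : 'M[R]_(3 + 3)) (c : R),
  [/\ Pi^T = Pi, 0 < c, forall v : 'cV[R]_(3 + 3), c * dotm v v <= dotm v (Pi *m v) &
    forall Om0 (v : 'cV[R]_(3 + 3)), `|Om0| <= w ->
      2 * dotm v ((obsA J Om0 - K *m obsC) *m Pi *m v) <= - dotm v v].
Proof.
move=> w0; have [k hk0 hk] := coupling_bounded.
(* For |Om0| <= w: [al] bounds the quadratic form of the coupling, [mu] the norm of the matrix M in
   the cross term b x.M y, and [be] the ratio |M y|^2 / |y|^2. *)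
pose al := 9 * (k * w); pose mu := w + k * w; pose be := 27 * mu ^+ 2.
have kw0 : 0 <= k * w by rewrite mulr_ge0.
have al0 : 0 <= al by rewrite /al; lra.
have be0 : 0 <= be by rewrite mulr_ge0// sqr_ge0.
pose b := al + 1; pose s := b ^+ 2 * be + 1.
have b0 : 0 <= b by rewrite /b; lra.
have bb0 : 0 <= b ^+ 2 * be by rewrite mulr_ge0// sqr_ge0.
have s0 : 0 < s by rewrite /s; lra.
(* c = k1 b + k2 cancels the x.y terms. Young's inequality with weight s bounds 2 b x.M y by s |x|^2
   + |y|^2, and k1 pays for the first part. Since b = al + 1, the choice of k2 leaves - |y|^2 after
   the coupling term c al |y|^2. *)
pose k1 := b + s / 2 + 1 / 2; pose k2 := al * k1 * b + 1; pose c := k1 * b + k2.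
have k10 : 0 <= k1 by rewrite /k1; lra.
have k2_1 : 1 <= k2 by rewrite /k2 lerDr !mulr_ge0.
have k1b : b ^+ 2 <= k1 * b by rewrite expr2 ler_wpM2r// /k1; lra.
exists (col_mx k1%:M k2%:M), (block_mx 1%:M b%:M b%:M c%:M), ((2 * b ^+ 2 + 2)^-1).
have Piv (x y : 'cV[R]_3) : block_mx 1%:M b%:M b%:M c%:M *m col_mx x y =
    col_mx (x + b *: y) (b *: x + c *: y) :> 'cV[R]_(3 + 3).
  by rewrite mul_block_col mul1mx !mul_scalar_mx.
split.
- by rewrite tr_block_mx !tr_scalar_mx.
- by rewrite invr_gt0; have := sqr_ge0 b; lra.
- move=> v; rewrite -[v]vsubmxK; set x := usubmx v; set y := dsubmx v.
  have b2 : 0 < 2 * b ^+ 2 + 2 by have := sqr_ge0 b; lra.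
  rewrite Piv !dotm_col_mx ler_pdivrMl// !dotm_linear (dotmC y x).
  have := dotm_ge0 (x + (2 * b) *: y); have h1 := dotm_ge0 (x + b *: y).
  rewrite !dotm_linear (dotmC y x) in h1 *; move=> h2.
  have h3 := dotm_ge0 y; have h4 : 0 <= b ^+ 2 by exact: sqr_ge0.
  set X := dotm x x in h1 h2 *; set Y := dotm y y in h1 h2 h3 *.
  set XY := dotm x y in h1 h2 *.
  have h5 : (b ^+ 2 + 1) * Y <= c * Y by rewrite ler_wpM2r// /c; lra.
  have h6 : 0 <= b ^+ 2 * (X + 2 * b * XY + b ^+ 2 * Y) by rewrite mulr_ge0//; lra.
  have h7 : 0 <= b ^+ 2 * (c * Y - (b ^+ 2 + 1) * Y) by rewrite mulr_ge0//; lra.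
  have h8 : 0 <= b ^+ 2 * Y by rewrite mulr_ge0.
  by lra.
- move=> Om0 v hO; rewrite -[v]vsubmxK; set x := usubmx v; set y := dsubmx v.
  have -> : obsA J Om0 - col_mx k1%:M k2%:M *m obsC =
      block_mx (- hat Om0 - k1%:M) 1%:M (- k2%:M) (coupling Om0).
    rewrite obsAE mul_col_row !mulmx1 !mulmx0 opp_block_mx add_block_mx.
    by rewrite !oppr0 !addr0 add0r.
  rewrite -mulmxA Piv mul_block_col !dotm_col_mx mulmxBl mul1mx mulNmx mul_scalar_mx.
  rewrite mulNmx mul_scalar_mx !mulmxDr -!scalemxAr !dotm_linear dotm_hat_self.
  pose M := (coupling Om0)^T - hat Om0.
  have e1 : dotm y (coupling Om0 *m x) = dotm x (M *m y) + dotm x (hat Om0 *m y).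
    by rewrite -dotmDr mulmxBl subrK dotm_mull dotmC.
  have hc : `|coupling Om0| <= k * w by apply: le_trans (hk _) _; rewrite ler_wpM2l.
  have hM : `|M| <= mu.
    apply: le_trans (ler_normB _ _) _; rewrite norm_trmx addrC.
    by apply: lerD => //; exact: le_trans (norm_hat _) hO.
  have h1 : dotm y (coupling Om0 *m y) <= al * dotm y y.
    apply: le_trans (quad_le _ _) _; rewrite ler_wpM2r ?dotm_ge0//.
    by rewrite /al (_ : (3 * 3)%:R = 9)// ler_wpM2l.
  have h2 : dotm (M *m y) (M *m y) <= be * dotm y y.
    rewrite dotm_mull mulmxA dotmC; apply: le_trans (quad_le _ _) _.
    rewrite ler_wpM2r ?dotm_ge0//; apply: le_trans (ler_wpM2l _ (norm_mulmx _ _)) _ => //.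
    rewrite norm_trmx (_ : (3 * 3)%:R = 9 :> R)// /be expr2.
    have -> : 9 * (3%:R * (`|M| * `|M|)) = 27 * (`|M| * `|M|) by ring.
    by rewrite ler_wpM2l// ler_pM.
  have h3 := dotm_young x (b *: (M *m y)) s0; rewrite !dotm_linear in h3.
  have h4 : s^-1 * (b * (b * dotm (M *m y) (M *m y))) <= dotm y y.
    rewrite ler_pdivrMl// mulrA -expr2.
    apply: (@le_trans _ _ (b ^+ 2 * (be * dotm y y))); first by rewrite ler_wpM2l ?sqr_ge0.
    by rewrite mulrA ler_wpM2r ?dotm_ge0// /s; lra.
  rewrite e1 (dotmC y x); set XMY := dotm x (M *m y) in h3 *.
  set XHY := dotm x (hat Om0 *m y).
  have h5 : c * dotm y (coupling Om0 *m y) <= c * (al * dotm y y).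
    by rewrite ler_wpM2l// /c addr_ge0 ?mulr_ge0//; lra.
  set Y := dotm y y in h4 h5 *; set X := dotm x x in h3 *.
  set YCY := dotm y (coupling Om0 *m y) in h5 *.
  have E1 : c * (al * Y) = b * (k2 * Y) - Y by rewrite /c /k2 /b; ring.
  have E2 : k1 * X = b * X + s * X / 2 + X / 2 by rewrite /k1; field.
  have E3 : c * dotm x y = k1 * (b * dotm x y) + k2 * dotm x y by rewrite /c; ring.
  by lra.
Qed.

End Observer.

(** * A Lyapunov function for the estimation error *)

Section EstimatorLyapunov.
Context {R : realType}.
Local Notation hdw := has_derivative_within.

(** The identity behind [cvg_invmx], applied to the difference quotient. *)
Lemma hdw_invmx {n} {D : set R} {M : R -> 'M[R]_n} {t V} b :
  (forall s, D s -> M s \in unitmx /\ `|invmx (M s)| <= b) -> D t ->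
  hdw D M t V -> hdw D (fun s => invmx (M s)) t (- (invmx (M t) *m V *m invmx (M t))).
Proof.
move=> hM Dt hV.
have cX : invmx (M (t + h)) @[h --> within [set h | D (t + h)] 0^'] --> invmx (M t).
  apply: (@cvg_invmx _ _ _ _ _ _ _ b); first exact: (hdw_continuous hV).
    by have [] := hM t Dt.
  by rewrite near_withinE; apply: nearW => h /= /hM.
have H : - (invmx (M (t + h)) *m (h^-1 *: (M (t + h) - M t)) *m invmx (M t))
    @[h --> within [set h | D (t + h)] 0^'] --> - (invmx (M t) *m V *m invmx (M t)).
  by apply: cvgN; apply: cvg_mulmx; [exact: cvg_mulmx | exact: cvg_cst].
apply: cvg_trans H; apply: near_eq_cvg; rewrite near_withinE; apply: nearW => h /= Dh.
have [u1 _] := hM _ Dh; have [u2 _] := hM t Dt.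
rewrite -scalemxAr -scalemxAl -scalerN mulmxBr mulmxBl mulVmx// mul1mx.
by rewrite -mulmxA mulmxV// mulmx1 opprB.
Qed.

Lemma norm_block_mx_le m1 m2 n1 n2 (A : 'M[R]_(m1, n1)) (B : 'M[R]_(m1, n2))
    (C : 'M[R]_(m2, n1)) (D : 'M[R]_(m2, n2)) c :
  `|A| <= c -> `|B| <= c -> `|C| <= c -> `|D| <= c -> `|block_mx A B C D| <= c.
Proof.
move=> hA hB hC hD; apply: norm_mx_le => [|i j]; first exact: le_trans hA.
rewrite -(splitK i) -(splitK j).
case: (fintype.split i) => {}i; case: (fintype.split j) => {}j /=.
- by rewrite block_mxEul; apply: le_trans hA; exact: norm_entry.
- by rewrite block_mxEur; apply: le_trans hB; exact: norm_entry.
- by rewrite block_mxEdl; apply: le_trans hC; exact: norm_entry.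
- by rewrite block_mxEdr; apply: le_trans hD; exact: norm_entry.
Qed.

Lemma norm_1mx {n} : `|1%:M : 'M[R]_n| <= 1.
Proof.
apply: norm_mx_le => // i j; rewrite mxE.
by case: eqP; rewrite ?normr1 ?normr0.
Qed.

(** With v = (P + dl I)^-1 e the left side is the derivative of e^T (P + dl I)^-1 e along e' = (A -
    P S) e + h. The terms in A P cancel, the ones in S form a square, and the shift leaves only the
    two terms with dl. *)
Lemma riccati_dissipation n (A P S Q : 'M[R]_n) dl (v e h : 'cV[R]_n) :
  P^T = P -> S^T = S -> e = P *m v + dl *: v ->
  2 * dotm v ((A - P *m S) *m e + h) - dotm v ((P *m A^T + A *m P - P *m S *m P + Q) *m v)
  = 2 * dl * dotm v (A *m v) + dl ^+ 2 * dotm v (S *m v) - dotm e (S *m e)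
    - dotm v (Q *m v) + 2 * dotm v h.
Proof.
move=> symP symS ->.
have sw B : dotm v (P *m B) = dotm (P *m v) B by rewrite dotm_mull symP.
have sS : dotm v (S *m (P *m v)) = dotm (P *m v) (S *m v) by rewrite dotm_mull symS dotmC.
rewrite !(mulmxDl, mulmxDr, mulNmx, =^~ scalemxAr) -!mulmxA !dotm_linear !sw sS.
rewrite (dotm_mull A^T) trmxK (dotmC (A *m _)).
ring.
Qed.

Variables (J : 'M[R]_3) (Om0 : R -> 'cV[R]_3) (P Q : R -> 'M[R]_(3 + 3)) (Rt : R -> 'M[R]_3).
Variables (w gamma1 gamma2 gamma3 gamma4 : R).
Hypothesis hO : forall t, 0 <= t -> `|Om0 t| <= w.
Hypothesis cO : forward_continuous Om0.
Hypothesis cR : forward_continuous Rt.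
Hypothesis gamma1_gt0 : 0 < gamma1.
Hypothesis gamma2_gt0 : 0 < gamma2.
Hypothesis gamma3_gt0 : 0 < gamma3.
Hypothesis gamma4_gt0 : 0 < gamma4.
Hypothesis symQ : forall t, 0 <= t -> (Q t)^T = Q t.
Hypothesis symR : forall t, 0 <= t -> (Rt t)^T = Rt t.
Hypothesis hQ : forall t, 0 <= t -> loewner_le gamma1%:M (Q t) /\ loewner_le (Q t) gamma2%:M.
Hypothesis hR : forall t, 0 <= t -> loewner_le gamma3%:M (Rt t) /\ loewner_le (Rt t) gamma4%:M.
Hypothesis P0sym : (P 0)^T = P 0.
Hypothesis P0ge0 : loewner_le 0 (P 0).
Hypothesis hP : solves_on `[0, +oo[ P (fun t => riccati J (Om0 t) (Q t) (Rt t) (P t)).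

Local Notation C := (@obsC R).
Local Notation S t := (C^T *m invmx (Rt t) *m C).
Local Notation A t := (obsA J (Om0 t)).

Lemma scalar_loewnerE n a (v : 'cV[R]_n) : dotm v (a%:M *m v) = a * dotm v v.
Proof. by rewrite mul_scalar_mx dotmZr. Qed.

Lemma noise_coercive t : 0 <= t ->
  forall v : 'cV[R]_3, gamma3 * dotm v v <= dotm v (Rt t *m v).
Proof. by move=> /hR[/loewner_leP h _] v; rewrite -scalar_loewnerE. Qed.

Lemma noise_unitmx t : 0 <= t -> Rt t \in unitmx.
Proof. by move=> t0; exact: coercive_unitmx gamma3_gt0 (noise_coercive t0). Qed.

Lemma noise_inv_norm t : 0 <= t -> `|invmx (Rt t)| <= gamma3^-1.
Proof. by move=> t0; exact: coercive_inv_norm gamma3_gt0 (noise_coercive t0). Qed.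

Lemma noise_inv_ge0 t (y : 'cV[R]_3) : 0 <= t -> 0 <= dotm y (invmx (Rt t) *m y).
Proof.
move=> t0; have := noise_coercive t0 (invmx (Rt t) *m y).
rewrite mulmxA mulmxV ?noise_unitmx// mul1mx (dotmC y); apply: le_trans.
by rewrite mulr_ge0 ?dotm_ge0// ltW.
Qed.

Lemma noise_inv_continuous : forward_continuous (fun t => invmx (Rt t)).
Proof.
move=> t; have s0 (s : R) : 0 <= Num.max 0 s by rewrite le_max lexx.
apply: (@cvg_invmx _ _ _ _ _ _ _ gamma3^-1); [exact: cR | exact: noise_unitmx |].
by apply: nearW => s; split; [exact: noise_unitmx | exact: noise_inv_norm].
Qed.

Lemma covariance_bound : exists2 p, 0 < p & forall t, 0 <= t ->
  (P t)^T = P t /\ forall v : 'cV[R]_(3 + 3), 0 <= dotm v (P t *m v) <= p * dotm v v.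
Proof.
have w0 : 0 <= w := le_trans (normr_ge0 _) (hO (lexx 0)).
have [K [Pi [c [symPi c0 hPi hK]]]] := observer_gain J w0.
have cA : forward_continuous (fun t => A t) by exact: obsA_continuous.
have cS : forward_continuous (fun t => S t).
  move=> t; apply: cvg_mulmx; last exact: cvg_cst.
  by apply: cvg_mulmx; [exact: cvg_cst | exact: noise_inv_continuous].
have symS t : 0 <= t -> (S t)^T = S t.
  by move=> t0; rewrite !trmx_mul trmxK trmx_inv symR// mulmxA.
have Sge0 t : 0 <= t -> loewner_le 0 (S t).
  move=> t0; apply/loewner_leP => v; rewrite mul0mx dotm0r -!mulmxA dotm_mull trmxK.
  exact: noise_inv_ge0.
have Qge0 t : 0 <= t -> loewner_le 0 (Q t).
  move=> t0; apply/loewner_leP => v; have [/loewner_leP/(_ v) h _] := hQ t0.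
  rewrite mul0mx dotm0r; apply: le_trans h.
  by rewrite scalar_loewnerE mulr_ge0 ?dotm_ge0// ltW.
have hP' : solves_on `[0, +oo[ P
    (fun t => P t *m (A t)^T + A t *m P t - P t *m S t *m P t + Q t).
  by move=> t /hP; rewrite /riccati !mulmxA.
have symP t (t0 : 0 <= t) : (P t)^T = P t by exact: (riccati_sym cA cS symS symQ P0sym hP' t0).
have Pge0 t (t0 : 0 <= t) : loewner_le 0 (P t).
  exact: (riccati_ge0 cA cS symS symQ Qge0 Sge0 P0sym P0ge0 hP' t0).
have [|||||p p0 hp] := @riccati_le R _ _ _ _ _ cA cS symS symQ P0sym hP' _ C Rt K Pi
    c gamma2 gamma4 (fun t _ => erefl) _ _ _ _ (ltW gamma2_gt0) (ltW gamma4_gt0) symPi c0 hPi.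
- by move=> t t0; split; [exact: symR | exact: noise_unitmx].
- by move=> t y; exact: noise_inv_ge0.
- by move=> t y t0; rewrite -scalar_loewnerE; have [_ /loewner_leP] := hR t0.
- by move=> t v t0; rewrite -scalar_loewnerE; have [_ /loewner_leP] := hQ t0.
- by move=> t v t0; apply: hK; exact: hO.
exists p => // t t0; split; first exact: symP.
move=> v; rewrite hp// andbT; have /loewner_leP/(_ v) := Pge0 t t0.
by rewrite mul0mx dotm0r.
Qed.

(** [h] is kept arbitrary to receive the quadratic remainders of the dynamics, and [D] because the
    estimate is applied on compact segments of time. *)
Lemma estimator_lyapunov : exists (X : R -> 'M[R]_(3 + 3)) (c1 c2 b a : R),
  [/\ 0 < c1, 0 < c2, 0 < a &
   (forall t e, 0 <= t -> `|X t| <= b /\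
      c1 * dotm e e <= dotm e (X t *m (e : 'cV[R]_(3 + 3))) <= c2 * dotm e e) /\
   forall (D : set R) t (e : R -> 'cV[R]_(3 + 3)) h,
     (forall s, D s -> 0 <= s) -> D t ->
     hdw D P t (riccati J (Om0 t) (Q t) (Rt t) (P t)) ->
     hdw D e t ((A t - P t *m C^T *m invmx (Rt t) *m C) *m e t + h) ->
     exists2 v, hdw D (fun s => dotm (e s) (X s *m e s)) t v &
       v <= - a * dotm (e t) (e t) + 2 * dotm (X t *m e t) h].
Proof.
have w0 : 0 <= w := le_trans (normr_ge0 _) (hO (lexx 0)).
have [p p0 hp] := covariance_bound.
have [k k0 hk] := coupling_bounded J.
have kw0 : 0 <= k * w by rewrite mulr_ge0.
have g30 : 0 < gamma3^-1 by rewrite invr_gt0.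
pose f := 36 * (w + 1 + k * w) + 36 * (9 * gamma3^-1) + 1.
have f1 : 1 <= f by rewrite /f; lra.
have f0 : 0 < f by lra.
have hA t (v : 'cV[R]_(3 + 3)) : 0 <= t -> dotm v (A t *m v) <= f * dotm v v.
  move=> t0; apply: le_trans (quad_le _ _) _; rewrite ler_wpM2r ?dotm_ge0//.
  apply: (@le_trans _ _ (36 * (w + 1 + k * w))); last by rewrite /f; lra.
  rewrite (_ : ((3 + 3) * (3 + 3))%:R = 36)// ler_wpM2l//.
  rewrite obsAE; apply: norm_block_mx_le.
  - by rewrite normrN; apply: le_trans (norm_hat _) _; have := hO t0; lra.
  - by apply: le_trans norm_1mx _; lra.
  - by rewrite normr0; lra.
  - apply: le_trans (hk _) _; have : k * `|Om0 t| <= k * w by rewrite ler_wpM2l// hO.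
    by lra.
have hS t (v : 'cV[R]_(3 + 3)) : 0 <= t -> dotm v (S t *m v) <= f * dotm v v.
  move=> t0; apply: le_trans (quad_le _ _) _; rewrite ler_wpM2r ?dotm_ge0//.
  apply: (@le_trans _ _ (36 * (9 * gamma3^-1))); last by rewrite /f; lra.
  rewrite (_ : ((3 + 3) * (3 + 3))%:R = 36)// ler_wpM2l//.
  have C1 : `|C| <= 1.
    apply: norm_mx_le => // i j; rewrite mxE; case: splitP => l _; rewrite ?mxE ?normr0//.
    by case: eqP; rewrite ?normr1 ?normr0.
  apply: le_trans (norm_mulmx _ _) _; rewrite (_ : 9 = 3 * 3 :> R) -?mulrA; last by ring.
  rewrite ler_wpM2l// -[leRHS]mulr1 ler_pM//.
  apply: le_trans (norm_mulmx _ _) _; rewrite ler_wpM2l// norm_trmx -[leRHS]mul1r ler_pM//.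
  exact: noise_inv_norm.
(* Then 2 dl v.A v and dl^2 v.S v together cost at most gamma1 / 2 |v|^2, half of what Q
   supplies. *)
pose dl := Num.min 1 (gamma1 / (6 * f)).
have dl0 : 0 < dl by rewrite lt_min ltr01 divr_gt0// mulr_gt0.
have dl1 : dl <= 1 by rewrite ge_min lexx.
have dlf : dl * f <= gamma1 / 6.
  have : dl <= gamma1 / (6 * f) by rewrite ge_min lexx orbT.
  rewrite -(ler_pM2r f0) => /le_trans; apply.
  by rewrite le_eqVlt; apply/orP; left; apply/eqP; field; rewrite gt_eqF.
pose M t := P t + dl%:M.
have ME t v : M t *m v = P t *m v + dl *: (v : 'cV[R]_(3 + 3)).
  by rewrite mulmxDl mul_scalar_mx.
pose mu := p + dl.
have mu0 : 0 < mu by rewrite addr_gt0.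
have symM t : 0 <= t -> (M t)^T = M t.
  by move=> t0; rewrite trmxD tr_scalar_mx (hp t t0).1.
have hM t (v : 'cV[R]_(3 + 3)) : 0 <= t -> dl * dotm v v <= dotm v (M t *m v) <= mu * dotm v v.
  move=> t0; rewrite ME dotmDr dotmZr; have /andP[h1 h2] := (hp t t0).2 v.
  by rewrite /mu; apply/andP; split; lra.
have hMc t (t0 : 0 <= t) (v : 'cV[R]_(3 + 3)) : dl * dotm v v <= dotm v (M t *m v).
  by have /andP[] := hM t v t0.
have uM t : 0 <= t -> M t \in unitmx by move=> t0; exact: coercive_unitmx dl0 (hMc t t0).
have nX t : 0 <= t -> `|invmx (M t)| <= dl^-1 by move=> t0; exact: coercive_inv_norm dl0 (hMc t t0).
have hM0 t : 0 <= t -> forall v : 'cV[R]_(3 + 3), 0 <= dotm v (M t *m v) <= mu * dotm v v.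
  move=> t0 v; have /andP[h ->] := hM t v t0; rewrite andbT; apply: le_trans h.
  by rewrite mulr_ge0 ?dotm_ge0// ltW.
(* M lies between dl I and mu I, so its inverse lies between mu^-1 I and dl^-1 I. The factor mu^2 in
   the rate comes from |e| <= mu |v|. *)
exists (fun t => invmx (M t)), mu^-1, dl^-1, dl^-1, (gamma1 / 2 / mu ^+ 2).
split; rewrite ?invr_gt0//; first by rewrite divr_gt0 ?exprn_gt0// divr_gt0.
split=> [t e t0|D t e h D0 Dt hPt he].
  split; first exact: nX.
  set v := invmx (M t) *m e.
  have eE : e = M t *m v by rewrite mulmxA mulmxV ?mul1mx// uM.
  apply/andP; split.
    rewrite ler_pdivrMl// [in leLHS]eE [in X in _ * X]eE (dotmC _ v).
    exact: posdef_dotm_mulmx_le (symM t t0) mu0 (hM0 t t0).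
  have h1 := hMc t t0 v; rewrite -eE in h1; have h2 := dotm_young v e dl0.
  by rewrite (dotmC e v); lra.
have t0 := D0 t Dt; set v := invmx (M t) *m e t.
have eE : e t = M t *m v by rewrite mulmxA mulmxV ?mul1mx// uM.
have hMt : hdw D M t (riccati J (Om0 t) (Q t) (Rt t) (P t)).
  by rewrite -[X in hdw _ _ _ X]addr0; exact: (hdwD hPt hdw_cst).
have hX := hdw_invmx (b := dl^-1) (fun s Ds => conj (uM s (D0 s Ds)) (nX s (D0 s Ds))) Dt hMt.
eexists; first exact: (hdw_dotm he (hdw_mulmx hX he)).
have symX : (invmx (M t))^T = invmx (M t) by rewrite trmx_inv symM.
have [symPt _] := hp t t0.
set de := _ *m e t + h.
(* The derivative of X = M^-1 is - X P' X, so with v = X e the derivative of e^T X e reads 2 v.e' -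
   v^T P' v. *)
have -> : dotm de (invmx (M t) *m e t) + dotm (e t) (- (invmx (M t) *m
   riccati J (Om0 t) (Q t) (Rt t) (P t) *m invmx (M t)) *m e t + invmx (M t) *m de) =
   2 * dotm v de - dotm v (riccati J (Om0 t) (Q t) (Rt t) (P t) *m v).
  rewrite dotmDr mulNmx dotmNr (dotm_mull (invmx (M t)) _ de) symX -/v (dotmC de v).
  by rewrite -!mulmxA (dotm_mull (invmx (M t))) symX -/v; ring.
have -> : riccati J (Om0 t) (Q t) (Rt t) (P t) =
   P t *m (A t)^T + A t *m P t - P t *m S t *m P t + Q t by rewrite /riccati !mulmxA.
have -> : de = (A t - P t *m S t) *m e t + h by rewrite /de !mulmxA.
have ePv : e t = P t *m v + dl *: v by rewrite eE ME.
have symSt : (S t)^T = S t by rewrite !trmx_mul trmxK trmx_inv symR// mulmxA.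
rewrite (riccati_dissipation _ _ _ symPt symSt ePv).
have h1 : 0 <= dotm (e t) (S t *m e t).
  by rewrite -!mulmxA dotm_mull trmxK; exact: noise_inv_ge0.
have h2 : gamma1 * dotm v v <= dotm v (Q t *m v).
  by rewrite -scalar_loewnerE; have [/loewner_leP] := hQ t0.
have V0 := dotm_ge0 v.
have h3 : dl * dotm v (A t *m v) <= gamma1 / 6 * dotm v v.
  apply: (@le_trans _ _ (dl * (f * dotm v v))); first by rewrite ler_wpM2l ?hA// ltW.
  by rewrite mulrA ler_wpM2r.
have h4 : dl ^+ 2 * dotm v (S t *m v) <= gamma1 / 6 * dotm v v.
  apply: (@le_trans _ _ (dl * (dl * (f * dotm v v)))).
    by rewrite expr2 -mulrA !ler_wpM2l ?hS// ltW.
  apply: (@le_trans _ _ (dl * (f * dotm v v))); last by rewrite mulrA ler_wpM2r.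
  by rewrite ler_piMl// mulr_ge0 ?mulr_ge0// ltW.
have h5 : dotm (e t) (e t) <= mu ^+ 2 * dotm v v.
  rewrite eE; apply: le_trans (posdef_dotm_mulmx_le v (symM t t0) mu0 (hM0 t t0)) _.
  rewrite expr2 -mulrA ler_wpM2l ?(ltW mu0)//.
  by have /andP[] := hM t v t0.
have h6 : gamma1 / 2 / mu ^+ 2 * dotm (e t) (e t) <= gamma1 / 2 * dotm v v.
  by rewrite -mulrA ler_wpM2l ?divr_ge0 ?(ltW gamma1_gt0)// ler_pdivrMl ?exprn_gt0.
by lra.
Qed.
End EstimatorLyapunov.

(** * Attitude error dynamics *)

Section AttitudeError.
Context {R : realType}.
Local Notation hdw := has_derivative_within.
Implicit Types (w x y : 'cV[R]_3) (Z : 'M[R]_3).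

Definition skewv Z : 'cV[R]_3 := vee (2^-1 *: (Z - Z^T)).

Lemma sum3 (V : nmodType) (F : 'I_3 -> V) : \sum_i F i = F 0 + F 1 + F 2.
Proof.
rewrite !big_ord_recl big_ord0 addr0 addrA.
have -> : lift ord0 (ord0 : 'I_2) = 1 :> 'I_3 by apply/val_inj.
by have -> : lift ord0 (lift ord0 (ord0 : 'I_1)) = 2 :> 'I_3 by apply/val_inj.
Qed.

Lemma skewvD Z Z' : skewv (Z + Z') = skewv Z + skewv Z'.
Proof. by rewrite /skewv -veeD -scalerDr trmxD opprD addrACA. Qed.

Lemma skewvN Z : skewv (- Z) = - skewv Z.
Proof. by rewrite /skewv trmxN -opprD scalerN -scaleN1r veeZ scaleN1r. Qed.

Lemma skewvZ a Z : skewv (a *: Z) = a *: skewv Z.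
Proof. by rewrite /skewv trmxZ -scalerBr scalerA mulrC -scalerA veeZ. Qed.

Lemma skewv_hat w : skewv (hat w) = w.
Proof.
rewrite /skewv trmx_hat opprK (_ : hat w + hat w = 2 *: hat w); last first.
  by rewrite scaler_nat mulr2n.
by rewrite scalerA mulVf ?scale1r ?hatK.
Qed.

Lemma skewv_sym Z : skewv (Z + Z^T) = 0.
Proof. by rewrite /skewv trmxD trmxK [Z^T + _]addrC subrr scaler0 -(scale0r 0) veeZ scale0r. Qed.

(** The commutator of a skew matrix with the symmetric part of Z is symmetric. With the skew part it
    is the hat of a cross product. *)
Lemma skewv_commutator w Z : skewv (Z *m hat w - hat w *m Z) = - (hat w *m skewv Z).
Proof.
apply/matrixP => i j; rewrite ord1.
by case: i => [[|[|[|]]]] //= hi; rewrite !(mxE, sum3) /=; field.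
Qed.

Lemma dotm_hatr Z x : dotm Z (hat x) = 2 * dotm (skewv Z) x.
Proof. by rewrite !dotmE big_ord1 !(mxE, sum3) /=; field. Qed.

Lemma dotm_sym_skew Z :
  dotm Z Z = dotm (Z + Z^T) (Z + Z^T) / 4 + 2 * dotm (skewv Z) (skewv Z).
Proof. by rewrite !dotmE big_ord1 !(mxE, sum3) /=; field. Qed.

(** Commuting with a skew matrix is infinitesimal conjugation by rotations, which preserves the
    Frobenius norm. This removes the reference velocity from the rate of |Z|^2. *)
Lemma dotm_commutator w Z : dotm Z (Z *m hat w - hat w *m Z) = 0.
Proof.
have h1 := dotm_mulr (hat w) Z Z; have h2 := dotm_mull (hat w) Z Z.
rewrite trmx_hat mulmxN dotmNl (dotmC (_ *m _)) in h1.
rewrite trmx_hat mulNmx dotmNl (dotmC (_ *m _)) in h2.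
by rewrite dotmDr dotmNr; lra.
Qed.

Lemma dotm_sym Z : dotm Z (Z + Z^T) = dotm (Z + Z^T) (Z + Z^T) / 2.
Proof. by rewrite !dotm_linear !dotm_tr (dotmC Z^T); field. Qed.

Lemma norm_skewv Z : `|skewv Z| <= `|Z|.
Proof.
apply: le_trans (norm_vee _) _; rewrite normrZ ger0_norm ?invr_ge0//.
rewrite ler_pdivrMl//; apply: le_trans (ler_normB _ _) _.
by rewrite norm_trmx; lra.
Qed.

Lemma hdw_skewv {D : set R} {Z : R -> 'M[R]_3} {t V} :
  hdw D Z t V -> hdw D (fun s => skewv (Z s)) t (skewv V).
Proof.
move=> hZ; apply: hdw_vee; apply: hdw_scaler.
exact: (hdwB hZ (hdw_trmx hZ)).
Qed.

(** For R = R0 (I + Z) one has R^T R - I = Z + Z^T + Z^T Z. The bracket is (I + Z)(Z + Z^T + Z^T Z)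
    without its linear part Z + Z^T. *)
Definition attitude_remainder ke Z x : 'M[R]_3 :=
  Z *m hat x - ke *: (Z^T *m Z + Z *m (Z + Z^T) + Z *m Z^T *m Z).

Definition attitude_rate ke w Z x : 'M[R]_3 :=
  Z *m hat w - hat w *m Z + hat x - ke *: (Z + Z^T) + attitude_remainder ke Z x.

Lemma attitude_error_rate (ke : R) (D : set R) t (R0 Rot : R -> 'M[R]_3) (Om0 Om : 'cV[R]_3) :
  SO3 (R0 t) ->
  hdw D R0 t (rigid_body_R (R0 t) Om0) -> hdw D Rot t (extended_R ke (Rot t) Om) ->
  hdw D (fun s => (R0 s)^T *m (Rot s - R0 s)) t
    (attitude_rate ke Om0 ((R0 t)^T *m (Rot t - R0 t)) (Om - Om0)).
Proof.
move=> [RtR _] h0 h.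
(* Z is made opaque, so that replacing Rot by R0 (I + Z) does not unfold it again. *)
have [Z ZE] : exists Z, (R0 t)^T *m (Rot t - R0 t) = Z by eexists.
have RRt : R0 t *m (R0 t)^T = 1%:M by exact: mulmx1C.
have RotE : Rot t = R0 t *m (1%:M + Z).
  by rewrite -ZE mulmxDr mulmx1 mulmxA RRt mul1mx addrC subrK.
have := hdw_mulmx (hdw_trmx h0) (hdwB h h0).
rewrite ZE; suff <- : (rigid_body_R (R0 t) Om0)^T *m (Rot t - R0 t) + (R0 t)^T *m
   (extended_R ke (Rot t) Om - rigid_body_R (R0 t) Om0) =
   attitude_rate ke Om0 Z (Om - Om0) by [].
rewrite /extended_R /rigid_body_R trmx_mul trmx_hat -mulmxA ZE.
have -> : (Rot t)^T *m Rot t = (1%:M + Z)^T *m (1%:M + Z).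
  by rewrite RotE trmx_mul mulmxA -(mulmxA _ (R0 t)^T) RtR mulmx1.
rewrite RotE !mulmxDr !mulmxN -!scalemxAr !mulmxA RtR !mul1mx.
rewrite /attitude_rate /attitude_remainder hatB trmxD trmx1.
rewrite !(mulmxDl, mulmxDr, mulmxN, mulNmx, mul1mx, mulmx1) !mulmxA.
rewrite RtR !mul1mx.
mx_linear.
Qed.

Lemma skewv_attitude_rate ke w Z x : skewv (attitude_rate ke w Z x) =
  - (hat w *m skewv Z) + x + skewv (attitude_remainder ke Z x).
Proof.
rewrite /attitude_rate 3!skewvD skewv_commutator skewv_hat.
by rewrite skewvN skewvZ skewv_sym scaler0 subr0.
Qed.

Lemma dotm_attitude_rate ke w Z x : dotm Z (attitude_rate ke w Z x) =
  2 * dotm (skewv Z) x - ke / 2 * dotm (Z + Z^T) (Z + Z^T)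
  + dotm Z (attitude_remainder ke Z x).
Proof.
have -> : ke / 2 * dotm (Z + Z^T) (Z + Z^T) = ke * dotm Z (Z + Z^T).
  by rewrite dotm_sym; field.
rewrite -dotm_hatr -dotmZr -[dotm Z (hat x)]add0r -(dotm_commutator w Z).
by rewrite -dotmNr -!dotmDr.
Qed.

Lemma attitude_remainder_le ke : 0 < ke -> exists2 c, 0 < c & forall Z x r,
  `|Z| <= r -> `|x| <= r -> r <= 1 -> `|attitude_remainder ke Z x| <= c * r ^+ 2.
Proof.
(* The products in the bracket contribute 3, 6 and 9 times r^2; for the cubic one this uses r <=
   1. *)
move=> ke0; exists (3 + ke * 18) => [|Z x r hZ hx r1]; first by lra.
have r0 : 0 <= r := le_trans (normr_ge0 _) hZ.
have mm (A B : 'M[R]_3) a b : 0 <= b -> `|A| <= a -> `|B| <= b -> `|A *m B| <= 3 * (a * b).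
  move=> b0 hA hB; apply: le_trans (norm_mulmx _ _) _; rewrite ler_wpM2l//.
  by apply: ler_pM.
have hZt : `|Z^T| <= r by rewrite norm_trmx.
have hx' := le_trans (norm_hat x) hx.
have h1 := mm _ _ _ _ r0 hZ hx'.
have h2 := mm _ _ _ _ r0 hZt hZ.
have h3 : `|Z *m (Z + Z^T)| <= 3 * (r * (r + r)).
  apply: mm => //; first by rewrite addr_ge0.
  by apply: le_trans (ler_normD _ _) _; apply: lerD.
have h4 := mm _ _ _ _ r0 (mm _ _ _ _ r0 hZ hZt) hZ.
rewrite /attitude_remainder; apply: le_trans (ler_normB _ _) _.
rewrite normrZ (ger0_norm (ltW ke0)) mulrDl; apply: lerD; first by rewrite expr2.
rewrite -mulrA ler_wpM2l ?(ltW ke0)//.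
apply: le_trans (ler_normD _ _) _; have := ler_normD (Z^T *m Z) (Z *m (Z + Z^T)).
have : 3 * (3 * (r * r) * r) <= 9 * r ^+ 2.
  have -> : 3 * (3 * (r * r) * r) = 9 * r ^+ 2 * r by ring.
  by rewrite ler_piMr// mulr_ge0// sqr_ge0.
have E : 3 * (r * (r + r)) = 6 * r ^+ 2 by ring.
by rewrite E in h3; rewrite -expr2 in h2; lra.
Qed.

End AttitudeError.

(** * The closed loop in error coordinates *)

Section ClosedLoopRates.
Context {R : realType}.
Local Notation hdw := has_derivative_within.
Variables (J : 'M[R]_3) (ke kP : R) (KD : 'M[R]_3).
Hypothesis uJ : J \in unitmx.
Implicit Types (Om u x : 'cV[R]_3) (e z : 'cV[R]_(3 + 3)).

(** The part of the velocity error dynamics that is quadratic in x2. The expansion around Om0 stops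
    there, so [rigid_body_OmB] is exact. *)
Definition gyroscopic x2 : 'cV[R]_3 := invmx J *m cross (J *m x2) x2.

Definition estimate_feedback Om0 e : 'cV[R]_3 :=
  coupling J Om0 *m dsubmx e + kP *: usubmx e + KD *m dsubmx e.

Definition velocity_rate Om0 x1 x2 e : 'cV[R]_3 :=
  - (kP *: x1) - KD *m x2 + estimate_feedback Om0 e + gyroscopic x2.

Lemma rigid_body_OmB Om0 x2 u u0 :
  rigid_body_Om J (Om0 + x2) u - rigid_body_Om J Om0 u0 =
  coupling J Om0 *m x2 + invmx J *m (u - u0) + gyroscopic x2.
Proof.
have cr (a b : 'cV[R]_3) : hat (J *m a) *m b = - (hat b *m J *m a).
  by rewrite hat_mulE crossC -hat_mulE mulmxA.
rewrite /rigid_body_Om /coupling /gyroscopic -!hat_mulE (mulmxDr J) hatD.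
rewrite !(mulmxDl, mulmxDr) (cr x2 Om0) !(mulmxDl, mulmxDr, mulmxN, mulNmx) !mulmxA.
mx_linear.
Qed.

(** The cross products in the controller cancel the coupling of the estimated velocity, leaving the
    coupling of its error. Likewise the proportional and derivative terms act on the true state up
    to their value on e. *)
Lemma controller_feedback Om0 u0 x1 x2 e :
  coupling J Om0 *m x2 + invmx J *m (controller J kP KD Om0 u0 (col_mx x1 x2 - e) - u0)
  + gyroscopic x2 = velocity_rate Om0 x1 x2 e.
Proof.
rewrite -[e]vsubmxK /controller /velocity_rate /estimate_feedback opp_col_mx add_col_mx.
rewrite !col_mxKu !col_mxKd; set e1 := usubmx e; set e2 := dsubmx e.
have -> (a b : 'cV[R]_3) : cross (J *m a) b = - (hat b *m J *m a).
  by rewrite crossC -hat_mulE mulmxA.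
have -> (a : 'cV[R]_3) : cross (J *m Om0) a = hat (J *m Om0) *m a by rewrite -hat_mulE.
rewrite /coupling !(mulmxDl, mulmxDr, mulmxN, mulNmx, =^~ scalemxAr).
rewrite !scalerDr ?scalerN !mulmxA mulVmx// ?mul1mx.
mx_linear.
Qed.

(** Plant and observer share the linear part and the input, which drop out of the difference. The
    nonlinear remainders r1 and q2 are left as forcing. *)
Lemma estimator_rate Om0 P Rt u u0 x1 x2 e r1 q2 :
  col_mx (- (hat Om0 *m x1) + x2 + r1) (coupling J Om0 *m x2 + invmx J *m (u - u0) + q2)
  - observer J Om0 P Rt (col_mx x1 x2 - e) (u - u0) x1 =
  (obsA J Om0 - P *m (@obsC R)^T *m invmx Rt *m @obsC R) *m e + col_mx r1 q2.
Proof.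
have Cc : @obsC R *m col_mx x1 x2 = x1 by rewrite mul_row_col mul1mx mul0mx addr0.
have Ac : obsA J Om0 *m col_mx x1 x2 = col_mx (- (hat Om0 *m x1) + x2) (coupling J Om0 *m x2).
  by rewrite obsAE mul_block_col mul1mx mul0mx add0r mulNmx.
have -> : col_mx (- (hat Om0 *m x1) + x2 + r1)
     (coupling J Om0 *m x2 + invmx J *m (u - u0) + q2) =
   obsA J Om0 *m col_mx x1 x2 + obsB J *m (u - u0) + col_mx r1 q2.
  by rewrite Ac mul_col_mx mul0mx !add_col_mx addr0.
rewrite /observer (mulmxBr (obsC R)) Cc (mulmxBr (obsA J Om0)) !mulmxBl.
rewrite opprB addrA.
have -> : x1 - obsC R *m e - x1 = - (obsC R *m e) by rewrite addrAC subrr add0r.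
rewrite mulmxN !mulmxA.
mx_linear.
Qed.

Lemma closed_loop_rates (D : set R) t (R0 Rot : R -> 'M[R]_3) (Om0 Om u0 : R -> 'cV[R]_3)
    (z : R -> 'cV[R]_(3 + 3)) P Rt :
  let u := controller J kP KD (Om0 t) (u0 t) (z t) in
  let Z s := (R0 s)^T *m (Rot s - R0 s) in
  let x2 s := Om s - Om0 s in
  let e s := col_mx (Zk_vee (R0 s) (Rot s)) (Om s - Om0 s) - z s in
  SO3 (R0 t) ->
  hdw D R0 t (rigid_body_R (R0 t) (Om0 t)) ->
  hdw D Om0 t (rigid_body_Om J (Om0 t) (u0 t)) ->
  hdw D Rot t (extended_R ke (Rot t) (Om t)) ->
  hdw D Om t (rigid_body_Om J (Om t) u) ->
  hdw D z t (observer J (Om0 t) P Rt (z t) (u - u0 t) (Zk_vee (R0 t) (Rot t))) ->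
  [/\ hdw D Z t (attitude_rate ke (Om0 t) (Z t) (x2 t)),
      hdw D x2 t (velocity_rate (Om0 t) (skewv (Z t)) (x2 t) (e t)) &
      hdw D e t ((obsA J (Om0 t) - P *m (@obsC R)^T *m invmx Rt *m @obsC R) *m e t
        + col_mx (skewv (attitude_remainder ke (Z t) (x2 t))) (gyroscopic (x2 t)))].
Proof.
move=> u Z x2 e so hR0 hO0 hRot hO hz.
have hZ := attitude_error_rate so hR0 hRot.
have OmE : Om t = Om0 t + x2 t by rewrite addrC subrK.
have zE : z t = col_mx (skewv (Z t)) (x2 t) - e t by rewrite /e subKr.
have hx2 := hdwB hO hO0.
rewrite [in X in hdw _ _ _ X]OmE rigid_body_OmB in hx2.
split=> //.
  by rewrite -(controller_feedback _ (u0 t)) -zE.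
have := hdwB (hdw_col_mx (hdw_skewv hZ) hx2) hz.
rewrite skewv_attitude_rate [in X in hdw _ _ _ X]zE.
by rewrite -[Zk_vee _ _]/(skewv (Z t)) estimator_rate.
Qed.

End ClosedLoopRates.

(** * Energy of the tracking error *)

Section TrackingLyapunov.
Context {R : realType}.
Local Notation hdw := has_derivative_within.
Variables (J : 'M[R]_3) (ke kP kd w : R) (KD : 'M[R]_3).
Hypotheses (ke0 : 0 < ke) (kP0 : 0 < kP) (kd0 : 0 < kd) (w0 : 0 <= w).
Hypothesis hKD : forall v : 'cV[R]_3, kd * dotm v v <= dotm v (KD *m v).
Variables (X : R -> 'M[R]_(3 + 3)) (c1 c2 b a3 : R).
Hypotheses (c10 : 0 < c1) (c20 : 0 < c2) (a30 : 0 < a3).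
Hypothesis hX : forall t e, 0 <= t -> `|X t| <= b /\
  c1 * dotm e e <= dotm e (X t *m (e : 'cV[R]_(3 + 3))) <= c2 * dotm e e.

Lemma gyroscopic_le : exists2 c, 0 <= c & forall (x : 'cV[R]_3) r, `|x| <= r ->
  `|gyroscopic J x| <= c * r ^+ 2.
Proof.
exists (27 * (`|invmx J| * `|J|)) => [|x r hx]; first by rewrite !mulr_ge0.
have r0 : 0 <= r := le_trans (normr_ge0 _) hx.
have h1 : `|hat (J *m x)| <= 3 * (`|J| * r).
  apply: le_trans (norm_hat _) _; apply: le_trans (norm_mulmx _ _) _.
  by rewrite ler_wpM2l// ler_wpM2l.
have h2 : `|cross (J *m x) x| <= 3 * (3 * (`|J| * r) * r).
  rewrite -hat_mulE; apply: le_trans (norm_mulmx _ _) _; rewrite ler_wpM2l//.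
  by apply: ler_pM.
apply: le_trans (norm_mulmx _ _) _.
have -> : 27 * (`|invmx J| * `|J|) * r ^+ 2 = 3 * (`|invmx J| * (3 * (3 * (`|J| * r) * r))) by ring.
by rewrite ler_wpM2l// ler_wpM2l.
Qed.

Lemma dotm_mulmx_self_le n m (M : 'M[R]_(m, n)) (x : 'cV[R]_n) c : `|M| <= c ->
  dotm (M *m x) (M *m x) <= (m * 1)%:R * (n%:R * c) ^+ 2 * dotm x x.
Proof.
move=> hM; have c0 := le_trans (normr_ge0 _) hM.
apply: le_trans (dotm_le_norm_sqr _) _; rewrite -mulrA ler_wpM2l//.
apply: (@le_trans _ _ ((n%:R * c) ^+ 2 * `|x| ^+ 2)); last first.
  by rewrite ler_wpM2l ?sqr_ge0// norm_sqr_le_dotm.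
rewrite -exprMn ler_pXn2r ?nnegrE ?mulr_ge0//.
by apply: le_trans (norm_mulmx _ _) _; rewrite -mulrA ler_wpM2l// ler_wpM2r.
Qed.

Lemma estimate_feedback_le : exists2 g, 0 <= g & forall Om0 (e : 'cV[R]_(3 + 3)),
  `|Om0| <= w ->
  dotm (estimate_feedback J kP KD Om0 e) (estimate_feedback J kP KD Om0 e) <= g * dotm e e.
Proof.
have [k k0 hk] := coupling_bounded J.
have kw0 : 0 <= k * w by rewrite mulr_ge0.
have nKD : 0 <= `|KD| by exact: normr_ge0.
exists (3 * (6 * (k * w + kP + `|KD|)) ^+ 2) => [|Om0 e hO].
  by rewrite mulr_ge0// sqr_ge0.
have -> : estimate_feedback J kP KD Om0 e = row_mx kP%:M (coupling J Om0 + KD) *m e.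
  rewrite /estimate_feedback -[e in RHS]vsubmxK mul_row_col mul_scalar_mx mulmxDl.
  by rewrite addrA [kP *: _ + _]addrC.
apply: le_trans (dotm_mulmx_self_le (c := k * w + kP + `|KD|) _ _) _.
  have hc : `|coupling J Om0| <= k * w by apply: le_trans (hk _) _; rewrite ler_wpM2l.
  apply: norm_mx_le => [|i j]; first by rewrite !addr_ge0 ?(ltW kP0).
  rewrite mxE; case: splitP => l _.
    rewrite mxE; case: eqP => _ /=; rewrite ?mulr1n ?mulr0n ?normr0.
      by rewrite gtr0_norm//; lra.
    by have := kP0; lra.
  apply: le_trans (norm_entry _ _ _) _; apply: le_trans (ler_normD _ _) _.
  by have := kP0; lra.
by [].
Qed.

Definition tracking_energy eps K t (Z : 'M[R]_3) (x : 'cV[R]_3) (e : 'cV[R]_(3 + 3)) : R :=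
  kP / 2 * dotm Z Z + dotm x x + 2 * eps * dotm (skewv Z) x + K * dotm e (X t *m e).

Definition squared_size (Z : 'M[R]_3) (x : 'cV[R]_3) (e : 'cV[R]_(3 + 3)) : R :=
  dotm Z Z + dotm x x + dotm e e.

Lemma norm_sqr_le_squared_size Z x e :
  [/\ `|Z| ^+ 2 <= squared_size Z x e, `|x| ^+ 2 <= squared_size Z x e &
    `|e| ^+ 2 <= squared_size Z x e].
Proof.
have := norm_sqr_le_dotm Z; have := norm_sqr_le_dotm x; have := norm_sqr_le_dotm e.
have := dotm_ge0 Z; have := dotm_ge0 x; have := dotm_ge0 e.
by rewrite /squared_size; split; lra.
Qed.

Lemma tracking_energy_bounds eps K : 0 <= eps -> eps <= 1 / 2 -> eps <= kP / 2 -> 0 < K ->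
  (* By [dotm_sym_skew] the term kP/2 |Z|^2 contains kP |x1|^2. The cross term costs at most eps
     (|x1|^2 + |x2|^2), that is half of this and half of |x2|^2. *)
  exists m1 m2, [/\ 0 < m1, 0 < m2 & forall t Z x e, 0 <= t ->
    m1 * squared_size Z x e <= tracking_energy eps K t Z x e <= m2 * squared_size Z x e].
Proof.
move=> e0 e1 e2 K0; pose m1 := Num.min (kP / 4) (Num.min (1 / 2) (K * c1)).
have m1a : m1 <= kP / 4 by rewrite ge_min lexx.
have m1b : m1 <= 1 / 2 by rewrite !ge_min lexx orbT.
have m1c : m1 <= K * c1 by rewrite !ge_min lexx !orbT.
have m10 : 0 < m1 by rewrite !lt_min !divr_gt0//= mulr_gt0.
have Kc0 : 0 < K * c2 by rewrite mulr_gt0.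
exists m1, (kP / 2 + 2 + K * c2); split=> // [|t Z x e t0]; first by lra.
rewrite /tracking_energy /squared_size dotm_sym_skew.
have [_ /andP[h1 h2]] := hX e t0.
set A := dotm (Z + Z^T) _; set X1 := dotm (skewv Z) (skewv Z).
set X2 := dotm x x; set E := dotm e e in h1 h2 *; set V := dotm e _ in h1 h2 *.
have A0 : 0 <= A by exact: dotm_ge0.
have X10 : 0 <= X1 by exact: dotm_ge0.
have X20 : 0 <= X2 by exact: dotm_ge0.
have E0 : 0 <= E by exact: dotm_ge0.
have y1 : 0 <= X1 + 2 * dotm (skewv Z) x + X2.
  have := dotm_ge0 (skewv Z + x); rewrite !dotm_linear (dotmC x (skewv Z)) -/X1 -/X2; lra.
have y2 : 0 <= X1 - 2 * dotm (skewv Z) x + X2.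
  have := dotm_ge0 (skewv Z - x); rewrite !dotm_linear (dotmC x (skewv Z)) -/X1 -/X2; lra.
set S := dotm (skewv Z) x in y1 y2 *.
have p1 := mulr_ge0 e0 y1; have p2 := mulr_ge0 e0 y2.
have p3 : K * (c1 * E) <= K * V by rewrite ler_pM2l.
have p4 : K * V <= K * (c2 * E) by rewrite ler_pM2l.
have q1 : eps * X1 <= kP / 2 * X1 by rewrite ler_wpM2r.
have q1' : eps * X1 <= 1 / 2 * X1 by rewrite ler_wpM2r.
have q2 : eps * X2 <= 1 / 2 * X2 by rewrite ler_wpM2r.
have r1 : m1 * A <= kP / 4 * A by rewrite ler_wpM2r.
have r2 : m1 * X1 <= kP / 4 * X1 by rewrite ler_wpM2r.
have r3 : m1 * X2 <= 1 / 2 * X2 by rewrite ler_wpM2r.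
have r4 : m1 * E <= K * c1 * E by rewrite ler_wpM2r.
have s1 := mulr_ge0 (ltW Kc0) A0; have s2 := mulr_ge0 (ltW Kc0) X10.
have s3 := mulr_ge0 (ltW Kc0) X20; have s4 := mulr_ge0 (ltW kP0) E0.
have s5 := mulr_ge0 (ltW kP0) X20; have s6 := mulr_ge0 (ltW kP0) A0.
by apply/andP; split; lra.
Qed.

(** The bounded sum is the derivative of [tracking_energy], where [v3] stands for the derivative of
    e^T X e, known only through its upper bound. *)
Lemma tracking_energy_rate : exists eps K l cc,
  [/\ 0 < eps, eps <= 1 / 2, eps <= kP / 2, 0 < K & 0 < l /\ 0 < cc /\
  forall t Om0 (Z : 'M[R]_3) (x : 'cV[R]_3) (e : 'cV[R]_(3 + 3)) v3 r, 0 <= t -> `|Om0| <= w ->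
    `|Z| <= r -> `|x| <= r -> `|e| <= r -> r <= 1 ->
    v3 <= - a3 * dotm e e + 2 * dotm (X t *m e)
      (col_mx (skewv (attitude_remainder ke Z x)) (gyroscopic J x)) ->
    kP * dotm Z (attitude_rate ke Om0 Z x)
    + 2 * dotm x (velocity_rate J kP KD Om0 (skewv Z) x e)
    + 2 * eps * (dotm (skewv (attitude_rate ke Om0 Z x)) x
        + dotm (skewv Z) (velocity_rate J kP KD Om0 (skewv Z) x e))
    + K * v3 <= - l * squared_size Z x e + cc * r ^+ 3].
Proof.
have [C2 C20 hC2] := gyroscopic_le.
have [C1 C10 hC1] := @attitude_remainder_le R ke ke0.
have [g g0 hg] := estimate_feedback_le.
pose be := 3 * (3 * (w + `|KD|)) ^+ 2.
have be0 : 0 <= be by rewrite mulr_ge0// sqr_ge0.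
have b0 : 0 <= b by have [h _] := hX 0 (lexx 0); exact: le_trans (normr_ge0 _) h.
(* Per unit of eps the cross term produces - kP |x1|^2 after Young's inequality, at the price of
   [dd] |x2|^2. Taking eps dd <= kd / 2 keeps that price within the damping of KD. *)
pose dd := 2 * be / kP + 2.
have bk0 : 0 <= 2 * be / kP by rewrite divr_ge0 ?(ltW kP0)// mulr_ge0.
have dd0 : 0 < dd by rewrite /dd; lra.
pose eps := Num.min (1 / 2) (Num.min (kP / 2) (kd / (2 * dd))).
have ea : eps <= 1 / 2 by rewrite ge_min lexx.
have eb : eps <= kP / 2 by rewrite !ge_min lexx orbT.
have ec : eps * dd <= kd / 2.
  have : eps <= kd / (2 * dd) by rewrite !ge_min lexx !orbT.
  rewrite -(ler_pM2r dd0) => /le_trans; apply.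
  by rewrite le_eqVlt; apply/orP; left; apply/eqP; field; rewrite gt_eqF.
have e0 : 0 < eps by rewrite !lt_min !divr_gt0//= mulr_gt0.
(* The first two terms pay for the estimation error fed back into the x2 equation and into the cross
   term. The 1 is what remains as decay of |e|^2. *)
pose K := (g / kd + 2 * g / kP + 1) / a3.
have gk0 : 0 <= g / kd by rewrite divr_ge0 ?(ltW kd0).
have gp0 : 0 <= 2 * g / kP by rewrite divr_ge0 ?(ltW kP0)// mulr_ge0.
have K0 : 0 < K by rewrite divr_gt0//; lra.
(* The smallest of the remaining rates for Z + Z^T, x1, x2 and e, with the weights of
   [dotm_sym_skew] taken into account. *)
pose l := Num.min (2 * kP * ke) (Num.min (eps * kP / 2) (Num.min (kd / 2) 1)).
have la : l <= 2 * kP * ke by rewrite ge_min lexx.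
have lb : l <= eps * kP / 2 by rewrite !ge_min lexx orbT.
have lc : l <= kd / 2 by rewrite !ge_min lexx !orbT.
have ld : l <= 1 by rewrite !ge_min lexx !orbT.
have l0 : 0 < l by rewrite !lt_min !divr_gt0 ?mulr_gt0//=.
pose cc := kP * (9 * C1) + 6 * C2 + 2 * eps * (3 * C1 + 3 * C2) + 2 * K * (36 * b * (C1 + C2)) + 1.
have cc0 : 0 < cc.
  have [C1n kPn Kn en] := And4 (ltW C10) (ltW kP0) (ltW K0) (ltW e0).
  have C12 : 0 <= C1 + C2 by rewrite addr_ge0.
  have i1 : 0 <= kP * (9 * C1) by rewrite !mulr_ge0.
  have i2 : 0 <= 2 * eps * (3 * C1 + 3 * C2).
    by have := mulr_ge0 en C1n; have := mulr_ge0 en C20; lra.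
  have i3 : 0 <= 2 * K * (36 * b * (C1 + C2)).
    by have := mulr_ge0 Kn (mulr_ge0 b0 C12); lra.
  by rewrite /cc; lra.
exists eps, K, l, cc; do 2![split=> //]; split=> // t Om0 Z x e v3 r t0 hO hZ hx he r1 hv3.
have r0 : 0 <= r := le_trans (normr_ge0 _) hZ.
set rem := attitude_remainder ke Z x in hv3 *; set q2 := gyroscopic J x in hv3 *.
have hrem : `|rem| <= C1 * r ^+ 2 by exact: hC1.
have hq2 : `|q2| <= C2 * r ^+ 2 by exact: hC2.
have hr1 : `|skewv rem| <= C1 * r ^+ 2 by apply: le_trans (norm_skewv _) _.
have hs : `|skewv Z| <= r by apply: le_trans (norm_skewv _) _.
have dl m n (A B : 'M[R]_(m, n)) (p q : R) : `|A| <= p -> `|B| <= q ->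
    dotm A B <= (m * n)%:R * (p * q).
  by move=> hA hB; apply: le_trans (dotm_le _ _) _; rewrite ler_wpM2l// ler_pM.
have d1 : dotm Z rem <= 9 * C1 * r ^+ 3.
  by apply: le_trans (dl _ _ _ _ _ _ hZ hrem) _; rewrite le_eqVlt; apply/orP; left; apply/eqP; ring.
have d2 : dotm x q2 <= 3 * C2 * r ^+ 3.
  by apply: le_trans (dl _ _ _ _ _ _ hx hq2) _; rewrite le_eqVlt; apply/orP; left; apply/eqP; ring.
have d3 : dotm (skewv rem) x <= 3 * C1 * r ^+ 3.
  by apply: le_trans (dl _ _ _ _ _ _ hr1 hx) _; rewrite le_eqVlt; apply/orP; left; apply/eqP; ring.
have d4 : dotm (skewv Z) q2 <= 3 * C2 * r ^+ 3.
  by apply: le_trans (dl _ _ _ _ _ _ hs hq2) _; rewrite le_eqVlt; apply/orP; left; apply/eqP; ring.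
have d5 : dotm (X t *m e) (col_mx (skewv rem) q2) <= 36 * b * (C1 + C2) * r ^+ 3.
  have hXe : `|X t *m e| <= 6 * (b * r).
    apply: le_trans (norm_mulmx _ _) _; rewrite ler_wpM2l// ler_pM//.
    by have [] := hX e t0.
  have hcol : `|col_mx (skewv rem) q2| <= (C1 + C2) * r ^+ 2.
    have rr := sqr_ge0 r.
    have n1 := mulr_ge0 (ltW C10) rr; have n2 := mulr_ge0 C20 rr.
    apply: norm_mx_le => [|i j]; first by rewrite mulrDl addr_ge0.
    rewrite mxE mulrDl; case: splitP => k _; apply: le_trans (norm_entry _ _ _) _; lra.
  apply: le_trans (dl _ _ _ _ _ _ hXe hcol) _.
  by rewrite le_eqVlt; apply/orP; left; apply/eqP; ring.
rewrite dotm_attitude_rate skewv_attitude_rate -/rem /velocity_rate -/q2.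
set Ge := estimate_feedback _ _ _ _ _.
have hGe : dotm Ge Ge <= g * dotm e e by exact: hg.
rewrite /squared_size (dotm_sym_skew Z).
set x1 := skewv Z in d4 *.
(* The reference rotation and the velocity gain enter the cross term together, so one application of
   Young's inequality handles both. *)
have M1 : - dotm (hat Om0 *m x1) x - dotm x1 (KD *m x) = dotm x1 ((hat Om0 - KD) *m x).
  by rewrite mulmxBl dotmDr dotmNr (dotm_mull (hat Om0)) trmx_hat mulNmx dotmNl.
have hM : dotm ((hat Om0 - KD) *m x) ((hat Om0 - KD) *m x) <= be * dotm x x.
  apply: dotm_mulmx_self_le; apply: le_trans (ler_normB _ _) _; apply: lerD => //.
  exact: le_trans (norm_hat _) hO.
have kP2 : 0 < kP / 2 by rewrite divr_gt0.
have Y1 := dotm_young x1 ((hat Om0 - KD) *m x) kP2.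
have Y2 := dotm_young x1 Ge kP2.
have Y3 := dotm_young x Ge kd0.
have hk := hKD x.
set A := dotm (Z + Z^T) _.
have A0 : 0 <= A by exact: dotm_ge0.
rewrite -M1 in Y1; clearbody rem q2 Ge; rewrite !dotm_linear (dotmC x x1).
set X1 := dotm x1 x1 in Y1 Y2 *.
set X2 := dotm x x in hM Y1 Y3 hk *; set E := dotm e e in hGe hv3 *.
have X10 : 0 <= X1 by exact: dotm_ge0.
have X20 : 0 <= X2 by exact: dotm_ge0.
have E0 : 0 <= E by exact: dotm_ge0.
have ki0 : 0 <= (kP / 2)^-1 by rewrite invr_ge0 ltW.
have Y1' : 2 * (- dotm (hat Om0 *m x1) x - dotm x1 (KD *m x)) <= kP / 2 * X1 + 2 * be / kP * X2.
  have : (kP / 2)^-1 * dotm ((hat Om0 - KD) *m x) ((hat Om0 - KD) *m x) <= (kP / 2)^-1 * (be * X2).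
    by rewrite ler_wpM2l.
  have -> : (kP / 2)^-1 * (be * X2) = 2 * be / kP * X2 by field; rewrite gt_eqF.
  lra.
have Y2' : 2 * dotm x1 Ge <= kP / 2 * X1 + 2 * g / kP * E.
  have : (kP / 2)^-1 * dotm Ge Ge <= (kP / 2)^-1 * (g * E) by rewrite ler_wpM2l.
  have -> : (kP / 2)^-1 * (g * E) = 2 * g / kP * E by field; rewrite gt_eqF.
  lra.
have Y3' : 2 * dotm x Ge <= kd * X2 + g / kd * E.
  have : kd^-1 * dotm Ge Ge <= kd^-1 * (g * E) by rewrite ler_wpM2l// invr_ge0 ltW.
  have -> : kd^-1 * (g * E) = g / kd * E by field; rewrite gt_eqF.
  lra.
have Y12 := ler_wpM2l (ltW e0) (lerD Y1' Y2').
have V3 := ler_wpM2l (ltW K0) hv3.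
have Ka : K * (a3 * E) = (g / kd + 2 * g / kP + 1) * E by rewrite /K; field; rewrite !gt_eqF.
have f1 := ler_wpM2l (ltW kP0) d1.
have f3 := ler_wpM2l (ltW e0) (lerD d3 d4).
have f5 := ler_wpM2l (ltW K0) d5.
have r3 : 0 <= r ^+ 3 by exact: exprn_ge0.
have ccE : cc * r ^+ 3 = kP * (9 * C1 * r ^+ 3) + 6 * C2 * r ^+ 3
   + 2 * (eps * (3 * C1 * r ^+ 3 + 3 * C2 * r ^+ 3))
   + 2 * (K * (36 * b * (C1 + C2) * r ^+ 3)) + r ^+ 3.
  by rewrite /cc; ring.
have g1 : eps * dd * X2 <= kd / 2 * X2 by rewrite ler_wpM2r.
have ddE : eps * dd * X2 = eps * (2 * be / kP * X2) + 2 * (eps * X2) by rewrite /dd; ring.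
have g2 : eps * (2 * g / kP * E) <= 1 / 2 * (2 * g / kP * E) by rewrite ler_wpM2r// mulr_ge0.
have g20 : 0 <= 2 * g / kP * E by rewrite mulr_ge0.
have t1 : l * A <= 2 * kP * ke * A by rewrite ler_wpM2r.
have t2 : l * X1 <= eps * kP / 2 * X1 by rewrite ler_wpM2r.
have t3 : l * X2 <= kd / 2 * X2 by rewrite ler_wpM2r.
have t4 : l * E <= 1 * E by rewrite ler_wpM2r.
rewrite ccE.
clear - V3 Ka f1 f3 f5 r3 g1 ddE g2 g20 t1 t2 t3 t4 Y12 Y3' hk d2.
lra.
Qed.

End TrackingLyapunov.

(** * Locally Lipschitz fields and clamping *)

Section TameFields.
Context {R : realType} {m n : nat} {B : R}.
Local Notation hdw := has_derivative_within.
Local Notation state := 'M[R]_(m, n).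

(** What Picard needs once the state is confined to the ball of radius B, uniformly in time.
    Boundedness is included to make the property stable under products, so that it can be assembled
    along the expression of a field. *)
Definition tame p q (G : R -> state -> 'M[R]_(p, q)) : Prop :=
  (exists M, forall t y y', `|y| <= B -> `|y'| <= B ->
     `|G t y| <= M /\ `|G t y - G t y'| <= M * `|y - y'|) /\
  forall y, continuous (G ^~ y).

Lemma tame_state : tame (fun _ y => y).
Proof.
split=> [|y t]; last exact: cvg_cst.
exists (`|B| + 1) => t y y' hy _; split.
  by apply: le_trans hy _; apply: le_trans (ler_norm _) _; rewrite lerDl.
by rewrite ler_peMl// lerDr.
Qed.

Lemma tame_time p q (A : R -> 'M[R]_(p, q)) M :
  (forall t, `|A t| <= M) -> continuous A -> tame (fun t _ => A t).
Proof.
move=> hM cA; split=> [|y t]; last exact: cA.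
exists M => t y y' _ _; split=> //; rewrite subrr normr0 mulr_ge0//.
exact: le_trans (hM t).
Qed.

Lemma tameD p q (G H : R -> state -> 'M[R]_(p, q)) :
  tame G -> tame H -> tame (fun t y => G t y + H t y).
Proof.
move=> [[M hM] cG] [[N hN] cH]; split=> [|y t]; last exact: (cvgD (@cG y t) (@cH y t)).
exists (M + N) => t y y' hy hy'.
have [h1 h2] := hM t y y' hy hy'; have [h3 h4] := hN t y y' hy hy'; split.
  by apply: le_trans (ler_normD _ _) _; apply: lerD.
rewrite opprD addrACA mulrDl; apply: le_trans (ler_normD _ _) _; exact: lerD.
Qed.

Lemma tame_additive p q p' q' (L : 'M[R]_(p, q) -> 'M[R]_(p', q')) c
    (G : R -> state -> 'M[R]_(p, q)) :
  (forall u v, L (u - v) = L u - L v) -> (forall v, `|L v| <= c * `|v|) ->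
  tame G -> tame (fun t y => L (G t y)).
Proof.
move=> LB hL [[M hM] cG]; pose c' := Num.max 0 c.
have c0 : 0 <= c' by rewrite le_max lexx.
have hL' v : `|L v| <= c' * `|v|.
  by apply: le_trans (hL v) _; rewrite ler_wpM2r// le_max lexx orbT.
split=> [|y t].
  exists (c' * M) => t y y' hy hy'; have [h1 h2] := hM t y y' hy hy'; split.
    by apply: le_trans (hL' _) _; rewrite ler_wpM2l.
  by rewrite -LB; apply: le_trans (hL' _) _; rewrite -mulrA ler_wpM2l.
apply/cvgrPdist_lt => e e0; have c1 : 0 < c' + 1 by lra.
have := @cG y t; move/cvgrPdist_lt/(_ _ (divr_gt0 e0 c1)).
apply: filterS => s hs; rewrite -LB; apply: le_lt_trans (hL' _) _.
rewrite ltr_pdivlMr// in hs; apply: le_lt_trans hs.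
by rewrite mulrC ler_wpM2l// lerDl.
Qed.

Lemma tameN p q (G : R -> state -> 'M[R]_(p, q)) :
  tame G -> tame (fun t y => - G t y).
Proof.
apply: (@tame_additive _ _ _ _ _ 1) => [u v|v]; first by rewrite opprD.
by rewrite normrN mul1r.
Qed.

Lemma tameB p q (G H : R -> state -> 'M[R]_(p, q)) :
  tame G -> tame H -> tame (fun t y => G t y - H t y).
Proof. by move=> hG hH; apply: tameD => //; exact: tameN. Qed.

Lemma tameZ p q a (G : R -> state -> 'M[R]_(p, q)) :
  tame G -> tame (fun t y => a *: G t y).
Proof.
apply: (@tame_additive _ _ _ _ _ `|a|) => [u v|v]; first by rewrite scalerBr.
by rewrite normrZ.
Qed.

Lemma tame_trmx p q (G : R -> state -> 'M[R]_(p, q)) :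
  tame G -> tame (fun t y => (G t y)^T).
Proof.
apply: (@tame_additive _ _ _ _ _ 1) => [u v|v]; first by rewrite trmxD trmxN.
by rewrite norm_trmx mul1r.
Qed.

Lemma tame_mulmx p q k (G : R -> state -> 'M[R]_(p, q)) (H : R -> state -> 'M[R]_(q, k)) :
  tame G -> tame H -> tame (fun t y => G t y *m H t y).
Proof.
move=> [[M hM] cG] [[N hN] cH]; split=> [|y t]; last first.
  by apply: cvg_mulmx; [exact: cG | exact: cH].
exists (q%:R * (2 * (M * N))) => t y y' hy hy'.
have [h1 h2] := hM t y y' hy hy'; have [h3 h4] := hN t y y' hy hy'.
have [h1' _] := hM t y' y hy' hy.
have M0 : 0 <= M by exact: le_trans h1.
have N0 : 0 <= N by exact: le_trans h3.
have MN0 := mulr_ge0 M0 N0.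
split.
  apply: le_trans (norm_mulmx _ _) _; rewrite ler_wpM2l//.
  apply: (@le_trans _ _ (M * N)); [exact: ler_pM | lra].
have -> : G t y *m H t y - G t y' *m H t y' =
    (G t y - G t y') *m H t y + G t y' *m (H t y - H t y').
  by rewrite mulmxBl mulmxBr addrA subrK.
apply: le_trans (ler_normD _ _) _.
have g1 : `|(G t y - G t y') *m H t y| <= q%:R * ((M * `|y - y'|) * N).
  by apply: le_trans (norm_mulmx _ _) _; rewrite ler_wpM2l// ler_pM.
have g2 : `|G t y' *m (H t y - H t y')| <= q%:R * (M * (N * `|y - y'|)).
  by apply: le_trans (norm_mulmx _ _) _; rewrite ler_wpM2l// ler_pM.
apply: le_trans (lerD g1 g2) _.
by rewrite le_eqVlt; apply/orP; left; apply/eqP; ring.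
Qed.

Lemma tame_col_mx p q k (G : R -> state -> 'M[R]_(p, k)) (H : R -> state -> 'M[R]_(q, k)) :
  tame G -> tame H -> tame (fun t y => col_mx (G t y) (H t y)).
Proof.
move=> hG hH.
have -> : (fun t y => col_mx (G t y) (H t y)) =
    (fun t y => col_mx 1%:M 0 *m G t y + col_mx 0 1%:M *m H t y).
  apply/funext => t; apply/funext => y.
  by rewrite !mul_col_mx !mul1mx !mul0mx add_col_mx addr0 add0r.
apply: tameD; apply: tame_mulmx => //.
  apply: (@tame_time _ _ (fun=> _) `|col_mx 1%:M 0 : 'M[R]_(p + q, p)|) => // t.
  exact: cvg_cst.
apply: (@tame_time _ _ (fun=> _) `|col_mx 0 1%:M : 'M[R]_(p + q, q)|) => // t.
exact: cvg_cst.
Qed.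

Lemma tame_row_mx p q k (G : R -> state -> 'M[R]_(p, q)) (H : R -> state -> 'M[R]_(p, k)) :
  tame G -> tame H -> tame (fun t y => row_mx (G t y) (H t y)).
Proof.
move=> hG hH.
have -> : (fun t y => row_mx (G t y) (H t y)) =
    (fun t y => (col_mx (G t y)^T (H t y)^T)^T).
  by apply/funext => t; apply/funext => y; rewrite tr_col_mx !trmxK.
by apply: tame_trmx; apply: tame_col_mx; apply: tame_trmx.
Qed.

Lemma tame_cst p q (A : 'M[R]_(p, q)) : tame (fun _ _ => A).
Proof. by apply: (@tame_time _ _ (fun=> A) `|A|) => // t; exact: cvg_cst. Qed.

Hypothesis B0 : 0 <= B.

(** Applied entrywise, this retracts onto the ball of radius B of the entrywise norm without
    increasing distances. *)
Definition clamp (a : R) := Num.max (- B) (Num.min B a).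

Lemma clamp_norm a : `|clamp a| <= B.
Proof.
by have := B0; rewrite ler_norml /clamp le_max lexx /= ge_max ge_min lexx andbT; lra.
Qed.

Lemma clamp_id a : `|a| <= B -> clamp a = a.
Proof. by rewrite ler_norml => /andP[h1 h2]; rewrite /clamp (min_idPr h2) (max_idPr h1). Qed.

Lemma clamp_lipschitz a a' : `|clamp a - clamp a'| <= `|a - a'|.
Proof.
have h := B0.
have cases x : [\/ clamp x = B /\ B <= x, clamp x = - B /\ x <= - B
    | clamp x = x /\ - B <= x <= B].
  rewrite /clamp; case: (leP B x) => h1.
    by constructor 1; split => //; apply/max_idPr; lra.
  case: (leP (- B) x) => h2; [constructor 3 | constructor 2]; split=> //.
    by rewrite (ltW h1).
  exact: ltW.
have [[-> h1]|[-> h1]|[-> /andP[h1 h1']]] := cases a;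
have [[-> h2]|[-> h2]|[-> /andP[h2 h2']]] := cases a';
  rewrite ler_norml; apply/andP; split; have := ler_norm (a - a');
  have := ler_norm (- (a - a')); rewrite normrN; lra.
Qed.

Lemma tame_picard (G : R -> state -> state) t0 y0 : tame G ->
  exists2 y : R -> state, y t0 = y0 &
    forall t, t0 <= t -> hdw setT y t (G t (map_mx clamp (y t))).
Proof.
move=> [[M hM] cG].
have tr y : `|map_mx clamp y : state| <= B.
  by apply: norm_mx_le => // i j; rewrite mxE clamp_norm.
have M0 : 0 <= M by have [h _] := hM 0 _ _ (tr 0) (tr 0); exact: le_trans h.
apply: (@picard R m n (fun t y => G t (map_mx clamp y)) (M + 1) M).
- by lra.
- move=> t y y'; have [_ h] := hM t _ _ (tr y) (tr y').
  apply: le_trans h _; apply: ler_pM => //; first by rewrite lerDl.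
  by apply: norm_mx_le => // i j; rewrite !mxE; apply: le_trans (clamp_lipschitz _ _) _;
    have := norm_entry (y - y') i j; rewrite !mxE.
- by move=> y; exact: cG.
- by move=> t; have [] := hM t _ _ (tr y0) (tr y0).
Qed.

End TameFields.

(** * Exponential decay inside the sublevel set *)

Section TrackingErrorDecay.
Context {R : realType}.
Local Notation hdw := has_derivative_within.
Variables (J : 'M[R]_3) (ke kP w gamma1 gamma2 gamma3 gamma4 : R) (KD : 'M[R]_3).
Variables (R0 : R -> 'M[R]_3) (Om0 u0 : R -> 'cV[R]_3).
Variables (P Q : R -> 'M[R]_(3 + 3)) (Rt : R -> 'M[R]_3).
Hypothesis pJ : sym_posdef J.
Hypothesis ke0 : 0 < ke.
Hypothesis hSO : forall t, 0 <= t -> SO3 (R0 t).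
Hypothesis hO : forall t, 0 <= t -> `|Om0 t| <= w.
Hypothesis hR0 : solves_on `[0, +oo[ R0 (fun t => rigid_body_R (R0 t) (Om0 t)).
Hypothesis hO0 : solves_on `[0, +oo[ Om0 (fun t => rigid_body_Om J (Om0 t) (u0 t)).
Hypothesis gamma1_gt0 : 0 < gamma1.
Hypothesis gamma2_gt0 : 0 < gamma2.
Hypothesis gamma3_gt0 : 0 < gamma3.
Hypothesis gamma4_gt0 : 0 < gamma4.
Hypothesis cRt : forward_continuous Rt.
Hypothesis symQ : forall t, 0 <= t -> (Q t)^T = Q t.
Hypothesis symR : forall t, 0 <= t -> (Rt t)^T = Rt t.
Hypothesis hQ : forall t, 0 <= t -> loewner_le gamma1%:M (Q t) /\ loewner_le (Q t) gamma2%:M.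
Hypothesis hR : forall t, 0 <= t -> loewner_le gamma3%:M (Rt t) /\ loewner_le (Rt t) gamma4%:M.
Hypothesis P0sym : (P 0)^T = P 0.
Hypothesis P0ge0 : loewner_le 0 (P 0).
Hypothesis hP : solves_on `[0, +oo[ P (fun t => riccati J (Om0 t) (Q t) (Rt t) (P t)).
Hypothesis kP0 : 0 < kP.
Hypothesis pKD : sym_posdef KD.

Definition attitude_error (Rot : R -> 'M[R]_3) s := (R0 s)^T *m (Rot s - R0 s).
Definition observer_error (Rot : R -> 'M[R]_3) (Om : R -> 'cV[R]_3)
    (z : R -> 'cV[R]_(3 + 3)) s :=
  col_mx (Zk_vee (R0 s) (Rot s)) (Om s - Om0 s) - z s.

Definition closed_loop_at (Rot : R -> 'M[R]_3) (Om : R -> 'cV[R]_3)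
    (z : R -> 'cV[R]_(3 + 3)) s dR dO dz : Prop :=
  let u := controller J kP KD (Om0 s) (u0 s) (z s) in
  [/\ dR = extended_R ke (Rot s) (Om s), dO = rigid_body_Om J (Om s) u &
      dz = observer J (Om0 s) (P s) (Rt s) (z s) (u - u0 s) (Zk_vee (R0 s) (Rot s))].

(* The closed loop is only required where [U < rho], so that the estimate also
   applies to truncations of the field. *)
Lemma error_decay : exists (U : R -> 'M[R]_3 -> 'cV[R]_3 -> 'cV[R]_(3 + 3) -> R)
    (rho m1 m2 la : R),
  [/\ 0 < rho, 0 < m1, 0 < m2, 0 < la &
    (forall t Z x e, 0 <= t -> m1 * squared_size Z x e <= U t Z x e <= m2 * squared_size Z x e) /\
    rho <= m1 /\
    forall a c Rot Om z, 0 <= a -> a <= c ->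
      let V s := U s (attitude_error Rot s) (Om s - Om0 s) (observer_error Rot Om z s) in
      (forall s, a <= s <= c -> exists dR dO dz, [/\ hdw `[a, c] Rot s dR,
         hdw `[a, c] Om s dO, hdw `[a, c] z s dz &
         V s < rho -> closed_loop_at Rot Om z s dR dO dz]) ->
      V a < rho -> V c <= V a * expR (- la * (c - a))].
Proof.
have uJ := sym_posdef_unitmx pJ.
have w0 : 0 <= w := le_trans (normr_ge0 _) (hO (lexx 0)).
have [kd kd0 hKD] := sym_posdef_coercive pKD.
have cO := hdw_forward_continuous hO0.
have [X [c1 [c2 [b [a3 [c10 c20 a30 [hX hXr]]]]]]] :=
  estimator_lyapunov hO cO cRt gamma1_gt0 gamma2_gt0 gamma3_gt0 gamma4_gt0 symQ symR hQ hR
    P0sym P0ge0 hP.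
have [eps [K [l [cc [eps0 eps1 eps2 K0 [l0 [cc0 hrate]]]]]]] :=
  tracking_energy_rate J ke0 kP0 kd0 w0 hKD a30 hX.
have [m1 [m2 [m10 m20 hm]]] := tracking_energy_bounds kP0 c10 c20 hX (ltW eps0) eps1 eps2 K0.
(* For norms at most q the cubic term cc r^3 is at most half of the decay l r^2. The level m1 q^2
   confines the norms to q, and the division of l / 2 by m2 turns decay of the squared size into
   decay of the energy. *)
pose q := Num.min 1 (l / (2 * cc)).
have q0 : 0 < q by rewrite lt_min ltr01 divr_gt0// mulr_gt0.
have q1 : q <= 1 by rewrite ge_min lexx.
have qc : cc * q <= l / 2.
  have : q <= l / (2 * cc) by rewrite ge_min lexx orbT.
  rewrite -(ler_pM2l cc0) => /le_trans; apply.
  by rewrite le_eqVlt; apply/orP; left; apply/eqP; field; rewrite gt_eqF.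
exists (tracking_energy kP X eps K), (m1 * q ^+ 2), m1, m2, (l / 2 / m2).
split; rewrite ?mulr_gt0 ?exprn_gt0 ?invr_gt0//; split=> //; split.
  by rewrite ler_piMr ?(ltW m10)// exprn_ile1// ltW.
move=> a c Rot Om z a0 ac V hV Va.
have sge s : a <= s <= c -> 0 <= s by move=> /andP[as_ _]; exact: le_trans as_.
have sub : (`[a, c]%classic : set R) `<=` `[0, +oo[%classic.
  by move=> s /=; rewrite !in_itv /= => /sge ->.
apply: (decay_of_local_decay (rho := m1 * q ^+ 2)) => //.
- by rewrite !divr_ge0// ltW.
- move=> s /sge s0; have /andP[h _] := hm s (attitude_error Rot s) (Om s - Om0 s)
    (observer_error Rot Om z s) s0.
  apply: le_trans h; rewrite mulr_ge0 ?(ltW m10)//.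
  by rewrite !addr_ge0 ?dotm_ge0.
move=> s sac; have s0 := sge s sac.
have s0' : (`[0, +oo[%classic : set R) s by rewrite /= in_itv /= s0.
have Ds : (`[a, c]%classic : set R) s by rewrite /= in_itv.
have hPs := hdw_subset sub (hP s0'); have hRs := hdw_subset sub (hR0 s0').
have hOs := hdw_subset sub (hO0 s0').
have D0 r : (`[a, c]%classic : set R) r -> 0 <= r by rewrite /= in_itv /= => /sge.
set A' := obsA J (Om0 s) - P s *m (@obsC R)^T *m invmx (Rt s) *m @obsC R.
(* Differentiability of V, whatever the rates are; only the estimation error must appear in the form
   A' e + h. *)
have energy dZ dx h : hdw `[a, c] (attitude_error Rot) s dZ ->
    hdw `[a, c] (fun r => Om r - Om0 r) s dx ->
    hdw `[a, c] (observer_error Rot Om z) s (A' *m observer_error Rot Om z s + h) ->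
    exists v3, v3 <= - a3 * dotm (observer_error Rot Om z s) (observer_error Rot Om z s)
        + 2 * dotm (X s *m observer_error Rot Om z s) h /\
      hdw `[a, c] V s (kP * dotm (attitude_error Rot s) dZ + 2 * dotm (Om s - Om0 s) dx
        + 2 * eps * (dotm (skewv dZ) (Om s - Om0 s) + dotm (skewv (attitude_error Rot s)) dx)
        + K * v3).
  move=> hZ hx he; have [v3 hv3 v3le] := hXr _ _ _ _ D0 Ds hPs he.
  exists v3; split=> //.
  have := hdwD (hdwD (hdwD (hdwMl (a := kP / 2) (hdw_dotm hZ hZ)) (hdw_dotm hx hx))
    (hdwMl (a := 2 * eps) (hdw_dotm (hdw_skewv hZ) hx))) (hdwMl (a := K) hv3).
  rewrite (dotmC dZ) (dotmC dx).
  suff -> : kP / 2 * (dotm (attitude_error Rot s) dZ + dotm (attitude_error Rot s) dZ) +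
     (dotm (Om s - Om0 s) dx + dotm (Om s - Om0 s) dx) =
     kP * dotm (attitude_error Rot s) dZ + 2 * dotm (Om s - Om0 s) dx by [].
  by field.
have [dR [dO [dz [hdR hdO hdz hcl]]]] := hV s sac.
have [Vs|Vs] := boolP (V s < m1 * q ^+ 2).
  have [ER EO Ez] := hcl Vs; rewrite ER in hdR; rewrite EO in hdO; rewrite Ez in hdz.
  have [hZ hx he] := closed_loop_rates uJ (hSO s0) hRs hOs hdR hdO hdz.
  have [v3 [v3le hv]] := energy _ _ _ hZ hx he.
  eexists; first exact: hv.
  move=> _; set Z := attitude_error Rot s in v3le *; set x := Om s - Om0 s in v3le *.
  set e := observer_error Rot Om z s in v3le *.
  have /andP[Vm1 Vm2] := hm s Z x e s0; rewrite -[tracking_energy _ _ _ _ _ _ _ _]/(V s) in Vm1 Vm2.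
  set N := squared_size Z x e in Vm1 Vm2 *.
  have [nZ nx ne] : [/\ `|Z| ^+ 2 <= N, `|x| ^+ 2 <= N & `|e| ^+ 2 <= N].
    exact: norm_sqr_le_squared_size.
  pose r := Num.max `|Z| (Num.max `|x| `|e|).
  have [rZ rx re] : [/\ `|Z| <= r, `|x| <= r & `|e| <= r].
    by rewrite /r !le_max !lexx !orbT.
  have rN : r ^+ 2 <= N by rewrite /r; case: (leP `|Z|) => _ //; case: (leP `|x|).
  have r0 : 0 <= r := le_trans (normr_ge0 _) rZ.
  have Nq : N < q ^+ 2 by rewrite -(ltr_pM2l m10); exact: le_lt_trans Vm1 Vs.
  have rq : r <= q.
    rewrite -(@ler_pXn2r _ 2) ?nnegrE ?(ltW q0)//; exact: le_trans (ltW Nq).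
  have := hrate s (Om0 s) Z x e v3 r s0 (hO s0) rZ rx re (le_trans rq q1) v3le.
  move=> /le_trans; apply.
  have N0 : 0 <= N by apply: le_trans rN; exact: sqr_ge0.
  have h1 : cc * r ^+ 3 <= l / 2 * N.
    have -> : cc * r ^+ 3 = cc * r * r ^+ 2 by ring.
    apply: ler_pM => //; [by rewrite mulr_ge0// ltW | exact: sqr_ge0|].
    by apply: le_trans qc; rewrite ler_pM2l.
  have h2 : l / 2 / m2 * V s <= l / 2 * N.
    by rewrite -mulrA ler_wpM2l ?divr_ge0 ?(ltW l0)// ler_pdivrMl.
  by rewrite -/N; lra.
(* Outside the sublevel set only the existence of a derivative is asked for, so h is simply the
   difference between the rate of e and A' e. *)
have hZ := hdw_mulmx (hdw_trmx hRs) (hdwB hdR hRs).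
have hx := hdwB hdO hOs.
have he := hdwB (hdw_col_mx (hdw_skewv hZ) hx) hdz.
set de := (X in hdw _ _ _ X) in he.
have he' : hdw `[a, c] (observer_error Rot Om z) s
   (A' *m observer_error Rot Om z s + (de - A' *m observer_error Rot Om z s)).
  by rewrite addrC subrK; exact: he.
have [v3 [_ hv]] := energy _ _ _ hZ hx he'.
by eexists; first exact: hv.
Qed.

End TrackingErrorDecay.

(** * Solutions of the truncated closed loop *)

Section TruncatedClosedLoop.
Context {R : realType}.
Local Notation hdw := has_derivative_within.
Local Notation state := 'M[R]_(3, 3 + (1 + (1 + 1))).
Variables (J : 'M[R]_3) (ke kP : R) (KD : 'M[R]_3).
Variables (R0 : R -> 'M[R]_3) (Om0 u0 : R -> 'cV[R]_3).
Variables (P : R -> 'M[R]_(3 + 3)) (Rt : R -> 'M[R]_3).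
Variables (r w p ri : R).
Hypothesis hR : forall t, 0 <= t -> `|R0 t| <= r.
Hypothesis hO : forall t, 0 <= t -> `|Om0 t| <= w.
Hypothesis nP : forall t, 0 <= t -> `|P t| <= p.
Hypothesis nRi : forall t, 0 <= t -> `|invmx (Rt t)| <= ri.
Hypothesis cP : forward_continuous P.
Hypothesis cRi : forward_continuous (fun t => invmx (Rt t)).
Hypothesis hR0 : solves_on `[0, +oo[ R0 (fun t => rigid_body_R (R0 t) (Om0 t)).
Hypothesis hO0 : solves_on `[0, +oo[ Om0 (fun t => rigid_body_Om J (Om0 t) (u0 t)).

(** The input deviation does not involve u0. A field written in deviations is therefore continuous
    in time even where u0 is not. *)
Lemma controllerB (Om u : 'cV[R]_3) z :
  controller J kP KD Om u z - u = controller J kP KD Om 0 z.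
Proof.
have E (a b c : 'cV[R]_3) : u - a - b - c - u = 0 - a - b - c.
  by apply/matrixP => i j; rewrite !mxE; ring.
exact: E.
Qed.

(** The whole state is packed into one matrix with three rows, since [picard] is stated for
    matrices: three columns for the attitude, one for the velocity, two for the observer. *)
Definition state_R (y : state) : 'M[R]_3 := lsubmx y.
Definition state_Om (y : state) : 'cV[R]_3 := lsubmx (rsubmx y).
Definition state_z (y : state) : 'cV[R]_(3 + 3) :=
  col_mx (lsubmx (rsubmx (rsubmx y))) (rsubmx (rsubmx (rsubmx y))).
Definition make_state (A : 'M[R]_3) (x : 'cV[R]_3) (z : 'cV[R]_(3 + 3)) : state :=
  row_mx A (row_mx x (row_mx (usubmx z) (dsubmx z))).

Lemma make_stateK A x z : [/\ state_R (make_state A x z) = A,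
  state_Om (make_state A x z) = x & state_z (make_state A x z) = z].
Proof.
by rewrite /state_R /state_Om /state_z /make_state !(row_mxKl, row_mxKr) vsubmxK.
Qed.

Lemma norm_state B y : `|state_R y| <= B -> `|state_Om y| <= B -> `|state_z y| <= B ->
  `|y| <= B.
Proof.
move=> hA hx hz; rewrite -(hsubmxK y) -(hsubmxK (rsubmx y)) -(hsubmxK (rsubmx (rsubmx y))).
apply: norm_mx_le => [|i j]; first exact: le_trans hA.
rewrite mxE; case: splitP => k _; first exact: le_trans (norm_entry _ _ _) hA.
rewrite mxE; case: splitP => {}k _; first exact: le_trans (norm_entry _ _ _) hx.
rewrite mxE; case: splitP => {}k _.
  have := norm_entry (state_z y) (lshift 3 i) k; rewrite /state_z col_mxEu => h.
  exact: le_trans h hz.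
have := norm_entry (state_z y) (rshift 3 i) k; rewrite /state_z col_mxEd => h.
exact: le_trans h hz.
Qed.

(** Attitude and velocity are deviations from the reference, whereas z is the observer state itself.
    Negative times are sent to 0, before which nothing is known about the reference. *)
Definition closed_loop_field t (y : state) : state :=
  let s := Num.max 0 t in
  let du := controller J kP KD (Om0 s) 0 (state_z y) in
  make_state
    (extended_R ke (R0 s + state_R y) (Om0 s + state_Om y) - rigid_body_R (R0 s) (Om0 s))
    (coupling J (Om0 s) *m state_Om y + invmx J *m du + gyroscopic J (state_Om y))
    (observer J (Om0 s) (P s) (Rt s) (state_z y) du (Zk_vee (R0 s) (R0 s + state_R y))).

Section Tame.
Variable B : R.
Local Notation tame := (@tame R 3 (3 + (1 + (1 + 1))) B _ _).

Lemma max0_ge (t : R) : 0 <= Num.max 0 t. Proof. by rewrite le_max lexx. Qed.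

Lemma tame_lsubmx a b c (G : R -> state -> 'M[R]_(a, b + c)) :
  tame G -> tame (fun t y => lsubmx (G t y)).
Proof.
apply: (@tame_additive _ _ _ _ _ _ _ _ _ 1) => [u v|v].
  by apply/matrixP => i j; rewrite !mxE.
by rewrite mul1r; apply: norm_mx_le => // i j; rewrite mxE norm_entry.
Qed.

Lemma tame_rsubmx a b c (G : R -> state -> 'M[R]_(a, b + c)) :
  tame G -> tame (fun t y => rsubmx (G t y)).
Proof.
apply: (@tame_additive _ _ _ _ _ _ _ _ _ 1) => [u v|v].
  by apply/matrixP => i j; rewrite !mxE.
by rewrite mul1r; apply: norm_mx_le => // i j; rewrite mxE norm_entry.
Qed.

Lemma tame_usubmx a b c (G : R -> state -> 'M[R]_(a + b, c)) :
  tame G -> tame (fun t y => usubmx (G t y)).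
Proof.
apply: (@tame_additive _ _ _ _ _ _ _ _ _ 1) => [u v|v].
  by apply/matrixP => i j; rewrite !mxE.
by rewrite mul1r; apply: norm_mx_le => // i j; rewrite mxE norm_entry.
Qed.

Lemma tame_dsubmx a b c (G : R -> state -> 'M[R]_(a + b, c)) :
  tame G -> tame (fun t y => dsubmx (G t y)).
Proof.
apply: (@tame_additive _ _ _ _ _ _ _ _ _ 1) => [u v|v].
  by apply/matrixP => i j; rewrite !mxE.
by rewrite mul1r; apply: norm_mx_le => // i j; rewrite mxE norm_entry.
Qed.

Lemma tame_hat (G : R -> state -> 'cV[R]_3) : tame G -> tame (fun t y => hat (G t y)).
Proof.
apply: (@tame_additive _ _ _ _ _ _ _ _ _ 1) => [u v|v]; first exact: hatB.
by rewrite mul1r norm_hat.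
Qed.

Lemma tame_skewv (G : R -> state -> 'M[R]_3) : tame G -> tame (fun t y => skewv (G t y)).
Proof.
apply: (@tame_additive _ _ _ _ _ _ _ _ _ 1) => [u v|v]; last by rewrite mul1r norm_skewv.
by rewrite skewvD skewvN.
Qed.

Lemma tame_cross (G H : R -> state -> 'cV[R]_3) :
  tame G -> tame H -> tame (fun t y => cross (G t y) (H t y)).
Proof.
move=> hG hH; have -> : (fun t y => cross (G t y) (H t y)) = (fun t y => hat (G t y) *m H t y).
  by apply/funext => t; apply/funext => y; rewrite hat_mulE.
by apply: tame_mulmx => //; exact: tame_hat.
Qed.

Lemma closed_loop_field_tame : tame closed_loop_field.
Proof.
have tR0 : tame (fun t _ => R0 (Num.max 0 t)).
  by apply: (@tame_time _ _ _ _ _ _ _ r) => [t|];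
    [exact/hR/max0_ge | exact: hdw_forward_continuous hR0].
have tO : tame (fun t _ => Om0 (Num.max 0 t)).
  by apply: (@tame_time _ _ _ _ _ _ _ w) => [t|];
    [exact/hO/max0_ge | exact: hdw_forward_continuous hO0].
have tP : tame (fun t _ => P (Num.max 0 t)).
  by apply: (@tame_time _ _ _ _ _ _ _ p) => [t|//]; exact/nP/max0_ge.
have tRi : tame (fun t _ => invmx (Rt (Num.max 0 t))).
  by apply: (@tame_time _ _ _ _ _ _ _ ri) => [t|//]; exact/nRi/max0_ge.
have tC q k (A : 'M[R]_(q, k)) : tame (fun _ _ => A) by exact: tame_cst.
have tI := @tame_state R 3 (3 + (1 + (1 + 1))) B.
have tSR : tame (fun _ y => state_R y) := tame_lsubmx tI.
have tSO : tame (fun _ y => state_Om y) := tame_lsubmx (tame_rsubmx tI).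
have tSz : tame (fun _ y => state_z y).
  have t0 := tame_rsubmx (tame_rsubmx tI).
  exact: (tame_col_mx (tame_lsubmx t0) (tame_rsubmx t0)).
have tJO := tame_mulmx (tC _ _ J) tO.
have tcoup : tame (fun t _ => coupling J (Om0 (Num.max 0 t))) :=
  tame_mulmx (tC _ _ (invmx J)) (tameB (tame_hat tJO) (tame_mulmx (tame_hat tO) (tC _ _ J))).
have tz2 := tame_dsubmx tSz.
have tdu : tame (fun t y => controller J kP KD (Om0 (Num.max 0 t)) 0 (state_z y)) :=
  tameB (tameB (tameB (tC _ _ 0) (tame_cross (tame_mulmx (tC _ _ J) tz2) tO))
      (tame_cross tJO tz2))
    (tame_mulmx (tC _ _ J) (tameD (tameZ kP (tame_usubmx tSz)) (tame_mulmx (tC _ _ KD) tz2))).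
have tRot := tameD tR0 tSR.
(* The block matrix is regrouped as a row of columns, the shapes covered by the closure lemmas. *)
have tA : tame (fun t _ => obsA J (Om0 (Num.max 0 t))).
  have -> : (fun t (_ : state) => obsA J (Om0 (Num.max 0 t))) = (fun t _ =>
     row_mx (col_mx (- hat (Om0 (Num.max 0 t))) 0) (col_mx 1%:M (coupling J (Om0 (Num.max 0 t))))).
    by apply/funext => t; apply/funext => y; rewrite obsAE block_mxEh.
  exact: (tame_row_mx (tame_col_mx (tameN (tame_hat tO)) (tC _ _ 0))
    (tame_col_mx (tC _ _ 1%:M) tcoup)).
have tZ : tame (fun t y => Zk_vee (R0 (Num.max 0 t)) (R0 (Num.max 0 t) + state_R y)) :=
  tame_skewv (tame_mulmx (tame_trmx tR0) (tameB tRot tR0)).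
have tobs : tame (fun t y => observer J (Om0 (Num.max 0 t)) (P (Num.max 0 t))
    (Rt (Num.max 0 t)) (state_z y) (controller J kP KD (Om0 (Num.max 0 t)) 0 (state_z y))
    (Zk_vee (R0 (Num.max 0 t)) (R0 (Num.max 0 t) + state_R y))) :=
  tameB (tameD (tame_mulmx tA tSz) (tame_mulmx (tC _ _ (obsB J)) tdu))
    (tame_mulmx (tame_mulmx (tame_mulmx tP (tC _ _ (@obsC R)^T)) tRi)
      (tameB (tame_mulmx (tC _ _ (@obsC R)) tSz) tZ)).
have tFR := tameB (tameB (tame_mulmx tRot (tame_hat (tameD tO tSO)))
    (tameZ ke (tame_mulmx tRot (tameB (tame_mulmx (tame_trmx tRot) tRot) (tC _ _ 1%:M)))))
  (tame_mulmx tR0 (tame_hat tO)).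
have tFO := tameD (tameD (tame_mulmx tcoup tSO) (tame_mulmx (tC _ _ (invmx J)) tdu))
  (tame_mulmx (tC _ _ (invmx J)) (tame_cross (tame_mulmx (tC _ _ J) tSO) tSO)).
exact: (tame_row_mx tFR (tame_row_mx tFO (tame_row_mx (tame_usubmx tobs) (tame_dsubmx tobs)))).
Qed.
End Tame.

Lemma hdw_lsubmx {m n k} {D : set R} {x : R -> 'M[R]_(m, n + k)} {t v} :
  hdw D x t v -> hdw D (fun s => lsubmx (x s)) t (lsubmx v).
Proof.
move=> hx; apply: hdw_mx => i j; rewrite mxE; under eq_fun do rewrite mxE.
exact: (hdw_entry hx).
Qed.

Lemma hdw_rsubmx {m n k} {D : set R} {x : R -> 'M[R]_(m, n + k)} {t v} :
  hdw D x t v -> hdw D (fun s => rsubmx (x s)) t (rsubmx v).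
Proof.
move=> hx; apply: hdw_mx => i j; rewrite mxE; under eq_fun do rewrite mxE.
exact: (hdw_entry hx).
Qed.

(** The clamped field has a solution for all times, and clamping is the identity while the three
    deviations stay within B. Adding the reference back then gives the closed loop. *)
Lemma truncated_solution B t0 dR x0 z0 : 0 <= B -> 0 <= t0 ->
  exists Rot Om z, [/\ Rot t0 = R0 t0 + dR, Om t0 = Om0 t0 + x0, z t0 = z0 &
    forall s, t0 <= s -> exists dRot dOm dz,
     [/\ hdw `[t0, +oo[ Rot s dRot, hdw `[t0, +oo[ Om s dOm, hdw `[t0, +oo[ z s dz &
       `|Rot s - R0 s| <= B -> `|Om s - Om0 s| <= B -> `|z s| <= B ->
       closed_loop_at J ke kP KD R0 Om0 u0 P Rt Rot Om z s dRot dOm dz]].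
Proof.
move=> B0 t00.
have [y y0 hy] := tame_picard B0 t0 (make_state dR x0 z0) (closed_loop_field_tame B).
have [sR sO sz] := make_stateK dR x0 z0.
exists (fun s => R0 s + state_R (y s)), (fun s => Om0 s + state_Om (y s)), (fun s => state_z (y s)).
rewrite y0 sR sO sz; split=> // s st; have s0 : 0 <= s := le_trans t00 st.
have sub : (`[t0, +oo[%classic : set R) `<=` `[0, +oo[%classic.
  by move=> a /=; rewrite !in_itv /= !andbT; exact: le_trans.
have s0' : (`[0, +oo[%classic : set R) s by rewrite /= in_itv /= s0.
have hRs := hdw_subset sub (hR0 s0'); have hOs := hdw_subset sub (hO0 s0').
have hys := hdw_subset (@subsetT _ (`[t0, +oo[%classic : set R)) (hy s st).
set v := closed_loop_field _ _ in hys.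
exists (rigid_body_R (R0 s) (Om0 s) + state_R v),
  (rigid_body_Om J (Om0 s) (u0 s) + state_Om v), (state_z v); split.
- exact: (hdwD hRs (hdw_lsubmx hys)).
- exact: (hdwD hOs (hdw_lsubmx (hdw_rsubmx hys))).
- have h2 := hdw_rsubmx (hdw_rsubmx hys).
  exact: (hdw_col_mx (hdw_lsubmx h2) (hdw_rsubmx h2)).
rewrite ![_ + state_R (y s)]addrC ![_ + state_Om (y s)]addrC !addrK => bR bO bz.
have yB := norm_state bR bO bz.
have cl : map_mx (clamp (B := B)) (y s) = y s.
  by apply/matrixP => i j; rewrite mxE clamp_id//; exact: le_trans (norm_entry _ _ _) yB.
rewrite /v cl /closed_loop_field (max_idPr s0).
have [-> -> ->] := make_stateK
    (extended_R ke (R0 s + state_R (y s)) (Om0 s + state_Om (y s)) - rigid_body_R (R0 s) (Om0 s))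
    (coupling J (Om0 s) *m state_Om (y s) +
      invmx J *m controller J kP KD (Om0 s) 0 (state_z (y s)) + gyroscopic J (state_Om (y s)))
    (observer J (Om0 s) (P s) (Rt s) (state_z (y s))
      (controller J kP KD (Om0 s) 0 (state_z (y s))) (Zk_vee (R0 s) (R0 s + state_R (y s)))).
split.
- by rewrite addrC subrK.
- rewrite -(controllerB (Om0 s) (u0 s)) -(rigid_body_OmB J (Om0 s) _ _ (u0 s)).
  by rewrite addrC subrK.
- by rewrite controllerB.
Qed.

End TruncatedClosedLoop.

(** * Comparison of the norms in both error coordinates *)

Section ErrorCoordinates.
Context {R : realType}.

(** tr (M^T M) = 3, and 2 is an integer above its square root. *)
Lemma SO3_norm (M : 'M[R]_3) : SO3 M -> `|M| <= 2.
Proof.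
move=> [MtM _]; rewrite -(@ler_pXn2r _ 2) ?nnegrE//.
apply: le_trans (norm_sqr_le_dotm _) _.
by rewrite /dotm MtM mxtrace_scalar -natrX ler_nat.
Qed.

Lemma SO3_norm_mulmx (M D : 'M[R]_3) : SO3 M ->
  `|M^T *m D| <= 6 * `|D| /\ `|D| <= 6 * `|M^T *m D|.
Proof.
move=> hM; have M2 := SO3_norm hM; have [MtM _] := hM.
have mm (A : 'M[R]_3) E : `|A| <= 2 -> `|A *m (E : 'M[R]_3)| <= 6 * `|E|.
  move=> hA; apply: le_trans (norm_mulmx _ _) _.
  have -> : 6 * `|E| = 3%:R * (2 * `|E|) by ring.
  by rewrite ler_wpM2l// ler_wpM2r.
split; first by apply: mm; rewrite norm_trmx.
have MMt : M *m M^T = 1%:M by exact: mulmx1C.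
by rewrite -[X in `|X| <= _]mul1mx -MMt -mulmxA; exact: mm.
Qed.

Lemma norm_triple (A : 'M[R]_3) (x : 'cV[R]_3) (e : 'cV[R]_(3 + 3)) :
  `|(A, x, e)| = Num.max (Num.max `|A| `|x|) `|e|.
Proof. by rewrite !prod_normE. Qed.

Lemma squared_size_norm : exists2 k, 0 < k &
  forall (M D : 'M[R]_3) (x : 'cV[R]_3) (e : 'cV[R]_(3 + 3)), SO3 M ->
    squared_size (M^T *m D) x e <= k * `|(D, x, e)| ^+ 2 /\
    `|(D, x, e)| ^+ 2 <= k * squared_size (M^T *m D) x e.
Proof.
(* A round upper bound: the first estimate needs 9 * 36 + 3 + 6 = 333, the second 36. *)
exists 400; first by rewrite ltr0n.
move=> M D x e hM; have [h1 h2] := SO3_norm_mulmx D hM.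
rewrite norm_triple; set n := Num.max _ _.
have [nD nx ne] : [/\ `|D| <= n, `|x| <= n & `|e| <= n].
  by rewrite /n !le_max !lexx !orbT.
have n0 : 0 <= n := le_trans (normr_ge0 _) nD.
have sq (a b : R) : 0 <= a -> a <= b -> a ^+ 2 <= b ^+ 2.
  by move=> a0 ab; rewrite ler_pXn2r ?nnegrE// (le_trans a0 ab).
set Z := M^T *m D in h1 h2 *.
split.
  have d1 := dotm_le_norm_sqr Z; have d2 := dotm_le_norm_sqr x.
  have d3 := dotm_le_norm_sqr e.
  have e1 : `|Z| ^+ 2 <= (6 * n) ^+ 2 by apply: sq => //; lra.
  have e2 : `|x| ^+ 2 <= n ^+ 2 by exact: sq.
  have e3 : `|e| ^+ 2 <= n ^+ 2 by exact: sq.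
  rewrite (_ : (3 * 3)%:R = 9 :> R)// in d1; rewrite (_ : (3 * 1)%:R = 3 :> R)// in d2.
  rewrite (_ : ((3 + 3) * 1)%:R = 6 :> R)// in d3.
  have E : (6 * n) ^+ 2 = 36 * n ^+ 2 by ring.
  by have := sqr_ge0 n; rewrite /squared_size; lra.
have d1 := norm_sqr_le_dotm Z; have d2 := norm_sqr_le_dotm x.
have d3 := norm_sqr_le_dotm e.
have [g1 g2 g3] := And3 (dotm_ge0 Z) (dotm_ge0 x) (dotm_ge0 e).
have e1 : `|D| ^+ 2 <= 36 * `|Z| ^+ 2.
  have -> : 36 * `|Z| ^+ 2 = (6 * `|Z|) ^+ 2 by ring.
  exact: sq.
have k1 : `|D| ^+ 2 <= 400 * squared_size Z x e by rewrite /squared_size; lra.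
have k2 : `|x| ^+ 2 <= 400 * squared_size Z x e by rewrite /squared_size; lra.
have k3 : `|e| ^+ 2 <= 400 * squared_size Z x e by rewrite /squared_size; lra.
by rewrite /n; case: (leP _ `|e|) => // _; case: (leP `|D|).
Qed.

Lemma squared_size_le1 (Z : 'M[R]_3) (x : 'cV[R]_3) (e : 'cV[R]_(3 + 3)) :
  squared_size Z x e < 1 -> [/\ `|Z| <= 1, `|x| <= 1 & `|e| <= 1].
Proof.
have le1 m n (A : 'M[R]_(m, n)) : dotm A A <= 1 -> `|A| <= 1.
  move=> hA; rewrite -(@ler_pXn2r _ 2) ?nnegrE// expr1n.
  exact: le_trans (norm_sqr_le_dotm A) hA.
have [g1 g2 g3] := And3 (dotm_ge0 Z) (dotm_ge0 x) (dotm_ge0 e).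
by rewrite /squared_size => h; split; apply: le1; lra.
Qed.

End ErrorCoordinates.

Theorem theorem5 (R : realType) (J : 'M[R]_3) (ke kP : R) (KD : 'M[R]_3)
    (R0 : R -> 'M[R]_3) (Om0 u0 : R -> 'cV[R]_3)
    (P Q : R -> 'M[R]_(3 + 3)) (Rt : R -> 'M[R]_3)
    (gamma1 gamma2 gamma3 gamma4 : R) :
  sym_posdef J ->
  0 < ke ->
  (forall t : R, 0 <= t -> SO3 (R0 t)) ->
  [bounded (R0 t, Om0 t) | t in `[0, +oo[] ->
  [bounded u0 t | t in `[0, +oo[] ->
  solves_on `[0, +oo[ R0 (fun t => rigid_body_R (R0 t) (Om0 t)) ->
  solves_on `[0, +oo[ Om0 (fun t => rigid_body_Om J (Om0 t) (u0 t)) ->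
  0 < gamma1 -> 0 < gamma2 -> 0 < gamma3 -> 0 < gamma4 ->
  {within `[0, +oo[, continuous Q} ->
  {within `[0, +oo[, continuous Rt} ->
  (forall t : R, 0 <= t -> (Q t)^T = Q t) ->
  (forall t : R, 0 <= t -> (Rt t)^T = Rt t) ->
  (forall t : R, 0 <= t ->
     loewner_le gamma1%:M (Q t) /\ loewner_le (Q t) gamma2%:M) ->
  (forall t : R, 0 <= t ->
     loewner_le gamma3%:M (Rt t) /\ loewner_le (Rt t) gamma4%:M) ->
  (P 0)^T = P 0 ->
  loewner_le 0 (P 0) ->
  solves_on `[0, +oo[ P (fun t => riccati J (Om0 t) (Q t) (Rt t) (P t)) ->
  0 < kP ->
  sym_posdef KD ->
  (exists2 T : R, 0 < T & forall t : R, 0 <= t -> Om0 (t + T) = Om0 t) ->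
  exponentially_stable (error_solution J ke kP KD R0 Om0 u0 P Rt).
Proof.
move=> pJ ke0 hSO hb _ hR0 hO0 g1 g2 g3 g4 _ cR symQ symR hQ hR P0s P0ge hP kP0 pKD _.
have [w hO] : exists w, forall t, 0 <= t -> `|Om0 t| <= w.
  have [M [_ hM]] := hb; exists (M + 1) => t t0.
  have := hM (M + 1) _ t; rewrite ltrDl ltr01 => /(_ isT).
  rewrite /= in_itv /= t0 prod_normE ge_max => /(_ isT) /andP[_]; exact.
have cRt := within_forward_continuous cR.
have cO := hdw_forward_continuous hO0.
have [p p0 hp] := covariance_bound hO cO cRt g1 g2 g3 g4 symQ symR hQ hR P0s P0ge hP.
have nP t : 0 <= t -> `|P t| <= p.
  by move=> t0; have [sP h] := hp t t0; apply: norm_le_of_quad => //; exact: ltW.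
have cP := hdw_forward_continuous hP.
have nRi := noise_inv_norm g3 hR.
have cRi := noise_inv_continuous cRt g3 hR.
have [U [rho [m1 [m2 [la [rho0 m10 m20 la0 [hU [rhom hdecay]]]]]]]] :=
  error_decay pJ ke0 hSO hO hR0 hO0 g1 g2 g3 g4 cRt symQ symR hQ hR P0s P0ge hP kP0 pKD.
have [k k0 hk] := @squared_size_norm R.
(* Passing from the norm to the energy and back costs k m2 at time t0 and k / m1 at time t. All this
   concerns squares, hence the square roots and the rate la / 2. The radius given by [c2] places the
   initial energy below rho. *)
pose k2 := k * k * m2 / m1.
have k20 : 0 < k2 by rewrite /k2 divr_gt0// !mulr_gt0.
pose c2 := rho / (k * m2).
have c20 : 0 < c2 by rewrite /c2 divr_gt0// mulr_gt0.
exists (Num.sqrt c2), (Num.sqrt k2), (la / 2); split;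
  [by rewrite sqrtr_gt0 | by rewrite sqrtr_gt0 | by rewrite divr_gt0 |].
move=> t0 t00.
have Ustart D x e : `|(D, x, e)| < Num.sqrt c2 -> U t0 ((R0 t0)^T *m D) x e < rho.
  move=> hx; have /andP[_ h] := hU t0 ((R0 t0)^T *m D) x e t00; apply: le_lt_trans h _.
  have [h _] := hk _ D x e (hSO t0 t00).
  apply: (@le_lt_trans _ _ (m2 * (k * `|(D, x, e)| ^+ 2))); first by rewrite ler_wpM2l// ltW.
  have : `|(D, x, e)| ^+ 2 < c2.
    rewrite -[ltRHS]sqr_sqrtr ?(ltW c20)//.
    by rewrite ltr_pXn2r ?nnegrE ?sqrtr_ge0.
  rewrite /c2 ltr_pdivlMr ?mulr_gt0// => h'.
  by apply: le_lt_trans h'; rewrite le_eqVlt; apply/orP; left; apply/eqP; ring.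
split.
  move=> [[dR x0] e0] hxi.
  (* The observer is started so that the estimation error at t0 equals e0. *)
  pose z0 := col_mx (Zk_vee (R0 t0) (R0 t0 + dR)) x0 - e0.
  have [Rot [Om [z [Rot0 Om00 z00 hsol]]]] :=
    truncated_solution ke kP KD (fun t t0 => SO3_norm (hSO t t0)) hO nP nRi cP cRi
      hR0 hO0 dR x0 z0 (ler0n R 6) t00.
  pose V s := U s (attitude_error R0 Rot s) (Om s - Om0 s) (observer_error R0 Om0 Rot Om z s).
  have V0 : V t0 < rho.
    have E m n (a b : 'M[R]_(m, n)) : a + b - a = b by rewrite [a + b]addrC addrK.
    rewrite /V /attitude_error /observer_error Rot0 Om00 z00 /z0 !E subKr.
    exact: Ustart.
  (* Origin of the clamping radius 6: V < rho <= m1 forces the squared size below 1, so Z, x and e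
     have norm at most 1. Then |R - R0| <= 6, and z has norm at most 2. *)
  have Vn r : t0 <= r -> V r < rho ->
      [/\ `|Rot r - R0 r| <= 6, `|Om r - Om0 r| <= 6 & `|z r| <= 6].
    move=> tr Vr; have r0 := le_trans t00 tr.
    have /andP[hV _] := hU r (attitude_error R0 Rot r) (Om r - Om0 r)
        (observer_error R0 Om0 Rot Om z r) r0.
    rewrite -/(V r) in hV.
    have [|nZ nx ne] := @squared_size_le1 R (attitude_error R0 Rot r) (Om r - Om0 r)
        (observer_error R0 Om0 Rot Om z r).
      rewrite -(ltr_pM2l m10) mulr1; apply: lt_le_trans rhom; exact: le_lt_trans hV Vr.
    split.
    - have [_ h] := SO3_norm_mulmx (Rot r - R0 r) (hSO r r0); apply: le_trans h _.
      by rewrite -[leRHS]mulr1 ler_wpM2l.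
    - by apply: le_trans nx _; rewrite ler1n.
    - have -> : z r = col_mx (skewv (attitude_error R0 Rot r)) (Om r - Om0 r)
          - observer_error R0 Om0 Rot Om z r by rewrite /observer_error subKr.
      apply: le_trans (ler_normB _ _) _.
      have : `|col_mx (skewv (attitude_error R0 Rot r)) (Om r - Om0 r)| <= 1.
        apply: norm_mx_le => // i j; rewrite mxE; case: splitP => l _.
          apply: le_trans (norm_entry _ _ _) _; exact: le_trans (norm_skewv _) nZ.
        exact: le_trans (norm_entry _ _ _) nx.
      by lra.
  (* No circularity: [error_decay] asks for the closed loop only where V < rho, and there clamping
     is inactive by [Vn]. Hence V never exceeds its initial value. *)
  have Vlt s : t0 <= s -> V s < rho.
    move=> st; have := hdecay t0 s Rot Om z t00 st _ V0; rewrite -/(V s) -/(V t0) => H.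
    apply: le_lt_trans V0; apply: le_trans (H _) _; last first.
      rewrite ler_piMr//; last by rewrite -expR0 ler_expR mulNr oppr_le0 mulr_ge0 ?subr_ge0// ltW.
      have /andP[h _] := hU t0 (attitude_error R0 Rot t0) (Om t0 - Om0 t0)
        (observer_error R0 Om0 Rot Om z t0) t00.
      apply: le_trans h; rewrite mulr_ge0 ?(ltW m10)//.
      by rewrite !addr_ge0 ?dotm_ge0.
    move=> r /andP[tr rs]; have r0 := le_trans t00 tr.
    have sub : (`[t0, s]%classic : set R) `<=` `[t0, +oo[%classic.
      by move=> a /=; rewrite !in_itv /= => /andP[->].
    have [d1 [d2 [d3 [h1 h2 h3 hcl]]]] := hsol r tr.
    exists d1, d2, d3; split; [exact: (hdw_subset sub h1) | exact: (hdw_subset sub h2)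
      | exact: (hdw_subset sub h3) |].
    by rewrite -/(V r) => /(Vn r tr)[n1 n2 n3]; exact: hcl.
  exists (fun t => (Rot t - R0 t, Om t - Om0 t, observer_error R0 Om0 Rot Om z t)); last first.
    have E m n (a b : 'M[R]_(m, n)) : a + b - a = b by rewrite [a + b]addrC addrK.
    by rewrite /observer_error Rot0 Om00 z00 /z0 !E subKr.
  exists Rot, Om, z; split=> //.
  have sub : horizon t0 +oo `<=` `[t0, +oo[%classic.
    by move=> a [ta _]; rewrite /= in_itv /= andbT.
  have cl t : horizon t0 +oo t -> exists d1 d2 d3,
      [/\ has_derivative_within (horizon t0 +oo) Rot t d1,
        has_derivative_within (horizon t0 +oo) Om t d2,
        has_derivative_within (horizon t0 +oo) z t d3 &
        closed_loop_at J ke kP KD R0 Om0 u0 P Rt Rot Om z t d1 d2 d3].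
    move=> [tt _]; have [d1 [d2 [d3 [h1 h2 h3 hcl]]]] := hsol t tt.
    have [n1 n2 n3] := Vn t tt (Vlt t tt); exists d1, d2, d3.
    by split; [exact: (hdw_subset sub h1) | exact: (hdw_subset sub h2)
      | exact: (hdw_subset sub h3) | exact: hcl].
  by split=> t /cl[d1 [d2 [d3 [h1 h2 h3 [e1 e2 e3]]]]];
    [rewrite -e1 | rewrite -e2 | rewrite -e3].
(* The estimate concerns an arbitrary solution, which satisfies the closed loop throughout its
   horizon, so the decay applies on [t0, t] directly. *)
move=> T xi [Rot [Om [z [[hRot hOm hz] hxi]]]] xi0 t [t0t tT].
have t0D : horizon t0 T t0 by split; rewrite ?lexx//; apply: le_lt_trans tT; rewrite lee_fin.
have t0' := le_trans t00 t0t.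
pose V s := U s (attitude_error R0 Rot s) (Om s - Om0 s) (observer_error R0 Om0 Rot Om z s).
have V0 : V t0 < rho by apply: Ustart; rewrite -/(observer_error R0 Om0 Rot Om z t0) -hxi.
have sub : (`[t0, t]%classic : set R) `<=` horizon t0 T.
  move=> a /=; rewrite in_itv /= => /andP[h1 h2]; split=> //.
  by apply: le_lt_trans tT; rewrite lee_fin.
have hV : V t <= V t0 * expR (- la * (t - t0)).
  apply: hdecay => // s st; have Ds : (`[t0, t]%classic : set R) s by rewrite /= in_itv.
  by eexists; eexists; eexists; split; [exact: (hdw_subset sub (hRot s (sub s Ds)))
    | exact: (hdw_subset sub (hOm s (sub s Ds))) | exact: (hdw_subset sub (hz s (sub s Ds))) |].
rewrite -(@ler_pXn2r _ 2) ?nnegrE ?mulr_ge0 ?expR_ge0 ?sqrtr_ge0//.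
have -> : (Num.sqrt k2 * `|xi t0| * expR (- (la / 2) * (t - t0))) ^+ 2 =
    k2 * `|xi t0| ^+ 2 * expR (- la * (t - t0)).
  rewrite !exprMn sqr_sqrtr ?(ltW k20)// -expRM_natl; congr (_ * expR _).
  by field.
rewrite !hxi//.
have [_ h1] := hk _ (Rot t - R0 t) (Om t - Om0 t) (observer_error R0 Om0 Rot Om z t) (hSO t t0').
have [h2 _] := hk _ (Rot t0 - R0 t0) (Om t0 - Om0 t0)
  (observer_error R0 Om0 Rot Om z t0) (hSO t0 t00).
apply: le_trans h1 _.
have /andP[h3 _] := hU t (attitude_error R0 Rot t) (Om t - Om0 t)
        (observer_error R0 Om0 Rot Om z t) t0'.
have /andP[_ h4] := hU t0 (attitude_error R0 Rot t0) (Om t0 - Om0 t0)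
        (observer_error R0 Om0 Rot Om z t0) t00.
rewrite -/(V t) in h3; rewrite -/(V t0) in h4.
have h5 : m1 * squared_size (attitude_error R0 Rot t) (Om t - Om0 t)
     (observer_error R0 Om0 Rot Om z t)
   <= m2 * (k * `|(Rot t0 - R0 t0, Om t0 - Om0 t0, observer_error R0 Om0 Rot Om z t0)| ^+ 2)
     * expR (- la * (t - t0)).
  apply: le_trans h3 _; apply: le_trans hV _; rewrite ler_wpM2r ?expR_ge0//.
  by apply: le_trans h4 _; rewrite ler_wpM2l// ltW.
rewrite -(ler_pM2l m10) mulrCA; apply: le_trans (ler_wpM2l (ltW k0) h5) _.
rewrite le_eqVlt; apply/orP; left; apply/eqP; rewrite /k2 /observer_error.
by field; rewrite gt_eqF.
Qed.
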